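(* Let $(M,D)$ be an affine manifold, let $N=T^*M$, let $g_N$ be the modified Riemannian extension metric on $N$, and let $\mathfrak{J}$ be the canonical almost para-Hermitian structure on $(N,g_N)$. The following conditions are equivalent: (1) $(M,D)$ is flat. (2) $(N,g_N,\mathfrak{J})$ is integrable. (3) $(N,g_N,\mathfrak{J})$ satisfies the third Gray identity. (4) $\mathfrak{J}\,{}^{g_N}\mathcal{J}(\pi)={}^{g_N}\mathcal{J}(\pi)\,\mathfrak{J}$ for all $\pi\in\mathcal{P}(N)$.
   Context: An affine manifold $(M,D)$ is a smooth $n$-dimensional manifold $M$ with a torsion-free connection $D$ on $TM$; it is flat if its curvature ${}^DR(X,Y)=D_XD_Y-D_YD_X-D_{[X,Y]}$ vanishes identically. For a pseudo-Riemannian metric $g$, ${}^gR$ (of the Levi-Civita connection) has the same sign convention, ${}^gR(X,Y,Z,W)=g({}^gR(X,Y)Z,W)$, and ${}^g\mathcal{J}(X):Y\mapsto {}^gR(Y,X)X$. Modified Riemannian extension: let $N=T^*M$. Local coordinates $(x_1,\dots,x_n)$ on $M$ induce coordinates $(x_1,\dots,x_n,x_{1'},\dots,x_{n'})$ on $N$ by writing a 1-form as $\omega=x_{i'}dx^i$ (Einstein summation). Write $D_{\partial_{x_i}}\partial_{x_j}={}^D\Gamma_{ij}{}^k\partial_{x_k}$ and $u\circ v=\frac12(u\otimes v+v\otimes u)$. Then $g_N$ is the (globally well-defined) metric of neutral signature $(n,n)$ on $N$ given locally by $g_N=2\,dx^i\circ dx^{i'}+\{x_{i'}x_{j'}-2x_{k'}{}^D\Gamma_{ij}{}^k\}dx^i\circ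 dx^j$. The canonical almost para-Hermitian structure $\mathfrak{J}$ (an endomorphism of $TN$ with $\mathfrak{J}^2=\mathrm{Id}$ and $\mathfrak{J}^*g_N=-g_N$) is given locally by $\mathfrak{J}\partial_{x_i}=\partial_{x_i}-\{x_{i'}x_{j'}-2x_{k'}{}^D\Gamma_{ij}{}^k\}\partial_{x_{j'}}$, $\mathfrak{J}\partial_{x_{i'}}=-\partial_{x_{i'}}$. $(N,g_N,\mathfrak{J})$ is integrable if around every point there are local coordinates $(u_1,\dots,u_n,v_1,\dots,v_n)$ with $\mathfrak{J}\partial_{u_i}=\partial_{v_i}$ and $\mathfrak{J}\partial_{v_i}=\partial_{u_i}$; equivalently, the Nijenhuis tensor $N_{\mathfrak{J}}(X,Y)=[X,Y]-\mathfrak{J}[\mathfrak{J}X,Y]-\mathfrak{J}[X,\mathfrak{J}Y]+[\mathfrak{J}X,\mathfrak{J}Y]$ vanishes. It satisfies the third Gray identity if ${}^{g_N}R(X,Y,Z,W)={}^{g_N}R(\mathfrak{J}X,\mathfrak{J}Y,\mathfrak{J}Z,\mathfrak{J}W)$ for all $X,Y,Z,W$. $\mathcal{P}(N)$ is the bundle over $N$ of $g_N$-non-degenerate $\mathfrak{J}$-invariant tangent 2-planes. For $\pi\in\mathcal{P}(N)$ choose $\xi\in\pi$ with $g_N(\xi,\xi)=1$; the para-complex Jacobi operator is ${}^{g_N}\mathcal{J}(\pi):={}^{g_N}\mathcal{J}(\xi)-{}^{g_N}\mathcal{J}(\mathfrak{J}\xi)$, which is independent of the choice of $\xi$. *)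

(* Defs.v *)
From HB Require Import structures.
From mathcomp Require Import all_boot all_order all_algebra.
From mathcomp Require Import all_classical all_reals all_analysis.
Set Implicit Arguments.
Unset Strict Implicit.
Unset Printing Implicit Defensive.
Import Order.TTheory GRing.Theory Num.Theory.
Import numFieldNormedType.Exports.
Local Open Scope classical_set_scope.
Local Open Scope ring_scope.

(** * Calculus on open subsets of R^m *)

Definition partial (R : realType) (m : nat) (i : 'I_m) (f : 'rV[R]_m -> R) :
    'rV[R]_m -> R :=
  fun x => 'D_(delta_mx 0 i) f x.

Definition iter_partial (R : realType) (m : nat) (s : seq 'I_m)
    (f : 'rV[R]_m -> R) : 'rV[R]_m -> R :=
  foldr (@partial R m) f s.

(* C^infinity on an open set: all iterated partial derivatives exist there and
   are continuous.  Only used for open U. *)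
Definition smooth_on (R : realType) (m : nat) (U : set 'rV[R]_m)
    (f : 'rV[R]_m -> R) : Prop :=
  forall (s : seq 'I_m) (x : 'rV[R]_m), U x ->
    {for x, continuous (iter_partial s f)} /\
    forall i : 'I_m, derivable (iter_partial s f) x (delta_mx 0 i).

Definition smooth_map (R : realType) (m k : nat) (U : set 'rV[R]_m)
    (F : 'rV[R]_m -> 'rV[R]_k) : Prop :=
  forall j : 'I_k, smooth_on U (fun x => F x 0 j).

Definition partial_map (R : realType) (m k : nat) (i : 'I_m)
    (F : 'rV[R]_m -> 'rV[R]_k) : 'rV[R]_m -> 'rV[R]_k :=
  fun x => \row_j partial i (fun y => F y 0 j) x.

(** * Connections and metrics in local coordinates

   A vector field is given by its components in the frame d/dx_i, so it is a
   function 'rV_m -> 'rV_m.  A connection D is given by its Christoffel symbols,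
   [G x i j k] being the coefficient of d/dx_k in D_{d/dx_i} d/dx_j at x. *)

Definition christoffel (R : realType) (m : nat) : Type :=
  'rV[R]_m -> 'I_m -> 'I_m -> 'I_m -> R.

Definition bracket (R : realType) (m : nat) (X Y : 'rV[R]_m -> 'rV[R]_m) :
    'rV[R]_m -> 'rV[R]_m :=
  fun x => \sum_i (X x 0 i *: partial_map i Y x - Y x 0 i *: partial_map i X x).

Definition covd (R : realType) (m : nat) (G : christoffel R m)
    (X Y : 'rV[R]_m -> 'rV[R]_m) : 'rV[R]_m -> 'rV[R]_m :=
  fun x => \sum_i X x 0 i *: partial_map i Y x
           + \row_k \sum_i \sum_j G x i j k * X x 0 i * Y x 0 j.

Definition torsion (R : realType) (m : nat) (G : christoffel R m)
    (X Y : 'rV[R]_m -> 'rV[R]_m) : 'rV[R]_m -> 'rV[R]_m :=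
  fun x => covd G X Y x - covd G Y X x - bracket X Y x.

Definition curvature (R : realType) (m : nat) (G : christoffel R m)
    (X Y Z : 'rV[R]_m -> 'rV[R]_m) : 'rV[R]_m -> 'rV[R]_m :=
  fun x => covd G X (covd G Y Z) x - covd G Y (covd G X Z) x
           - covd G (bracket X Y) Z x.

Definition pairing (R : realType) (m : nat) (g : 'M[R]_m)
    (u v : 'rV[R]_m) : R :=
  (u *m g *m v^T) 0 0.

(* Christoffel symbols of the Levi-Civita connection of the metric with Gram
   matrix g x in the coordinate frame:
   1/2 g^{kl} (d_i g_{jl} + d_j g_{il} - d_l g_{ij}). *)
Definition levi_civita (R : realType) (m : nat) (g : 'rV[R]_m -> 'M[R]_m) :
    christoffel R m :=
  fun x i j k => 2^-1 * \sum_l invmx (g x) k l *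
    (partial i (fun y => g y j l) x + partial j (fun y => g y i l) x
     - partial l (fun y => g y i j) x).

(* The curvature tensor of g at the point x: the tangent vectors X, Y, Z at x
   are extended by constant components, which is harmless since the curvature
   is tensorial. *)
Definition riemann (R : realType) (m : nat) (g : 'rV[R]_m -> 'M[R]_m)
    (x : 'rV[R]_m) (X Y Z : 'rV[R]_m) : 'rV[R]_m :=
  curvature (levi_civita g) (cst X) (cst Y) (cst Z) x.

Definition riemann4 (R : realType) (m : nat) (g : 'rV[R]_m -> 'M[R]_m)
    (x : 'rV[R]_m) (X Y Z W : 'rV[R]_m) : R :=
  pairing (g x) (riemann g x X Y Z) W.

Definition jacobi (R : realType) (m : nat) (g : 'rV[R]_m -> 'M[R]_m)
    (x : 'rV[R]_m) (X : 'rV[R]_m) : 'rV[R]_m -> 'rV[R]_m :=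
  fun Y => riemann g x Y X X.

(** * Smooth manifolds, affine manifolds, cotangent bundles *)

(* [chart_inv a] is the inverse of [chart_map a]; both are only meaningful on
   [chart_dom a] and its image [chart_map a @` chart_dom a].  The atlas
   need not be maximal. *)
Record manifold (R : realType) (n : nat) := Manifold {
  carrier :> topologicalType;
  mfd_hausdorff : hausdorff_space carrier;
  mfd_second_countable : @second_countable carrier;
  chart : Type;
  chart_dom : chart -> set carrier;
  chart_map : chart -> carrier -> 'rV[R]_n;
  chart_inv : chart -> 'rV[R]_n -> carrier;
  chart_dom_cover : forall p : carrier, exists a, chart_dom a p;
  chart_dom_open : forall a, open (chart_dom a);
  chart_image_open : forall a, open (chart_map a @` chart_dom a);
  chart_mapK : forall a p, chart_dom a p -> chart_inv a (chart_map a p) = p;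
  chart_map_continuous : forall a p, chart_dom a p ->
    {for p, continuous (chart_map a)};
  chart_inv_continuous : forall a x, (chart_map a @` chart_dom a) x ->
    {for x, continuous (chart_inv a)};
  transition_smooth : forall a b,
    smooth_map (chart_map a @` (chart_dom a `&` chart_dom b))
      (chart_map b \o chart_inv a)
}.

Definition transition (R : realType) (n : nat) (M : manifold R n)
    (a b : chart M) : 'rV[R]_n -> 'rV[R]_n :=
  chart_map b \o chart_inv a.

(* A torsion-free connection on TM.  In [gamma_transition], y = transition a b
   and the identity is the d/dy_r-component of D_{d/dx_i} d/dx_j, computed in
   the coordinates x of a and in the coordinates y of b. *)
Record affine_manifold (R : realType) (n : nat) := AffineManifold {
  base_mfd :> manifold R n;
  gamma : chart base_mfd -> christoffel R n;
  gamma_smooth : forall a i j k,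
    smooth_on (chart_map a @` chart_dom a) (fun x => gamma a x i j k);
  gamma_transition : forall a b x i j r,
    (chart_map a @` (chart_dom a `&` chart_dom b)) x ->
    let y := transition a b in
    \sum_k gamma a x i j k * partial k (fun t => y t 0 r) x =
    partial i (partial j (fun t => y t 0 r)) x
    + \sum_p \sum_q gamma b (y x) p q r
        * partial i (fun t => y t 0 p) x * partial j (fun t => y t 0 q) x;
  gamma_torsion_free : forall a (X Y : 'rV[R]_n -> 'rV[R]_n),
    smooth_map (chart_map a @` chart_dom a) X ->
    smooth_map (chart_map a @` chart_dom a) Y ->
    forall x, (chart_map a @` chart_dom a) x -> torsion (gamma a) X Y x = 0
}.

(* A point of T^*M: a point p of M and a 1-form at p, the latter given by its
   components (x_{1'}, ..., x_{n'}) in each chart around p. *)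
Record cotangent (R : realType) (n : nat) (M : manifold R n) := Cotangent {
  foot : M;
  form : chart M -> 'rV[R]_n;
  form_transition : forall a b i, chart_dom a foot -> chart_dom b foot ->
    form a 0 i =
      \sum_j partial i (fun t => transition a b t 0 j) (chart_map a foot)
             * form b 0 j;
  (* normalisation making equality of records the equality of covectors *)
  form_out : forall a, ~ chart_dom a foot -> form a = 0
}.

(* The induced coordinates (x_1, ..., x_n, x_{1'}, ..., x_{n'}) on T^*M. *)
Definition cot_coord (R : realType) (n : nat) (M : manifold R n) (a : chart M)
    (z : cotangent M) : 'rV[R]_(n + n) :=
  row_mx (chart_map a (foot z)) (form z a).

Definition cot_image (R : realType) (n : nat) (M : manifold R n) (a : chart M) :
    set 'rV[R]_(n + n) :=
  [set w | (chart_map a @` chart_dom a) (lsubmx w)].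

(** * The modified Riemannian extension

   In each induced chart, tangent vectors of T^*M are the row vectors of their
   components in the frame (d/dx_1, ..., d/dx_n, d/dx_{1'}, ..., d/dx_{n'}). *)

Definition ext_block (R : realType) (n : nat) (M : affine_manifold R n)
    (a : chart M) (w : 'rV[R]_(n + n)) : 'M[R]_n :=
  let x := lsubmx w in let x' := rsubmx w in
  \matrix_(i, j) (x' 0 i * x' 0 j - 2 * \sum_k x' 0 k * gamma a x i j k).

Definition ext_metric (R : realType) (n : nat) (M : affine_manifold R n)
    (a : chart M) (w : 'rV[R]_(n + n)) : 'M[R]_(n + n) :=
  block_mx (ext_block a w) 1%:M 1%:M 0.

Definition para_J (R : realType) (n : nat) (M : affine_manifold R n)
    (a : chart M) (w : 'rV[R]_(n + n)) (v : 'rV[R]_(n + n)) : 'rV[R]_(n + n) :=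
  v *m block_mx 1%:M (- ext_block a w) 0 (- 1%:M).

(* J-invariant, g_N-non-degenerate tangent 2-planes at a point *)
Definition para_plane (R : realType) (n : nat) (M : affine_manifold R n)
    (a : chart M) (w : 'rV[R]_(n + n)) (P : {vspace 'rV[R]_(n + n)}) : Prop :=
  [/\ \dim P = 2%N,
      forall v, v \in P -> para_J a w v \in P
    & forall u, u \in P ->
        (forall v, v \in P -> pairing (ext_metric a w) u v = 0) -> u = 0].

Definition para_jacobi (R : realType) (n : nat) (M : affine_manifold R n)
    (a : chart M) (w : 'rV[R]_(n + n)) (xi : 'rV[R]_(n + n)) :
    'rV[R]_(n + n) -> 'rV[R]_(n + n) :=
  fun Y => jacobi (ext_metric a) w xi Y
           - jacobi (ext_metric a) w (para_J a w xi) Y.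

(* F = (u_1, ..., u_n, v_1, ..., v_n) is a system of local coordinates on V,
   with inverse G.  V is a subset of the domain of the induced chart a, so that
   the coordinate vector fields of F, written in that chart, are the partial
   derivatives of G at F w. *)
Definition local_coordinates (R : realType) (m : nat) (V : set 'rV[R]_m)
    (F G : 'rV[R]_m -> 'rV[R]_m) : Prop :=
  [/\ open V, open (F @` V), smooth_map V F, smooth_map (F @` V) G
    & forall w, V w -> G (F w) = w].

(** * The four conditions

   All the tensors are given chartwise; conditions at a point z of T^*M are
   required in every induced chart around z. *)

Definition flat (R : realType) (n : nat) (M : affine_manifold R n) : Prop :=
  forall (a : chart M) (X Y Z : 'rV[R]_n -> 'rV[R]_n),
    smooth_map (chart_map a @` chart_dom a) X ->
    smooth_map (chart_map a @` chart_dom a) Y ->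
    smooth_map (chart_map a @` chart_dom a) Z ->
    forall x, (chart_map a @` chart_dom a) x -> curvature (gamma a) X Y Z x = 0.

Definition integrable_para (R : realType) (n : nat) (M : affine_manifold R n) :
    Prop :=
  forall (z : cotangent M) (a : chart M), chart_dom a (foot z) ->
    exists (V : set 'rV[R]_(n + n)) (F G : 'rV[R]_(n + n) -> 'rV[R]_(n + n)),
      [/\ V (cot_coord a z), V `<=` cot_image a, local_coordinates V F G
        & forall w (i : 'I_n), V w ->
            para_J a w (partial_map (lshift n i) G (F w))
              = partial_map (rshift n i) G (F w) /\
            para_J a w (partial_map (rshift n i) G (F w))
              = partial_map (lshift n i) G (F w)].

Definition third_gray (R : realType) (n : nat) (M : affine_manifold R n) :
    Prop :=
  forall (z : cotangent M) (a : chart M), chart_dom a (foot z) ->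
    let w := cot_coord a z in let J := para_J a w in
    forall X Y Z W : 'rV[R]_(n + n),
      riemann4 (ext_metric a) w X Y Z W
        = riemann4 (ext_metric a) w (J X) (J Y) (J Z) (J W).

(* The operator attached to the plane P does not depend on the unit vector
   xi of P, and each such P contains one. *)
Definition para_jacobi_commutes (R : realType) (n : nat)
    (M : affine_manifold R n) : Prop :=
  forall (z : cotangent M) (a : chart M), chart_dom a (foot z) ->
    let w := cot_coord a z in
    forall P : {vspace 'rV[R]_(n + n)}, para_plane a w P ->
    forall xi, xi \in P -> pairing (ext_metric a w) xi xi = 1 ->
    para_J a w \o para_jacobi a w xi =1 para_jacobi a w xi \o para_J a w.

(* Main.v *)
(* Let E and V be the eigenbundles of J for the eigenvalues 1 and -1: E is spanned
   by e_i = d/dx_i - 1/2 sum_j Phi_ij d/dx_j', where Phi is the coefficient of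
   dx o dx in g_N, and V is the vertical bundle. The Levi-Civita connection of g_N
   preserves V, and modulo V the curvature of g_N on E is the curvature R^D of D.
   - If D is flat, only curvature components with an even number of vertical
     arguments survive, which is the third Gray identity; the latter makes J commute
     with the para-complex Jacobi operators by the symmetries of the curvature.
   - If J commutes with these operators, polarisation shows that R^D(x, y)z is skew
     in y and z, so that R^D = 0 by the Bianchi identity.
   - J is integrable iff locally there are n independent functions p, constant on
     the fibres, and n independent functions q annihilated by the e_i. For such q the
     commutators [e_i, e_k] q = 0 express the vanishing of R^D. Conversely, if D is
     flat with affine coordinates y_a and x'_k = sum_a y'_a dy_a/dx_k, then p = y and
     q = y' / (1 - y . y' / 2) are such functions. *)

Require Import Defs.
From HB Require Import structures.
From mathcomp Require Import all_boot all_order all_algebra.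
From mathcomp Require Import all_classical all_reals all_analysis.
From mathcomp Require Import ring lra.
Set Implicit Arguments.
Unset Strict Implicit.
Unset Printing Implicit Defensive.
Import Order.TTheory GRing.Theory Num.Theory.
Import numFieldNormedType.Exports.
Local Open Scope classical_set_scope.
Local Open Scope ring_scope.

(** * Mean value theorem and functions of class C^k *)

(** The term x'_i x'_j of the metric shapes the computations. It adds to the symbols of D terms
    linear in the covector, so the base components of the curvature contain multiples of Phi even
    for flat D; they cancel only on vectors of E, through their vertical parts. It also gives e_i
    y'_a = - x'_i y'_a / 2: the factor does not depend on a, so y' can be divided by any function
    with the same logarithmic derivatives, and 1 - y . y' / 2 is one that equals 1 over the origin
    of the coordinates y. If J exchanges d/du and d/dv, then p and q are u + v and u - v; conversely
    the inverse function theorem turns p and q into coordinates. The commutator [e_i, e_k] is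
    vertical with coefficients sum_l x'_l R_ikm^l, zero on the zero section, so flatness has to be
    read off at small nonzero covectors. Affine coordinates come from an overdetermined linear
    system for a function and its differential. It is solved by Picard iteration with Poincare's
    homotopy operator, which treats all directions at once and avoids differential equations with
    parameters. *)

Lemma rV_coord_le (R : realType) m (x : 'rV[R]_m) i : `|x 0 i| <= `|x|.
Proof.
rewrite [leRHS]/Num.Def.normr/= mx_normrE.
exact: (le_bigmax _ (fun ij : 'I_1 * 'I_m => `|x ij.1 ij.2|) (0, i)).
Qed.

Lemma rV_norm_le (R : realType) m (x : 'rV[R]_m) e :
  0 <= e -> (forall i, `|x 0 i| <= e) -> `|x| <= e.
Proof.
move=> e0 xe; rewrite [leLHS]/Num.Def.normr/= mx_normrE.
by apply: bigmax_le => // -[i j] _; rewrite ord1.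
Qed.

Lemma rV_norm_lt (R : realType) m (x : 'rV[R]_m) e :
  0 < e -> (forall i, `|x 0 i| < e) -> `|x| < e.
Proof.
move=> e0 xe; rewrite [ltLHS]/Num.Def.normr/= mx_normrE.
by apply: bigmax_lt => // -[i j] _; rewrite ord1.
Qed.

Lemma open_ball_sub (R : realType) m (U : set 'rV[R]_m) x : open U -> U x ->
  exists2 r : R, 0 < r & forall y, `|y - x| < r -> U y.
Proof.
move=> oU Ux; have /nbhs_ballP[r /= r0 rU] := open_nbhs_nbhs (conj oU Ux).
exists r => // y yx; apply: rU; rewrite -ball_normE /ball_ /=.
by rewrite distrC.
Qed.

Lemma open_norm_ball (R : realType) m (x : 'rV[R]_m) r :
  open [set y | `|y - x| < r].
Proof.
rewrite (_ : [set y | _] = ball_ Num.norm x r); last first.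
  by apply/funext => y /=; rewrite /ball_/= distrC.
by rewrite ball_normE; exact: ball_open.
Qed.

Section mean_value.
Context (R : realType).

Lemma is_derive_line (V : normedModType R) (f : V -> R) (x v : V) (t : R) :
  derivable f (t *: v + x) v ->
  is_derive t 1 (fun s : R => f (s *: v + x)) ('D_v f (t *: v + x)).
Proof.
pose g := fun s : R => f (s *: v + x).
have E : (fun h : R => h^-1 *: (g (h *: 1 + t) - g t)) =
         (fun h => h^-1 *: (f (h *: v + (t *: v + x)) - f (t *: v + x))).
  by apply/funext => h; rewrite /g /= [h *: 1]mulr1 scalerDl addrA.
move=> df; apply: DeriveDef; first by rewrite /derivable /= E.
by rewrite /derive /= E.
Qed.

(** The segment is parametrised by [s * h] with [s] in [0, 1], which treats all signs of [h], zero
    included, at once. *)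
Lemma mvt_line (V : normedModType R) (f : V -> R) (x v : V) (h : R) :
  (forall s, 0 <= s <= 1 -> derivable f ((s * h) *: v + x) v) ->
  exists2 s, 0 <= s <= 1 &
    f (h *: v + x) - f x = h * 'D_v f ((s * h) *: v + x).
Proof.
move=> df; pose g := fun s : R => f (s *: v + x).
pose phi := g \o (fun s : R => s * h).
have dg s : 0 <= s <= 1 -> is_derive (s * h) 1 g ('D_v f ((s * h) *: v + x)).
  by move=> s01; apply/is_derive_line/df.
have dphi (s : R) : 0 <= s <= 1 -> is_derive s 1 phi (h * 'D_v f ((s * h) *: v + x)).
  move=> s01; have dgs := dg s s01.
  have dm : derivable (fun s : R => s * h) s 1 by [].
  apply: DeriveDef.
    by apply/derivable1_diffP/differentiable_comp; apply/derivable1_diffP => //;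
      case: dgs.
  have dg' : derivable g (s * h) 1 by case: dgs.
  rewrite -derive1E (derive1_comp dm dg').
  rewrite !derive1E derive_val.
  by rewrite -derive1E derive1Mr // derive1_id mul1r mulrC.
have cphi : {within `[0, 1], continuous phi}.
  apply: derivable_within_continuous => s; rewrite in_itv /= => s01.
  by case: (dphi s s01).
have [||s|s s01] := @MVT_segment R phi (fun s => h * 'D_v f ((s * h) *: v + x)) 0 1.
- exact: ler01.
- by move=> s /[!in_itv]/= /andP[s0 s1]; apply: dphi; rewrite !ltW.
- by [].
rewrite /phi /g /= mul1r mul0r scale0r add0r subr0 mulr1 => ->.
by exists s => //; move: s01; rewrite in_itv.
Qed.

Definition in_box m (y z w : 'rV[R]_m) :=
  forall j, exists2 s, 0 <= s <= 1 & w 0 j = y 0 j + s * (z 0 j - y 0 j).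

(** Going from [y] to [z] one coordinate at a time, the mean value theorem applies on each edge and
    the increments telescope. Only partial derivatives are needed, at the price of a different
    intermediate point for each coordinate. *)
Lemma mvt_box m (f : 'rV[R]_m -> R) (y z : 'rV[R]_m) :
  (forall w, in_box y z w -> forall i, derivable f w 'e_i) ->
  exists2 xi : 'I_m -> 'rV[R]_m, (forall i, in_box y z (xi i)) &
    f z - f y = \sum_i (z 0 i - y 0 i) * partial i f (xi i).
Proof.
move=> df; pose p k : 'rV[R]_m := \row_j (if (j < k)%N then z 0 j else y 0 j).
have p0 : p 0 = y by apply/rowP => j; rewrite mxE.
have pm : p m = z by apply/rowP => j; rewrite mxE ltn_ord.
have boxp (k : 'I_m) s : 0 <= s <= 1 ->
    in_box y z ((s * (z 0 k - y 0 k)) *: 'e_k + p k).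
  move=> s01 j; rewrite !mxE /= [j == k]eq_sym; case: eqVneq => [<-|nkj].
    by exists s => //; rewrite ltnn mulr1 addrC.
  rewrite mulr0 add0r; case: ifP => _.
    by exists 1; [rewrite ler01 lexx|rewrite mul1r addrC subrK].
  by exists 0; [rewrite ler01 lexx|rewrite mul0r addr0].
have H (k : 'I_m) : exists x, in_box y z x /\
    f (p k.+1) - f (p k) = (z 0 k - y 0 k) * partial k f x.
  have [s s01|s s01 E] :=
    @mvt_line _ f (p k) 'e_k (z 0 k - y 0 k).
    by apply: df; apply: boxp.
  exists ((s * (z 0 k - y 0 k)) *: 'e_k + p k); split; first exact: boxp.
  rewrite -E; congr (f _ - _); apply/rowP => j; rewrite !mxE /=.
  rewrite ltnS leq_eqVlt.
  have [->|nkj] := eqVneq j k; first by rewrite eqxx mulr1 ltnn subrK.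
  have /negPf-> : (j : nat) != k by [].
  by rewrite mulr0 add0r.
have /choice[xi xiP] := H.
exists xi; first by move=> i; case: (xiP i).
rewrite -pm -[in LHS]p0 -(telescope_sumr (fun k => f (p k)) (leq0n m)) big_mkord.
by apply: eq_bigr => i _; rewrite pm; case: (xiP i) => _ ->.
Qed.

(** Balls of the sup norm are boxes, so they contain the box spanned by any two of their points. *)
Lemma in_box_ball m (x y z w : 'rV[R]_m) r : in_box y z w ->
  `|y - x| < r -> `|z - x| < r -> `|w - x| < r.
Proof.
move=> b yr zr; have r0 : 0 < r by apply: le_lt_trans yr.
apply: rV_norm_lt => // j; rewrite !mxE.
have := le_lt_trans (rV_coord_le _ j) yr; rewrite !mxE.
have := le_lt_trans (rV_coord_le _ j) zr; rewrite !mxE !ltr_norml.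
have [s /andP[s0 s1] ->] := b j.
move=> /andP[a b'] /andP[c d]; have s1' : 0 <= 1 - s by rewrite subr_ge0.
have E : y 0 j + s * (z 0 j - y 0 j) - x 0 j =
  (1 - s) * (y 0 j - x 0 j) + s * (z 0 j - x 0 j) by ring.
have [s0'|s0'] := ltP 0 s; last first.
  have -> : s = 0 by apply/eqP; rewrite eq_le s0 s0'.
  by rewrite mul0r addr0 c d.
by rewrite E; apply/andP; split; nra.
Qed.

End mean_value.

(** * Functions of class C^k *)

Section Ck.
Context (R : realType) (m : nat).
Implicit Types (U V : set 'rV[R]_m) (f g : 'rV[R]_m -> R).

(** A finite-order counterpart of [smooth_on], recursive on the order, so that stability under
    products, quotients and composition can be proved by induction on [k]. *)
Fixpoint Ck (k : nat) U f : Prop :=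
  (forall x, U x -> {for x, continuous f}) /\
  if k is k'.+1 then
    forall i, (forall x, U x -> derivable f x 'e_i) /\
              Ck k' U (partial i f)
  else True.

Lemma Ck_continuous k U f x : Ck k U f -> U x -> {for x, continuous f}.
Proof. by case: k => [|k] [+ _]; apply. Qed.

Lemma CkS_derivable k U f x i : Ck k.+1 U f -> U x ->
  derivable f x 'e_i.
Proof. by move=> [_ /(_ i)[+ _]]; apply. Qed.

Lemma CkS_partial k U f i : Ck k.+1 U f -> Ck k U (partial i f).
Proof. by move=> [_ /(_ i)[]]. Qed.

Lemma CkW k U f : Ck k.+1 U f -> Ck k U f.
Proof.
elim: k f => [|k IH] f [cf df]; split=> // i.
by have [d c] := df i; split=> //; apply: IH.
Qed.

Lemma Ck_sub k U V f : V `<=` U -> Ck k U f -> Ck k V f.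
Proof.
move=> VU; elim: k f => [|k IH] f [cf df]; split=> //.
- by move=> x /VU; apply: cf.
- by move=> x /VU; apply: cf.
- by move=> i; have [d c] := df i; split; [move=> x /VU; apply: d|apply: IH].
Qed.

Lemma smooth_onP U f : smooth_on U f <-> forall k, Ck k U f.
Proof.
have rc s i : @iter_partial R m (rcons s i) f = iter_partial s (partial i f).
  by rewrite /iter_partial foldr_rcons.
split=> [+ k|].
  elim: k f {rc} => [|k IH] f sf.
    by split=> // x Ux; have [] := sf [::] x Ux.
  split=> [x Ux|i]; first by have [] := sf [::] x Ux.
  split=> [x Ux|]; first by have [_] := sf [::] x Ux; apply.
  apply: IH => s x Ux; have := sf (rcons s i) x Ux.
  by rewrite /iter_partial foldr_rcons.
move=> H s x Ux; have {H} := H (size s).+1.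
(* [foldr] applies the last index of the sequence first, so the induction peels indices off from the
   right. *)
elim/last_ind: s f {rc} => [|s i IH] f H.
  by split=> [|i]; [apply: Ck_continuous H _|apply: CkS_derivable H _].
rewrite /iter_partial foldr_rcons; apply: IH.
by apply: CkS_partial; rewrite size_rcons in H.
Qed.

Lemma near_open U x (P : set 'rV[R]_m) : open U -> U x ->
  (forall y, U y -> P y) -> \forall y \near x, P y.
Proof.
by move=> oU Ux UP; apply: filterS (open_nbhs_nbhs (conj oU Ux)).
Qed.

Lemma eq_partial U f g i x : open U -> U x -> {in U, f =1 g} ->
  partial i f x = partial i g x.
Proof.
move=> oU Ux fg; apply: near_eq_derive.
by apply: near_open oU Ux _ => // y Uy; apply: fg; rewrite inE.
Qed.

Lemma eq_derivable U f g v x : open U -> U x -> {in U, f =1 g} ->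
  derivable f x v -> derivable g x v.
Proof.
move=> oU Ux fg; apply: near_eq_derivable.
by apply: near_open oU Ux _ => // y Uy; apply: fg; rewrite inE.
Qed.

Lemma eq_continuous_at U f g x : open U -> U x -> {in U, f =1 g} ->
  {for x, continuous f} -> {for x, continuous g}.
Proof.
move=> oU Ux fg cf; have fgx : f x = g x by apply: fg; rewrite inE.
have H : \forall y \near x, f y = g y.
  by apply: (near_open oU Ux) => y Uy; apply: fg; rewrite inE.
rewrite /prop_for /continuous_at -fgx.
exact: cvg_trans (near_eq_cvg H) cf.
Qed.

Lemma eq_Ck k U f g : open U -> {in U, f =1 g} -> Ck k U f -> Ck k U g.
Proof.
move=> oU; elim: k f g => [|k IH] f g fg [cf df].
  by split=> // x Ux; apply: eq_continuous_at fg (cf x Ux).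
split=> [x Ux|i]; first exact: eq_continuous_at fg (cf x Ux).
have [d c] := df i; split=> [x Ux|].
  exact: eq_derivable fg (d x Ux).
apply: IH c => x; rewrite inE => Ux; exact: eq_partial fg.
Qed.

Lemma partial_cst (c : R) i : partial i (fun _ : 'rV[R]_m => c) = fun => 0.
Proof. by apply/funext => x; rewrite /partial derive_cst. Qed.

Lemma Ck_cst k U (c : R) : Ck k U (fun => c).
Proof.
elim: k c => [|k IH] c; split.
- by move=> x _; exact: cst_continuous.
- by [].
- by move=> x _; exact: cst_continuous.
- by move=> i; rewrite partial_cst; split=> [x _|]; [exact: derivable_cst|].
Qed.

Lemma is_derive_coord (j : 'I_m) x v :
  is_derive x v (fun y : 'rV[R]_m => y 0 j) (v 0 j).
Proof.
have H : \forall h \near (0 : R)^', v 0 j = h^-1 *: ((h *: v + x) 0 j - x 0 j).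
  near=> h; rewrite !mxE addrK scalerA mulVf ?scale1r //.
  by near: h; exact: nbhs_dnbhs_neq.
have E : (fun h : R => h^-1 *: ((h *: v + x) 0 j - x 0 j)) @ (0 : R)^' --> v 0 j.
  exact: cvg_trans (near_eq_cvg H) (cvg_cst (v 0 j)).
apply: DeriveDef; first by apply/cvg_ex; exists (v 0 j).
exact: cvg_lim E.
Unshelve. all: by end_near. Qed.

Lemma partial_coord i j :
  partial i (fun y : 'rV[R]_m => y 0 j) = fun => (j == i)%:R.
Proof.
apply/funext => x; rewrite /partial.
by have [_ ->] := is_derive_coord j x 'e_i; rewrite !mxE.
Qed.

Lemma Ck_coord k U j : Ck k U (fun y : 'rV[R]_m => y 0 j).
Proof.
case: k => [|k]; split; [|by []| |]; try by move=> x _; apply: coord_continuous.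
move=> i; rewrite partial_coord; split=> [x _|]; last exact: Ck_cst.
by case: (is_derive_coord j x 'e_i).
Qed.

Lemma partialD f g i x : derivable f x 'e_i ->
  derivable g x 'e_i ->
  partial i (fun y => f y + g y) x = partial i f x + partial i g x.
Proof. exact: deriveD. Qed.

Lemma partialM f g i x : derivable f x 'e_i ->
  derivable g x 'e_i ->
  partial i (fun y => f y * g y) x = f x * partial i g x + g x * partial i f x.
Proof. exact: deriveM. Qed.

Lemma partialZ (c : R) f i x : derivable f x 'e_i ->
  partial i (fun y => c * f y) x = c * partial i f x.
Proof. by move=> df; have := deriveZ c df. Qed.

Lemma derivable_mulc (c : R) f v x : derivable f x v ->
  derivable (fun y => c * f y) x v.
Proof. by move=> df; have := derivableZ (k := c) df. Qed.

Lemma partial_sum (I : Type) (r : seq I) (F : I -> 'rV[R]_m -> R) i x :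
  (forall j, derivable (F j) x 'e_i) ->
  derivable (fun y => \sum_(j <- r) F j y) x 'e_i /\
  partial i (fun y => \sum_(j <- r) F j y) x = \sum_(j <- r) partial i (F j) x.
Proof.
move=> dF; elim: r => [|j r [IHd IHp]].
  rewrite (_ : (fun y => _) = fun=> 0); last first.
    by apply/funext => y; rewrite big_nil.
  by rewrite big_nil partial_cst; split; [exact: derivable_cst|].
rewrite (_ : (fun y => _) = fun y => F j y + \sum_(j <- r) F j y); last first.
  by apply/funext => y; rewrite big_cons.
rewrite big_cons -IHp; split; first exact: derivableD.
exact: partialD.
Qed.

Lemma CkD k U f g : open U -> Ck k U f -> Ck k U g ->
  Ck k U (fun y => f y + g y).
Proof.
move=> oU; elim: k f g => [|k IH] f g [cf df] [cg dg]; split.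
- by move=> x Ux; exact: continuousD (cf _ Ux) (cg _ Ux).
- by [].
- by move=> x Ux; exact: continuousD (cf _ Ux) (cg _ Ux).
move=> i; have [d1 c1] := df i; have [d2 c2] := dg i.
split=> [x Ux|]; first by exact: derivableD (d1 x Ux) (d2 x Ux).
apply: eq_Ck (IH _ _ c1 c2) => // x; rewrite inE => Ux.
by rewrite (partialD (d1 x Ux) (d2 x Ux)).
Qed.

Lemma CkM k U f g : open U -> Ck k U f -> Ck k U g ->
  Ck k U (fun y => f y * g y).
Proof.
move=> oU; elim: k f g => [|k IH] f g Cf Cg.
  have [cf _] := Cf; have [cg _] := Cg.
  by split=> // x Ux; exact: continuousM (cf _ Ux) (cg _ Ux).
have [cf df] := Cf; have [cg dg] := Cg.
split=> [x Ux|i]; first by exact: continuousM (cf _ Ux) (cg _ Ux).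
have [d1 c1] := df i; have [d2 c2] := dg i.
split=> [x Ux|]; first by exact: derivableM (d1 x Ux) (d2 x Ux).
apply: (@eq_Ck _ _ (fun x => f x * partial i g x + g x * partial i f x)) => //.
  by move=> x; rewrite inE => Ux; rewrite (partialM (d1 x Ux) (d2 x Ux)).
by apply: CkD => //; apply: IH => //; apply: CkW.
Qed.

Lemma CkN k U f : open U -> Ck k U f -> Ck k U (fun y => - f y).
Proof.
move=> oU Cf; apply: (@eq_Ck _ _ (fun y => -1 * f y)) => //.
  by move=> x _; rewrite mulN1r.
by apply: CkM => //; apply: Ck_cst.
Qed.

Lemma CkB k U f g : open U -> Ck k U f -> Ck k U g ->
  Ck k U (fun y => f y - g y).
Proof. by move=> oU Cf Cg; apply: CkD => //; apply: CkN. Qed.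

Lemma Ck_sum k U (I : Type) (r : seq I) (F : I -> 'rV[R]_m -> R) : open U ->
  (forall j, Ck k U (F j)) -> Ck k U (fun y => \sum_(j <- r) F j y).
Proof.
move=> oU CF; elim: r => [|j r IH].
  apply: (@eq_Ck _ _ (fun=> 0)) => //; last exact: Ck_cst.
  by move=> x _; rewrite big_nil.
apply: (@eq_Ck _ _ (fun y => F j y + \sum_(j <- r) F j y)) => //.
  by move=> x _; rewrite big_cons.
exact: CkD.
Qed.

Lemma Ck_prod k U (I : Type) (r : seq I) (F : I -> 'rV[R]_m -> R) : open U ->
  (forall j, Ck k U (F j)) -> Ck k U (fun y => \prod_(j <- r) F j y).
Proof.
move=> oU CF; elim: r => [|j r IH].
  apply: (@eq_Ck _ _ (fun=> 1)) => //; last exact: Ck_cst.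
  by move=> x _; rewrite big_nil.
apply: (@eq_Ck _ _ (fun y => F j y * \prod_(j <- r) F j y)) => //.
  by move=> x _; rewrite big_cons.
exact: CkM.
Qed.

Lemma partialV f i x : f x != 0 -> derivable f x 'e_i ->
  partial i (fun y => (f y)^-1) x = - (f x) ^- 2 * partial i f x.
Proof. exact: deriveV. Qed.

Lemma CkV k U f : open U -> (forall x, U x -> f x != 0) -> Ck k U f ->
  Ck k U (fun y => (f y)^-1).
Proof.
move=> oU f0; elim: k f f0 => [|k IH] f f0 Cf.
  have [cf _] := Cf; split=> // x Ux.
  by exact: continuousV (f0 _ Ux) (cf _ Ux).
have [cf df] := Cf; split=> [x Ux|i].
  by exact: continuousV (f0 _ Ux) (cf _ Ux).
have [d c] := df i.
split=> [x Ux|]; first by exact: derivableV (f0 x Ux) (d x Ux).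
apply: (@eq_Ck _ _ (fun x => - ((f x)^-1 * (f x)^-1) * partial i f x)) => //.
  move=> x; rewrite inE => Ux; rewrite (partialV (f0 x Ux) (d x Ux)).
  by rewrite expr2 invfM.
apply: CkM => //; apply: CkN => //.
by apply: CkM => //; apply: IH => //; apply: CkW.
Qed.

End Ck.

(** * Chain rule and symmetry of second derivatives *)

Section chain_rule.
Context (R : realType).

(** [mvt_box] gives the increment with partial derivatives at intermediate points; continuity of
    these derivatives moves them to [x]. *)
Lemma C1_expand m (U : set 'rV[R]_m) (f : 'rV[R]_m -> R) x (e : R) :
  open U -> U x -> Ck 1 U f -> 0 < e ->
  exists2 r : R, 0 < r & forall y, `|y - x| < r ->
    `|f y - f x - \sum_i (y 0 i - x 0 i) * partial i f x| <= e * `|y - x|.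
Proof.
move=> oU Ux Cf e0.
(* The [m] errors have to add up to at most [e]; [m.+1] avoids a division by zero when [m] is 0. *)
have e'0 : 0 < e / m.+1%:R by rewrite divr_gt0.
have H (i : 'I_m) : exists2 r : R, 0 < r & forall y, `|y - x| < r ->
    `|partial i f x - partial i f y| < e / m.+1%:R.
  have := Ck_continuous (CkS_partial i Cf) Ux.
  move=> /cvgrPdist_lt/(_ _ e'0)/nbhs_ballP[r /= r0 rU].
  by exists r => // y yx; apply: rU; rewrite -ball_normE /ball_ /= distrC.
have [r0 r00 r0U] := open_ball_sub oU Ux.
have /choice[rr rrP] : forall i : 'I_m, exists r : R, 0 < r /\ forall y,
    `|y - x| < r -> `|partial i f x - partial i f y| < e / m.+1%:R.
  by move=> i; have [r ? ?] := H i; exists r.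
pose r := \big[Order.min/r0]_i rr i.
have rpos : 0 < r by apply: lt_bigmin => // i _; case: (rrP i).
have rr0 : r <= r0 by apply: bigmin_le_id.
have rri i : r <= rr i by apply: bigmin_le_cond.
exists r => // y yx.
have xx : `|x - x| < r by rewrite subrr normr0.
have bU w : in_box x y w -> `|w - x| < r by move=> b; apply: in_box_ball b xx yx.
have [|xi xib ->] := @mvt_box _ _ f x y.
  move=> w /bU wr i; apply: CkS_derivable Cf _; apply: r0U.
  exact: lt_le_trans wr rr0.
rewrite -sumrB; apply: le_trans (ler_norm_sum _ _ _) _.
have B (i : 'I_m) : `|(y 0 i - x 0 i) * partial i f (xi i) -
    (y 0 i - x 0 i) * partial i f x| <= `|y - x| * (e / m.+1%:R).
  rewrite -mulrBr normrM ler_pM //.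
    by have := rV_coord_le (y - x) i; rewrite !mxE.
  rewrite distrC ltW //; apply: (proj2 (rrP i)).
  by apply: lt_le_trans (rri i); apply: bU.
apply: le_trans (ler_sum _ (fun i _ => B i)) _.
rewrite sumr_const card_ord -[leLHS]mulr_natr [leRHS]mulrC -mulrA ler_wpM2l //.
by rewrite mulrAC ler_pdivrMr ?ltr0n // ler_pM2l // ler_nat.
Qed.

Lemma C1_differentiable m (U : set 'rV[R]_m) (f : 'rV[R]_m -> R) x :
  open U -> U x -> Ck 1 U f -> differentiable f x.
Proof.
move=> oU Ux Cf.
pose D : 'cV[R]_m := \col_i partial i f x.
pose L (v : 'rV[R]_m) : R := (v *m D) 0 0.
have LE v : L v = \sum_i v 0 i * partial i f x.
  by rewrite /L mxE; apply: eq_bigr => i _; rewrite mxE.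
have Llin : linear L by move=> a u v; rewrite /L mulmxDl -scalemxAl !mxE.
pose LL : {linear 'rV[R]_m -> R} := HB.pack L
  (GRing.isLinear.Build R 'rV[R]_m R _ L Llin).
have cL : continuous LL.
  move=> v; rewrite (_ : (LL : _ -> _) = fun v => \sum_i v 0 i * partial i f x).
    by apply: (@Ck_continuous _ _ 0 setT) => //; apply: Ck_sum => [|i];
      [exact: openT|apply: CkM; [exact: openT|exact: Ck_coord|exact: Ck_cst]].
  by apply/funext => w; rewrite -LE.
have E : f \o shift x = cst (f x) + LL +o_ (0 : 'rV[R]_m) id.
  apply/eqaddoP => e e0; have [r r0 rP] := C1_expand oU Ux Cf e0.
  apply/nbhs_ballP; exists r => // h; rewrite -ball_normE /ball_ /= sub0r normrN => hr.
  have := rP (h + x); rewrite addrK => /(_ hr).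
  rewrite -[X in `|X| <= _ -> _]/(f (h + x) - f x - _) => H.
  apply: le_trans H; rewrite le_eqVlt; apply/orP; left; apply/eqP; congr `|_|.
  rewrite -[LHS]/(f (h + x) - (f x + L h)) LE opprD addrA; congr (_ - _).
  by apply: eq_bigr => i _; rewrite !mxE addrK.
have dE := diff_unique cL E.
by apply/diff_locallyP; rewrite dE.
Qed.

Lemma deriveE_partial m (U : set 'rV[R]_m) (f : 'rV[R]_m -> R) x v :
  open U -> U x -> Ck 1 U f -> 'D_v f x = \sum_i v 0 i * partial i f x.
Proof.
move=> oU Ux Cf; have df := C1_differentiable oU Ux Cf.
rewrite deriveE // {1}(row_sum_delta v) linear_sum; apply: eq_bigr => i _.
by rewrite linearZ /partial -deriveE.
Qed.

(** Since [G] is only assumed derivable along [v], the differential calculus is applied to the curve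
    [c], a function of one real variable, at 0. *)
Lemma is_derive_comp_C1 (V : normedModType R) m (U : set 'rV[R]_m)
    (f : 'rV[R]_m -> R) (G : V -> 'rV[R]_m) x v :
  open U -> U (G x) -> Ck 1 U f ->
  (forall j, derivable (fun y => G y 0 j) x v) ->
  is_derive x v (fun y => f (G y))
    (\sum_j 'D_v (fun y => G y 0 j) x * partial j f (G x)).
Proof.
move=> oU UG Cf dG.
pose c (h : R) : 'rV[R]_m := G (h *: v + x).
have c0 : c 0 = G x by rewrite /c scale0r add0r.
have dc : derivable c 0 1.
  apply/derivable_mxP => i j; rewrite ord1.
  exact: (iffLR (derivable1P _ _ _) (dG j)).
have Uc : U (c 0) by rewrite c0.
have dfc := C1_differentiable oU Uc Cf.
have dcd : differentiable c 0 by apply/derivable1_diffP.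
have dd : differentiable (f \o c) 0 by apply: differentiable_comp.
have E : (fun h : R => h^-1 *: ((f \o c) (h *: 1 + 0) - (f \o c) 0)) =
    (fun h => h^-1 *: ((f \o G) (h *: v + x) - (f \o G) x)).
  by apply/funext => h; rewrite /c /= scale0r add0r addr0 [h *: 1]mulr1.
have Ej j : 'D_1 (fun h => c h 0 j) 0 = 'D_v (fun y => G y 0 j) x.
  rewrite /derive; set u := (X in lim (X @ _)); set w := (X in _ = lim (X @ _)).
  suff -> : u = w by [].
  by apply/funext => h; rewrite /u /w /c /= scale0r add0r addr0 [h *: 1]mulr1.
apply: DeriveDef.
  by have /derivable1_diffP := dd; rewrite /derivable /= E.
have -> : 'D_v (fun y => f (G y)) x = 'D_1 (f \o c) 0 by rewrite /derive E.
rewrite deriveE // diff_comp //= -[in LHS]deriveE //.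
rewrite -deriveE // (deriveE_partial _ oU Uc Cf) c0; apply: eq_bigr => j _.
by rewrite derive_mx // mxE Ej.
Qed.

Lemma partial_comp m k (U : set 'rV[R]_k) (f : 'rV[R]_k -> R)
    (G : 'rV[R]_m -> 'rV[R]_k) x i :
  open U -> U (G x) -> Ck 1 U f ->
  (forall j, derivable (fun y => G y 0 j) x 'e_i) ->
  partial i (fun y => f (G y)) x =
    \sum_j partial i (fun y => G y 0 j) x * partial j f (G x).
Proof.
by move=> oU UG Cf dG; have [_] := is_derive_comp_C1 oU UG Cf dG.
Qed.

Lemma continuous_rV (T : topologicalType) m (G : T -> 'rV[R]_m) x :
  (forall j, {for x, continuous (fun y => G y 0 j)}) -> {for x, continuous G}.
Proof.
move=> cG; apply/cvgrPdist_lt => e e0; near=> y.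
apply: rV_norm_lt => // i; rewrite !mxE; move: i.
near: y; apply: filter_forall => i.
by have /cvgrPdist_lt := cG i; apply.
Unshelve. all: by end_near. Qed.

Lemma Ck_comp m k l (W : set 'rV[R]_m) (U : set 'rV[R]_k)
    (G : 'rV[R]_m -> 'rV[R]_k) (f : 'rV[R]_k -> R) :
  open W -> open U -> (forall x, W x -> U (G x)) ->
  (forall j, Ck l W (fun x => G x 0 j)) -> Ck l U f ->
  Ck l W (fun x => f (G x)).
Proof.
move=> oW oU WU; elim: l f => [|l IH] f CG Cf.
  split=> // x Wx; apply: continuous_comp.
    by apply: continuous_rV => j; apply: Ck_continuous (CG j) Wx.
  by apply: Ck_continuous Cf _; apply: WU.
have C1f : Ck 1 U f by elim: (l) Cf => // l' IH' /CkW.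
have D x i : W x -> is_derive x 'e_i (fun x => f (G x))
    (\sum_j partial i (fun y => G y 0 j) x * partial j f (G x)).
  move=> Wx; apply: is_derive_comp_C1 oU (WU _ Wx) C1f _ => j.
  exact: CkS_derivable (CG j) Wx.
split=> [x Wx|i].
  apply: continuous_comp.
    by apply: continuous_rV => j; apply: Ck_continuous (CG j) Wx.
  by apply: Ck_continuous Cf _; apply: WU.
split=> [x Wx|]; first by case: (D x i Wx).
apply: (@eq_Ck _ _ _ _
  (fun x => \sum_j partial i (fun y => G y 0 j) x * partial j f (G x))) => //.
  by move=> x; rewrite inE => Wx; case: (D x i Wx).
apply: Ck_sum => // j; apply: CkM => //; first exact: CkS_partial.
by apply: IH => [j'|]; [apply: CkW|apply: CkS_partial].
Qed.

(** The second difference over a square of side [h] is symmetric in the two directions, and two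
    applications of the mean value theorem equate it with [h * h] times a mixed derivative at a
    nearby point. *)
Lemma schwarz m (U : set 'rV[R]_m) (f : 'rV[R]_m -> R) x i j :
  open U -> U x -> Ck 2 U f ->
  partial i (partial j f) x = partial j (partial i f) x.
Proof.
move=> oU Ux Cf.
wlog suff S : i j / forall e : R, 0 < e -> exists2 r : R, 0 < r &
    forall h : R, 0 < h < r ->
    `|f (h *: 'e_i + (h *: 'e_j + x)) -
      f (h *: 'e_j + x) - f (h *: 'e_i + x) + f x -
      h * h * partial j (partial i f) x| <= h * h * e.
  apply/eqP; rewrite -subr_eq0 -normr_le0; apply/ler_addgt0Pl => e e0.
  rewrite addr0; have e20 : 0 < e / 2 by rewrite divr_gt0.
  have [r1 r10 H1] := S i j _ e20; have [r2 r20 H2] := S j i _ e20.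
  pose h := Num.min r1 r2 / 2.
  have m0 : 0 < Num.min r1 r2 by rewrite lt_min r10.
  have h0 : 0 < h by rewrite divr_gt0.
  have hm : h < Num.min r1 r2 by rewrite ltr_pdivrMr // ltr_pMr // ltr1n.
  have hr1 : 0 < h < r1 by rewrite h0 (lt_le_trans hm) // ge_min lexx.
  have hr2 : 0 < h < r2 by rewrite h0 (lt_le_trans hm) // ge_min lexx orbT.
  have := H1 h hr1; have := H2 h hr2; rewrite addrCA.
  set a := f _; set b := f (h *: 'e_i + x).
  set c := f (h *: 'e_j + x) => K2 K1.
  rewrite -(ler_pM2l (mulr_gt0 h0 h0)) -[h * h in leLHS]gtr0_norm ?mulr_gt0 //.
  rewrite -normrM mulrBr.
  have abs (p q s t P Q : R) : P - Q = (p - s - q + t - Q) - (p - q - s + t - P).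
    by ring.
  rewrite (abs a b c (f x)).
  apply: le_trans (ler_normB _ _) _.
  have -> : h * h * e = h * h * (e / 2) + h * h * (e / 2).
    by rewrite -mulrDr -splitr.
  exact: lerD K1 K2.
move=> e e0; have e20 : 0 < e / 2 by rewrite divr_gt0.
have [r0 r00 r0U] := open_ball_sub oU Ux.
have := Ck_continuous (CkS_partial j (CkS_partial i Cf)) Ux.
move=> /cvgrPdist_lt/(_ _ e0)/nbhs_ballP[r1 /= r10 r1P].
pose r := Num.min r0 r1 / 2.
have r2 : r + r = Num.min r0 r1 by rewrite -splitr.
have rpos : 0 < r by rewrite divr_gt0 // lt_min r00.
have dn (k : 'I_m) : `|'e_k : 'rV[R]_m| <= 1.
  by apply: rV_norm_le => // l; rewrite mxE /=; case: eqP; rewrite ?normr1 ?normr0.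
have near (s t h : R) : 0 <= s <= 1 -> 0 <= t <= 1 -> 0 < h < r ->
    `|((s * h) *: 'e_i + ((t * h) *: 'e_j + x)) - x| < Num.min r0 r1.
  move=> /andP[s0 s1] /andP[t0 t1] /andP[h0 hr].
  rewrite addrA addrK -r2; apply: le_lt_trans (ler_normD _ _) _.
  have B (u : R) k : 0 <= u -> u <= 1 -> `|(u * h) *: 'e_k : 'rV[R]_m| < r.
    move=> u0 u1; rewrite normrZ normrM (ger0_norm u0) (gtr0_norm h0).
    apply: le_lt_trans hr; rewrite -[leRHS]mulr1 ler_pM ?mulr_ge0 ?(ltW h0) //.
    by rewrite ler_piMl // ltW.
  by apply: ltrD; apply: B.
exists r => // h hr; have /andP[h0 _] := hr.
have one01 : 0 <= (1 : R) <= 1 by rewrite ler01 lexx.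
have zero01 : 0 <= (0 : R) <= 1 by rewrite ler01 lexx.
have nU y : `|y - x| < Num.min r0 r1 -> U y.
  by rewrite lt_min => /andP[? _]; apply: r0U.
pose phi y := f (h *: 'e_j + y) - f y.
have iC1 : Ck 1 U (partial i f) by apply: CkS_partial.
have shE (s : R) : h *: 'e_j + ((s * h) *: 'e_i + x) =
    ((s * h) *: 'e_i + ((1 * h) *: 'e_j + x)) by rewrite mul1r addrCA.
have dphi (s : R) : 0 <= s <= 1 ->
    is_derive ((s * h) *: 'e_i + x) 'e_i phi
      (partial i f (h *: 'e_j + ((s * h) *: 'e_i + x))
       - partial i f ((s * h) *: 'e_i + x)).
  move=> s01; set y := _ + x.
  have Uy : U y.
    by apply: nU; have := near s 0 h s01 zero01 hr; rewrite mul0r scale0r add0r.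
  have Uhy : U (h *: 'e_j + y).
    by apply: nU; rewrite (shE s); apply: near.
  have d1 : is_derive y 'e_i f (partial i f y).
    by apply: derivableP; apply: CkS_derivable Cf Uy.
  have d2 : is_derive y 'e_i (fun y => f (h *: 'e_j + y))
      (partial i f (h *: 'e_j + y)).
    have E : (fun k : R => k^-1 *: (f (h *: 'e_j + (k *: 'e_i + y))
          - f (h *: 'e_j + y))) =
       (fun k => k^-1 *: (f (k *: 'e_i + (h *: 'e_j + y)) -
          f (h *: 'e_j + y))).
      by apply/funext => k; rewrite addrCA.
    have dd : derivable f (h *: 'e_j + y) 'e_i.
      exact: CkS_derivable Cf Uhy.
    by apply: DeriveDef; [rewrite /derivable E|rewrite /partial /derive E].
  exact: is_deriveB.
have [s s01|s s01] := @mvt_line _ _ phi x 'e_i h.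
  by case: (dphi s s01).
have [_ ->] := dphi s s01.
rewrite /phi => E1.
set y := (s * h) *: 'e_i + x in E1.
have yU (t : R) : 0 <= t <= 1 -> `|(t * h) *: 'e_j + y - x| < Num.min r0 r1.
  by move=> t01; rewrite /y addrCA; apply: near.
have [t t01|t t01 E2] := @mvt_line _ _ (partial i f) y 'e_j h.
  by apply: CkS_derivable iC1 _; apply: nU; apply: yU.
move: E1; rewrite E2 => E1.
have -> : f (h *: 'e_i + (h *: 'e_j + x)) -
      f (h *: 'e_j + x) - f (h *: 'e_i + x) + f x =
      h * (h * 'D_'e_j (partial i f) ((t * h) *: 'e_j + y)).
  rewrite -E1 addrCA; have abs (a b c d : R) : a - b - c + d = a - c - (b - d) by ring.
  exact: abs.
rewrite mulrA -mulrBr normrM gtr0_norm ?mulr_gt0 // ler_pM2l ?mulr_gt0 //.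
rewrite distrC ltW //; apply: r1P; rewrite -ball_normE /ball_ /= distrC.
by have := yU t t01; rewrite lt_min => /andP[].
Qed.

End chain_rule.

(** * The inverse function theorem *)

Section inverse_function.
Context (R : realType).

(** Transposed with respect to the usual Jacobian: rows carry the variables, so it acts on row
    vectors from the right and the chain rule multiplies Jacobians in the order in which the maps
    are applied. *)
Definition jacm m k (f : 'rV[R]_m -> 'rV[R]_k) x : 'M[R]_(m, k) :=
  \matrix_(i, j) partial i (fun y => f y 0 j) x.

Lemma Ck_det l m n (U : set 'rV[R]_m) (A : 'rV[R]_m -> 'M[R]_n) : open U ->
  (forall i j, Ck l U (fun x => A x i j)) -> Ck l U (fun x => \det (A x)).
Proof.
move=> oU CA; rewrite /determinant; apply: Ck_sum => // s.
by apply: CkM => //; [apply: Ck_cst|apply: Ck_prod].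
Qed.

Lemma Ck_invmx l m n (U : set 'rV[R]_m) (A : 'rV[R]_m -> 'M[R]_n) i j :
  open U -> (forall x, U x -> A x \in unitmx) ->
  (forall i j, Ck l U (fun x => A x i j)) ->
  Ck l U (fun x => invmx (A x) i j).
Proof.
move=> oU uA CA.
apply: (@eq_Ck _ _ _ _ (fun x => (\det (A x))^-1 * \adj (A x) i j)) => //.
  by move=> x; rewrite inE => Ux; rewrite /invmx uA // [RHS]mxE.
apply: CkM => //.
  apply: CkV => //; last exact: Ck_det.
  by move=> x /uA; rewrite unitmxE unitfE.
rewrite (_ : (fun x => _) = fun x => (-1) ^+ (j + i) * \det (row' j (col' i (A x)))).
  apply: CkM => //; first exact: Ck_cst.
  apply: Ck_det => // p q.
  rewrite (_ : (fun x => _) = fun x => A x (lift j p) (lift i q)) //.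
  by apply/funext => x; rewrite !mxE.
by apply/funext => x; rewrite mxE.
Qed.

Lemma smooth_invmx m n (U : set 'rV[R]_m) (A : 'rV[R]_m -> 'M[R]_n) i j :
  open U -> (forall x, U x -> A x \in unitmx) ->
  (forall i j, smooth_on U (fun x => A x i j)) ->
  smooth_on U (fun x => invmx (A x) i j).
Proof.
move=> oU uA CA; apply/smooth_onP => l; apply: Ck_invmx => // p q.
exact: (iffLR (smooth_onP U _) (CA p q)).
Qed.

Lemma continuous_mulmxr m n (B : 'M[R]_(m, n)) :
  continuous (fun x : 'rV[R]_m => x *m B).
Proof.
move=> x; apply: continuous_rV => j.
rewrite (_ : (fun y => _) = fun y : 'rV[R]_m => \sum_l y 0 l * B l j); last first.
  by apply/funext => y; rewrite mxE.
apply: (@Ck_continuous _ _ 0 setT) => //; apply: Ck_sum => [|l]; first exact: openT.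
by apply: CkM; [exact: openT|exact: Ck_coord|exact: Ck_cst].
Qed.

Lemma lipschitz_partial m k (h : 'rV[R]_m -> 'rV[R]_k)
    (x0 : 'rV[R]_m) (r c : R) : 0 <= c ->
  (forall x i j, `|x - x0| < r -> derivable (fun y => h y 0 j) x 'e_i /\
     `|partial i (fun y => h y 0 j) x| <= c) ->
  forall x y, `|x - x0| < r -> `|y - x0| < r ->
    `|h y - h x| <= c *+ m * `|y - x|.
Proof.
move=> c0 dh x y xr yr; apply: rV_norm_le.
  by rewrite mulr_ge0 // mulrn_wge0.
move=> j; rewrite !mxE.
have [w wb i|xi xib ->] := @mvt_box _ _ (fun y => h y 0 j) x y.
  by case: (dh w i j (in_box_ball wb xr yr)).
apply: le_trans (ler_norm_sum _ _ _) _.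
have B i : `|(y 0 i - x 0 i) * partial i (fun y => h y 0 j) (xi i)| <= c * `|y - x|.
  rewrite normrM mulrC ler_pM //.
    by case: (dh (xi i) i j (in_box_ball (xib i) xr yr)).
  by have := rV_coord_le (y - x) i; rewrite !mxE.
apply: le_trans (ler_sum _ (fun i _ => B i)) _.
by rewrite sumr_const card_ord mulrnAl.
Qed.

Lemma continuous_norm_rV (T : topologicalType) m (g : T -> 'rV[R]_m) x :
  {for x, continuous g} -> {for x, continuous (fun t => `|g t|)}.
Proof.
move=> /cvgrPdist_lt cg; apply/cvgrPdist_lt => e e0.
by apply: filterS (cg e e0) => t; apply: le_lt_trans; exact: ler_dist_dist.
Qed.

Lemma continuous_id_rV m : continuous (fun x : 'rV[R]_m => x).
Proof. by move=> x; exact: cvg_id. Qed.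

Lemma near_rVP m (x : 'rV[R]_m) (P : 'rV[R]_m -> Prop) :
  (\forall y \near x, P y) <->
  exists2 r : R, 0 < r & forall y, `|y - x| < r -> P y.
Proof.
split=> [/nbhs_ballP[r /= r0 rP]|[r r0 rP]].
  by exists r => // y yx; apply: rP; rewrite -ball_normE /ball_ /= distrC.
apply/nbhs_ballP; exists r => // y; rewrite -ball_normE /ball_ /= distrC.
exact: rP.
Qed.

Lemma continuous_rVP m k (f : 'rV[R]_m -> 'rV[R]_k) (x : 'rV[R]_m) :
  {for x, continuous f} <-> forall e : R, 0 < e ->
    exists2 r : R, 0 < r & forall y, `|y - x| < r -> `|f y - f x| < e.
Proof.
split=> [/cvgrPdist_lt cf e e0|cf].
  have /near_rVP[r r0 rP] := cf e e0.
  by exists r => // y yx; rewrite distrC; apply: rP.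
move=> A /nbhs_ballP[e /= e0 eA]; have [r r0 rP] := cf e e0.
apply/nbhs_ballP; exists r => // y; rewrite -ball_normE /ball_ /= distrC => yx.
by apply: eA; rewrite -ball_normE /ball_ /= distrC; apply: rP.
Qed.

Lemma continuous_rV_realP m (f : 'rV[R]_m -> R) (x : 'rV[R]_m) :
  {for x, continuous f} <-> forall e : R, 0 < e ->
    exists2 r : R, 0 < r & forall y, `|y - x| < r -> `|f y - f x| < e.
Proof.
split=> [/cvgrPdist_lt cf e e0|cf].
  have /near_rVP[r r0 rP] := cf e e0.
  by exists r => // y yx; rewrite distrC; apply: rP.
move=> A /nbhs_ballP[e /= e0 eA]; have [r r0 rP] := cf e e0.
apply/nbhs_ballP; exists r => // y; rewrite -ball_normE /ball_ /= distrC => yx.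
by apply: eA; rewrite -ball_normE /ball_ /= distrC; apply: rP.
Qed.

Lemma open_rV m (V : set 'rV[R]_m) :
  (forall x, V x -> exists2 r : R, 0 < r & forall y, `|y - x| < r -> V y) ->
  open V.
Proof. by move=> H; rewrite openE => x /H/near_rVP. Qed.

Lemma near_forall (T : topologicalType) (I : finType) (P : I -> T -> Prop) (x : T) :
  (forall i, \forall y \near x, P i y) -> \forall y \near x, forall i, P i y.
Proof. by move=> H; apply: filter_forall. Qed.

(* The distance |phi x - x| attains its minimum on the compact closed ball, and
   replacing a minimiser x by phi x halves it. *)
Lemma contraction_ball_fixpoint m (phi : 'rV[R]_m -> 'rV[R]_m) x0 (rho : R) :
  0 <= rho ->
  (forall x, `|x - x0| <= rho -> `|phi x - x0| <= rho) ->
  (forall x, `|x - x0| <= rho -> {for x, continuous phi}) ->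
  (forall x y, `|x - x0| <= rho -> `|y - x0| <= rho ->
     `|phi x - phi y| <= 2^-1 * `|x - y|) ->
  exists2 x, `|x - x0| <= rho & phi x = x.
Proof.
move=> rho0 phiB phiC phiL; pose B : set 'rV[R]_m := [set x | `|x - x0| <= rho].
have cB : compact B.
  apply: bounded_closed_compact.
    exists (rho + `|x0|); split; first exact: num_real.
    move=> M Mr x Bx; rewrite -(subrK x0 x); apply: le_trans (ler_normD _ _) _.
    by apply: le_trans (ltW Mr); rewrite lerD2r.
  rewrite (_ : B = (fun x => `|x - x0|) @^-1` [set r | r <= rho]) //.
  apply: preimage_closed; last exact: closed_le.
  move=> x _.
  have H : {for x, continuous (fun x : 'rV[R]_m => `|x - x0|)}.
    apply: continuous_norm_rV.
    exact: (@continuousB _ _ _ (fun y : 'rV[R]_m => y) (fun=> x0) x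
      (@continuous_id_rV m x) (@cst_continuous _ _ x0 x)).
  exact: H.
have B0 : B !=set0 by exists x0; rewrite /B /= subrr normr0.
have [|x] := @EVT_min_rV R m (fun x => `|phi x - x|) B B0 cB.
  apply: continuous_in_subspaceT => x /[!inE] Bx.
  apply: (@continuous_norm_rV _ _ (fun x => phi x - x)).
  exact: (@continuousB _ _ _ phi (fun y : 'rV[R]_m => y) x
    (phiC x Bx) (@continuous_id_rV m x)).
rewrite inE => Bx minx; exists x => //.
have Bpx : B (phi x) by apply: phiB.
have := le_trans (minx (phi x) (mem_set Bpx)) (phiL _ _ Bpx Bx).
rewrite -subr_le0 -{1}[`|phi x - x|]mul1r -mulrBl => H.
apply/eqP; rewrite -subr_eq0 -normr_le0; rewrite pmulr_rle0 // in H.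
by rewrite subr_gt0 invf_lt1 // ltr1n.
Qed.

Lemma half_divrn m : 2^-1 / m.+1%:R *+ m <= 2^-1 :> R.
Proof.
rewrite -[leLHS]mulr_natr mulrAC ler_pdivrMr ?ltr0n //.
by rewrite ler_pM2l // ler_nat.
Qed.

(** A row vector killed by [A] equals its image under [1%:M - A], which at most halves the sup
    norm. *)
Lemma unitmx_near1 m (A : 'M[R]_m) :
  (forall i j, `|(1%:M - A) i j| <= 2^-1 / m.+1%:R) -> A \in unitmx.
Proof.
move=> HA; rewrite -row_free_unit -kermx_eq0; apply/eqP/row_matrixP => i.
rewrite row0; set v := row i _.
have vA : v *m A = 0 by rewrite /v -row_mul mulmx_ker row0.
have vE : v = v *m (1%:M - A) by rewrite mulmxBr mulmx1 vA subr0.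
suff : `|v| <= 2^-1 * `|v|.
  rewrite -subr_le0 -{1}[`|v|]mul1r -mulrBl => H.
  apply/eqP; rewrite -normr_le0; rewrite pmulr_rle0 // in H.
  by rewrite subr_gt0 invf_lt1 // ltr1n.
rewrite {1}vE; apply: rV_norm_le; first by rewrite mulr_ge0.
move=> j; rewrite mxE; apply: le_trans (ler_norm_sum _ _ _) _.
have B l : `|v 0 l * (1%:M - A) l j| <= `|v| * (2^-1 / m.+1%:R).
  by rewrite normrM ler_pM // rV_coord_le.
apply: le_trans (ler_sum _ (fun i _ => B i)) _.
by rewrite sumr_const card_ord -mulrnAr [leRHS]mulrC ler_wpM2l // half_divrn.
Qed.

(** Composed with the inverse Jacobian [B], the map becomes a perturbation [k] of the identity:
    [h x = x - k x] contracts by 1/2 near [x0], so [k] is injective there and [k x = y] is the fixed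
    point equation of [x |-> y + h x]. *)
Lemma inverse_function m (U : set 'rV[R]_m) (f : 'rV[R]_m -> 'rV[R]_m) x0 :
  open U -> U x0 -> smooth_map U f -> jacm f x0 \in unitmx ->
  exists V G, [/\ V x0, V `<=` U, local_coordinates V f G &
    forall x, V x -> jacm f x *m jacm G (f x) = 1%:M].
Proof.
move=> oU Ux0 sf uJ; pose B := invmx (jacm f x0).
have uB : B \in unitmx by rewrite unitmx_inv.
have cf l j : Ck l U (fun x => f x 0 j).
  exact: (iffLR (smooth_onP U _) (sf j)).
pose k x := f x *m B; pose h x := x - k x.
have kE x j : k x 0 j = \sum_l f x 0 l * B l j by rewrite /k mxE.
have Ckk l j : Ck l U (fun x => k x 0 j).
  rewrite (_ : (fun x => _) = fun x => \sum_l f x 0 l * B l j); last first.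
    by apply/funext => x; rewrite kE.
  by apply: Ck_sum => // i; apply: CkM => //; apply: Ck_cst.
have Ckh l j : Ck l U (fun x => h x 0 j).
  rewrite (_ : (fun x => _) = fun x : 'rV[R]_m => x 0 j - k x 0 j); last first.
    by apply/funext => x; rewrite !mxE.
  by apply: CkB => //; apply: Ck_coord.
have dh x i j : U x ->
    partial i (fun y => h y 0 j) x = (1%:M - jacm f x *m B) i j.
  move=> Ux; rewrite (_ : (fun y => h y 0 j) =
    fun y : 'rV[R]_m => y 0 j + \sum_l (- B l j) * f y 0 l); last first.
    apply/funext => y; rewrite !mxE -sumrN; congr (_ + _).
    by apply: eq_bigr => l _; rewrite mulrC mulNr.
  have df l : derivable (fun y => f y 0 l) x 'e_i.
    exact: CkS_derivable (cf 1 l) Ux.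
  have dBf l : derivable (fun y => (- B l j) * f y 0 l) x 'e_i.
    exact: derivable_mulc.
  have [dS pS] := @partial_sum _ _ _ (index_enum 'I_m) (fun l y => - B l j * f y 0 l) i x dBf.
  rewrite partialD //; last by case: (is_derive_coord j x 'e_i).
  rewrite pS partial_coord !mxE eq_sym -sumrN; congr (_ + _).
  by apply: eq_bigr => l _; rewrite partialZ // mulNr mulrC mxE.
have c0 : 0 < 2^-1 / m.+1%:R :> R by rewrite divr_gt0.
have [r r0 rP] : exists2 r : R, 0 < r & forall x, `|x - x0| < r -> U x /\
    forall i j, `|(1%:M - jacm f x *m B) i j| <= 2^-1 / m.+1%:R.
  have : \forall x \near x0, U x /\
      forall i j, `|partial i (fun y => h y 0 j) x| <= 2^-1 / m.+1%:R.
    apply: filterI; first by apply: open_nbhs_nbhs.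
    apply: (@near_forall _ _ (fun i x => forall j,
      `|partial i (fun y => h y 0 j) x| <= 2^-1 / m.+1%:R)) => i.
    apply: (@near_forall _ _ (fun j x =>
      `|partial i (fun y => h y 0 j) x| <= 2^-1 / m.+1%:R)) => j.
    have := Ck_continuous (CkS_partial i (Ckh 1 j)) Ux0.
    move=> /cvgrPdist_lt/(_ _ c0); apply: filterS => x.
    rewrite {1}dh // /B mulmxV // subrr mxE sub0r normrN; exact: ltW.
  move=> /nbhs_ballP[r /= r0 rU]; exists r => // x xr.
  have [|Ux H] := rU x; first by rewrite -ball_normE /ball_ /= distrC.
  by split=> // i j; rewrite -dh.
have rU x : `|x - x0| < r -> U x by move=> /rP[].
have uJr x : `|x - x0| < r -> jacm f x \in unitmx.
  move=> /rP[_ /unitmx_near1]; rewrite unitmx_mul; by case/andP.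
have hL x y : `|x - x0| < r -> `|y - x0| < r -> `|h x - h y| <= 2^-1 * `|x - y|.
  move=> xr yr; apply: le_trans (lipschitz_partial (ltW c0) _ yr xr) _.
    move=> z i j zr; split; first exact: CkS_derivable (Ckh 1 j) (rU z zr).
    by rewrite dh; [case: (rP z zr)|exact: rU].
  by rewrite ler_wpM2r // half_divrn.
have kh x : x = k x + h x by rewrite /h addrC subrK.
have kL x y : `|x - x0| < r -> `|y - x0| < r -> `|x - y| <= 2 * `|k x - k y|.
  move=> xr yr; have := hL x y xr yr.
  have E : x - y = (k x - k y) + (h x - h y).
    by rewrite {1}(kh x) {1}(kh y) opprD addrACA.
  have := ler_normD (k x - k y) (h x - h y); rewrite -E.
  set a := `|x - y|; set b := `|k x - k y|; set c := `|h x - h y|; lra.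
pose rho := r / 2; have rho0 : 0 < rho by rewrite divr_gt0.
have rhor : rho < r by rewrite ltr_pdivrMr // ltr_pMr // ltr1n.
(* Bounding [k x] as well makes the image of [V] the full preimage of a ball, hence open. A fixed
   point found in the closed ball of radius [rho] lies in the open one, because [kL] bounds its
   distance to [x0] by twice that of [k x] to [k x0]. *)
pose V := [set x | `|x - x0| < rho /\ `|k x - k x0| < rho / 2].
have Vr x : V x -> `|x - x0| < r by move=> [? _]; apply: lt_trans rhor.
have VU : V `<=` U by move=> x /Vr; apply: rU.
have ck x : U x -> {for x, continuous k}.
  by move=> Ux; apply: continuous_rV => j; apply: Ck_continuous (Ckk 0 j) Ux.
have oV : open V.
  apply: open_rV => x [xr kr].
  have Ux : U x by apply: rU; apply: lt_trans rhor.
  have g0 : 0 < rho / 2 - `|k x - k x0| by rewrite subr_gt0.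
  have /continuous_rVP/(_ _ g0)[s s0 sP] := ck x Ux.
  exists (Num.min s (rho - `|x - x0|)); first by rewrite lt_min s0 subr_gt0.
  move=> y; rewrite lt_min => /andP[/sP ys yr]; split.
    rewrite -(subrK x y) -addrA; apply: le_lt_trans (ler_normD _ _) _.
    by rewrite -ltrBrDr.
  rewrite -(subrK (k x) (k y)) -addrA; apply: le_lt_trans (ler_normD _ _) _.
  by rewrite -ltrBrDr.
have x0r : `|x0 - x0| < r by rewrite subrr normr0.
have Vx0 : V x0 by split; rewrite subrr normr0 // divr_gt0.
have imV : f @` V = (fun z => z *m B) @^-1` [set y | `|y - k x0| < rho / 2].
  apply/seteqP; split=> [_ [x [_ kx] <-] //|z /= zr].
  pose y := z *m B; pose phi x := y + h x.
  have yr' : `|y - k x0| < rho / 2 by [].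
  have ler x : `|x - x0| <= rho -> `|x - x0| < r by move=> H; apply: le_lt_trans rhor.
  have phid x : phi x - x0 = (y - k x0) + (h x - h x0).
    by rewrite /phi {1}(kh x0) opprD addrACA.
  have [|x xr|x xr|x x' xr x'r|x xr px] := @contraction_ball_fixpoint m phi x0 rho.
  - exact: ltW.
  - rewrite phid; apply: le_trans (ler_normD _ _) _.
    have := hL x x0 (ler x xr) x0r; move: yr' xr; rewrite /rho.
    set a := `|y - _|; set b := `|x - _|; set c := `|h x - _|; lra.
  - have ch : {for x, continuous h}.
      apply: continuous_rV => j; apply: Ck_continuous (Ckh 0 j) _.
      exact/rU/ler.
    exact: (continuousD (@cst_continuous _ _ y x) ch).
  - by rewrite /phi opprD addrACA subrr add0r; apply: hL; apply: ler.
  have kx : k x = y.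
    by apply: (addIr (h x)); rewrite -kh -[RHS]/(phi x) px.
  exists x; last first.
    by have := congr1 (fun u => u *m invmx B) kx; rewrite /k /y !mulmxK.
  split; last by rewrite kx.
  have := kL x x0 (ler x xr) x0r; rewrite kx; move: yr'.
  set a := `|y - _|; set b := `|x - _|; lra.
have oW : open (f @` V).
  rewrite imV; apply: open_comp; last exact: open_norm_ball.
  by move=> x _; apply: continuous_mulmxr.
pose G z := xget x0 [set x | V x /\ f x = z].
have GP z : (f @` V) z -> V (G z) /\ f (G z) = z.
  by move=> [x Vx fx]; rewrite /G; case: xgetP => [y -> //|/(_ x)]; case.
have Gf x : V x -> G (f x) = x.
  move=> Vx; have [VG fG] := GP (f x) (ex_intro2 _ _ x Vx erefl).
  apply/eqP; rewrite -subr_eq0 -normr_le0.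
  by have := kL _ _ (Vr _ VG) (Vr _ Vx); rewrite {1}/k fG subrr normr0 mulr0.
have GL z z' : (f @` V) z -> (f @` V) z' ->
    `|G z - G z'| <= 2 * `|z *m B - z' *m B|.
  move=> Wz Wz'; have [VG fG] := GP _ Wz; have [VG' fG'] := GP _ Wz'.
  by have := kL _ _ (Vr _ VG) (Vr _ VG'); rewrite /k fG fG'.
have cG z : (f @` V) z -> {for z, continuous G}.
  move=> Wz; apply/continuous_rVP => e e0.
  have e20 : 0 < e / 2 by rewrite divr_gt0.
  have [r1 r10 r1P] := open_ball_sub oW Wz.
  have /continuous_rVP/(_ _ e20)[r2 r20 r2P] := @continuous_mulmxr m m B z.
  exists (Num.min r1 r2); first by rewrite lt_min r10.
  move=> z'; rewrite lt_min => /andP[/r1P Wz' /r2P H].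
  apply: le_lt_trans (GL _ _ Wz' Wz) _.
  by rewrite mulrC -ltr_pdivlMr.
have dG z i j : (f @` V) z ->
    is_derive z 'e_i (fun z => G z 0 j) (invmx (jacm f (G z)) i j).
  move=> Wz; have [VG fG] := GP _ Wz.
  set x := G z in VG fG *; set J := jacm f x.
  have uJx : J \in unitmx by apply/uJr/Vr.
  (* [c] bounds the difference quotients of [G] along ['e_i], and [K] a column sum of the inverse
     Jacobian; the summands 1 keep both positive. The later choice of [eta] makes the total error
     [eta * c * K] equal to [e]. *)
  pose K := 1 + \sum_l `|invmx J l j|.
  have K0 : 0 < K by rewrite ltr_pwDl // sumr_ge0.
  pose c := 1 + 2 * `|('e_i : 'rV[R]_m) *m B|.
  have cpos : 0 < c by rewrite ltr_pwDl // mulr_ge0.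
  have D : (fun t : R => t^-1 *: (G (t *: 'e_i + z) 0 j - x 0 j)) @ (0 : R)^'
      --> invmx J i j.
    apply/cvgrPdist_le => e e0; pose eta := e / (c * K).
    have eta0 : 0 < eta by rewrite divr_gt0 // mulr_gt0.
    have ex l : \forall y \near x, `|f y 0 l - f x 0 l -
        \sum_p (y 0 p - x 0 p) * partial p (fun y => f y 0 l) x| <= eta * `|y - x|.
      have [s s0 sP] := C1_expand oU (VU x VG) (cf 1 l) eta0.
      by apply/nbhs_ballP; exists s => // y; rewrite -ball_normE /ball_ /= distrC; apply: sP.
    have {}ex : \forall y \near x, forall l, `|f y 0 l - f x 0 l -
        \sum_p (y 0 p - x 0 p) * partial p (fun y => f y 0 l) x| <= eta * `|y - x|.
      exact: (@near_forall _ _ (fun l y => `|f y 0 l - f x 0 l -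
        \sum_p (y 0 p - x 0 p) * partial p (fun y => f y 0 l) x| <= eta * `|y - x|)).
    have [s1 s10 s1P] := iffLR (near_rVP _ _) ex.
    have [s2 s20 s2P] := iffLR (continuous_rVP _ _) (cG z Wz) s1 s10.
    have [s3 s30 s3P] := open_ball_sub oW Wz.
    have s0 : 0 < Num.min s2 s3 by rewrite lt_min s20.
    near=> t.
    have t0 : t != 0 by near: t; exact: nbhs_dnbhs_neq.
    have ts : `|t| < Num.min s2 s3 by near: t; exact: dnbhs0_lt.
    have tz : `|t *: 'e_i + z - z| < Num.min s2 s3.
      rewrite addrK; apply: le_lt_trans ts; rewrite normrZ ler_piMr //.
      by apply: rV_norm_le => // l; rewrite mxE /=; case: eqP; rewrite ?normr1 ?normr0.
    have Wt : (f @` V) (t *: 'e_i + z).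
      by apply: s3P; apply: lt_le_trans tz _; rewrite ge_min lexx orbT.
    have Ht l : `|f (G (t *: 'e_i + z)) 0 l - f x 0 l -
        \sum_p (G (t *: 'e_i + z) 0 p - x 0 p) * partial p (fun y => f y 0 l) x|
         <= eta * `|G (t *: 'e_i + z) - x|.
      apply: (s1P (G (t *: 'e_i + z))); apply: s2P.
      by apply: lt_le_trans tz _; rewrite ge_min lexx.
    set z' := t *: 'e_i + z in Wt Ht *.
    have [VGt fGt] := GP _ Wt.
    pose d := G z' - x.
    have dn : `|d| <= `|t| * c.
      apply: le_trans (GL _ _ Wt Wz) _; rewrite -mulmxBl addrK -scalemxAl normrZ.
      by rewrite mulrCA ler_wpM2l // lerDr.
    (* Since [f (G z') - f x] is [t *: 'e_i], this is the remainder of the first-order expansion of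
       [f] at [x]. *)
    pose rem : 'rV[R]_m := t *: 'e_i - d *m J.
    have remn l : `|rem 0 l| <= eta * (`|t| * c).
      apply: le_trans (_ : _ <= eta * `|d|) _; last by rewrite ler_wpM2l // ltW.
      have := Ht l; rewrite fGt fG; apply: le_trans.
      rewrite le_eqVlt; apply/orP; left; apply/eqP; congr `|_|.
      rewrite /rem !mxE addrK; congr (_ - _).
      by apply: eq_bigr => p _; rewrite !mxE.
    have dE : d = t *: ('e_i *m invmx J) - rem *m invmx J.
      by rewrite /rem mulmxBl mulmxK // scalemxAl opprB addrCA subrr addr0.
    have dj : invmx J i j - t^-1 * d 0 j = t^-1 * (rem *m invmx J) 0 j.
      rewrite dE mxE mxE -rowE mxE [(- _ : 'rV__) 0 j]mxE mulrDr mulKf //.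
      by rewrite mulrN opprD opprK addrA subrr add0r.
    rewrite (_ : t^-1 *: _ = t^-1 * d 0 j); last by rewrite /d !mxE.
    rewrite dj normrM normfV mulrC ler_pdivrMr ?normr_gt0 //.
    rewrite mxE; apply: le_trans (ler_norm_sum _ _ _) _.
    have b l : `|rem 0 l * invmx J l j| <= eta * (`|t| * c) * `|invmx J l j|.
      by rewrite normrM ler_wpM2r.
    apply: le_trans (ler_sum _ (fun l _ => b l)) _.
    rewrite -mulr_sumr; apply: le_trans (_ : _ <= eta * (`|t| * c) * K) _.
      rewrite ler_wpM2l ?lerDr //.
      by rewrite mulr_ge0 ?(ltW eta0) // mulr_ge0 // ltW.
    rewrite -!mulrA [`|t| * _]mulrC !mulrA /eta -(mulrA _ c K).
    by rewrite divfK // mulf_neq0 // gt_eqF.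
  apply: DeriveDef; first by apply/cvg_ex; exists (invmx J i j).
  exact: cvg_lim D.
have pG z i j : (f @` V) z ->
    partial i (fun z => G z 0 j) z = invmx (jacm f (G z)) i j.
  by move=> Wz; case: (dG z i j Wz).
have cGj z j : (f @` V) z -> {for z, continuous (fun z => G z 0 j)}.
  move=> Wz; apply: (@continuous_comp _ _ _ G (fun y : 'rV[R]_m => y 0 j)).
    exact: cG.
  exact: coord_continuous.
(* Bootstrap: the partial derivatives of [G] are entries of the inverse Jacobian composed with [G],
   so each round gains one order. *)
have sG l j : Ck l (f @` V) (fun z => G z 0 j).
  elim: l j => [|l IH] j; first by split=> // z; apply: cGj.
  split=> [z|i]; first exact: cGj.
  split=> [z Wz|]; first by case: (dG z i j Wz).
  apply: (@eq_Ck _ _ _ _ (fun z => (fun x => invmx (jacm f x) i j) (G z))) => //.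
    by move=> z; rewrite inE => Wz; rewrite pG.
  apply: (@Ck_comp _ _ _ _ _ V G (fun x => invmx (jacm f x) i j)) => //.
    by move=> z /GP[].
  apply: Ck_invmx => // [x /Vr/uJr //|p q].
  rewrite (_ : (fun x => _) = partial p (fun y => f y 0 q)); last first.
    by apply/funext => x; rewrite mxE.
  by apply: Ck_sub VU _; apply: CkS_partial.
exists V, G; split=> //.
  split=> //.
  - by move=> j; apply/smooth_onP => l; apply: Ck_sub VU _.
  - by move=> j; apply/smooth_onP.
move=> x Vx; rewrite (_ : jacm G (f x) = invmx (jacm f x)).
  by rewrite mulmxV //; apply/uJr/Vr.
by apply/matrixP => i j; rewrite mxE pG ?Gf //.
Unshelve. all: by end_near. Qed.

End inverse_function.

(** * Linear Frobenius systems *)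

Section radial_average.
Context (R : realType) (m : nat).
Implicit Types (f g : 'rV[R]_m -> R) (x y : 'rV[R]_m).

Local Notation mu := (@lebesgue_measure R).

Definition cball (r : R) : set 'rV[R]_m := [set x | `|x| < r].

Lemma open_cball r : open (cball r).
Proof.
rewrite (_ : cball r = [set y | `|y - 0| < r]); first exact: open_norm_ball.
by apply/funext => y /=; rewrite subr0.
Qed.

Lemma cballZ r x (t : R) : 0 <= t <= 1 -> cball r x -> cball r (t *: x).
Proof.
move=> /andP[t0 t1]; rewrite /cball /= normrZ (ger0_norm t0).
by apply: le_lt_trans; rewrite ler_piMl.
Qed.

(** The exponent counts derivatives: differentiation under the integral produces a factor [t], so
    [partial j] turns [avg p f] into [avg p.+1 (partial j f)]. *)
Definition avg (p : nat) f x : R :=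
  \int[mu]_(t in `[0, 1]) (t ^+ p * f (t *: x)).

Lemma derivable_scale x v (t : R) j : derivable (fun t : R => (t *: x) 0 j) t v.
Proof.
rewrite (_ : (fun _ => _) = fun t : R => t * x 0 j); last first.
  by apply/funext => s; rewrite mxE.
exact: derivableM.
Qed.

Lemma continuous_scale x : continuous (fun t : R => t *: x).
Proof. by move=> t; exact: scalel_continuous. Qed.

Lemma continuous_ray r p f x : Ck 0 (cball r) f -> cball r x ->
  forall t : R, 0 <= t <= 1 -> {for t, continuous (fun t : R => t ^+ p * f (t *: x))}.
Proof.
move=> [cf _] xr t t01.
apply: (@continuousM _ _ (fun t : R => t ^+ p) (fun t : R => f (t *: x))).
  exact: exprn_continuous.
apply: (@continuous_comp _ _ _ (fun t : R => t *: x) f).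
  exact: continuous_scale.
by apply: cf; apply: cballZ.
Qed.

Lemma within_ray r p f x : Ck 0 (cball r) f -> cball r x ->
  {within `[0, 1], continuous (fun t : R => t ^+ p * f (t *: x))}.
Proof.
move=> Cf xr; apply: continuous_in_subspaceT => t.
by rewrite inE /= in_itv /=; exact: continuous_ray Cf xr t.
Qed.

Lemma integrable_ray r p f x : Ck 0 (cball r) f -> cball r x ->
  mu.-integrable `[0, 1] (EFin \o (fun t : R => t ^+ p * f (t *: x))).
Proof.
move=> Cf xr; apply: continuous_compact_integrable.
  exact: segment_compact.
exact: within_ray Cf xr.
Qed.

Lemma integrable_cst01 (c : R) : mu.-integrable `[0, 1] (EFin \o cst c).
Proof.
apply: continuous_compact_integrable; first exact: segment_compact.
by apply: continuous_subspaceT => t; exact: cst_continuous.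
Qed.

Lemma avg_le r p f x (c : R) : Ck 0 (cball r) f -> cball r x ->
  (forall y, cball r y -> `|f y| <= c) -> `|avg p f x| <= c.
Proof.
move=> Cf xr fc; rewrite /avg.
apply: le_trans (le_normr_Rintegral _ _) _ => //; first exact: integrable_ray Cf xr.
have -> : c = \int[mu]_(t in `[0, 1]) (cst c t).
  by rewrite Rintegral_cst //= lebesgue_measure_itv /= lte_fin ltr01 oppr0 adde0 mulr1.
apply: le_Rintegral => //.
- exact: (integrable_norm (integrable_ray p Cf xr)).
- exact: integrable_cst01.
move=> t /=; rewrite in_itv /= => t01; have /andP[t0 t1] := t01.
rewrite normrM -[leRHS]mul1r ler_pM //.
  by rewrite normrX ger0_norm // exprn_ile1.
by apply: fc; apply: cballZ.
Qed.

Lemma avgB r p f g x : Ck 0 (cball r) f -> Ck 0 (cball r) g -> cball r x ->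
  avg p (fun y => f y - g y) x = avg p f x - avg p g x.
Proof.
move=> Cf Cg xr; rewrite /avg -RintegralB //; last 2 first.
- exact: integrable_ray Cf xr.
- exact: integrable_ray Cg xr.
by apply: eq_Rintegral => t _; rewrite mulrBr.
Qed.

Lemma bounded_cball r rho g : Ck 0 (cball r) g -> 0 <= rho < r ->
  exists M, 0 <= M /\ forall y, `|y| <= rho -> `|g y| <= M.
Proof.
move=> [cg _] /andP[rho0 rhor]; pose B : set 'rV[R]_m := [set x | `|x| <= rho].
have cB : compact B.
  apply: bounded_closed_compact.
    exists rho; split; first exact: num_real.
    by move=> M Mr x Bx; apply: le_trans Bx (ltW Mr).
  rewrite (_ : B = (fun x => `|x|) @^-1` [set r | r <= rho]) //.
  apply: preimage_closed; last exact: closed_le.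
  by move=> x _; exact: norm_continuous.
have B0 : B !=set0 by exists 0; rewrite /B /= normr0.
have [|x _ maxx] := @EVT_max_rV R m (fun x => `|g x|) B B0 cB.
  apply: continuous_in_subspaceT => x /[!inE] Bx.
  apply: (@continuous_comp _ _ _ g Num.norm); last exact: norm_continuous.
  by apply: cg; apply: le_lt_trans rhor.
by exists `|g x|; split=> // y yr; apply: maxx; rewrite inE.
Qed.

(** Provides the domination for differentiating under the integral: points near [x] along ['e_j]
    stay in a closed ball of radius [rho < r], on which [bounded_cball] applies. *)
Lemma near0_cball r x j : cball r x -> exists2 d : R, 0 < d & exists2 rho,
  0 <= rho < r & forall l : R, `|l| < d -> `|l *: 'e_j + x| <= rho.
Proof.
rewrite /cball /= => xr; pose d := (r - `|x|) / 2.
have d0 : 0 < d by rewrite divr_gt0 // subr_gt0.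
exists d => //; exists (d + `|x|).
  rewrite addr_ge0 ?(ltW d0) //= -ltrBrDr /d.
  by rewrite ltr_pdivrMr // ltr_pMr ?subr_gt0 // ltr1n.
move=> l ld; apply: le_trans (ler_normD _ _) _; rewrite lerD2r.
apply: le_trans (ltW ld); rewrite normrZ ler_piMr //.
by apply: rV_norm_le => // k; rewrite mxE /=; case: eqP; rewrite ?normr1 ?normr0.
Qed.

Lemma is_derive_avg r p f x j : Ck 1 (cball r) f -> cball r x ->
  is_derive x 'e_j (avg p f) (avg p.+1 (partial j f) x).
Proof.
move=> Cf xr; have C0f := CkW Cf.
have [d d0 [rho rho0 rhod]] := near0_cball j xr.
have rhor : rho < r by case/andP: rho0.
have [M [M0 MP]] := bounded_cball (CkS_partial j Cf) rho0.
pose F (l t : R) := t ^+ p * f (t *: (l *: 'e_j + x)).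
have ir l : `|l| < d -> cball r (l *: 'e_j + x).
  by move=> /rhod H; apply: le_lt_trans rhor.
have dF (l t : R) : `|l| < d -> 0 <= t <= 1 -> is_derive l 1 (F ^~ t)
    (t ^+ p.+1 * partial j f (t *: (l *: 'e_j + x))).
  move=> ld t01.
  have Gd i : is_derive l 1 (fun l : R => (t *: (l *: 'e_j + x)) 0 i)
      (t * (i == j)%:R).
    rewrite (_ : (fun _ => _) = fun l : R => (t * (i == j)%:R) * l + t * x 0 i).
      apply: is_derive_eq; rewrite addr0 -[LHS]/((t * (i == j)%:R) * 1).
      by rewrite mulr1.
    by apply/funext => s; rewrite !mxE /=; ring.
  have D : is_derive l 1 (fun l : R => f (t *: (l *: 'e_j + x)))
      (t * partial j f (t *: (l *: 'e_j + x))).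
    have := @is_derive_comp_C1 R R m (cball r) f
      (fun l : R => t *: (l *: 'e_j + x)) l 1 (open_cball (r := r)).
    move=> /(_ _ Cf) H; apply: is_derive_eq (H _ _) _.
    - by apply: cballZ => //; apply: ir.
    - by move=> i; case: (Gd i).
    rewrite (bigD1 j) //= big1 ?addr0 => [|i /negPf ij].
      by have [_ ->] := Gd j; rewrite eqxx mulr1.
    by have [_ ->] := Gd i; rewrite ij mulr0 mul0r.
  have [D1 D2] := D; apply: DeriveDef.
    by have := derivableZ (k := t ^+ p) D1.
  by rewrite /F; have := deriveZ (t ^+ p) D1; rewrite D2 => ->; rewrite exprSr -mulrA.
have I0 : [set` `]-d, d[] (0 : R) by rewrite /= in_itv /= oppr_lt0 d0.
have Id (l : R) : [set` `]-d, d[] l -> `|l| < d by rewrite /= in_itv /= ltr_norml.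
have intF l : [set` `]-d, d[] l -> mu.-integrable `[0, 1] (EFin \o F l).
  by move=> /Id/ir H; exact: integrable_ray C0f H.
have derF l t : [set` `]-d, d[] l -> [set` `[0, 1]] t -> derivable (F ^~ t) l 1.
  by move=> /Id ld; rewrite /= in_itv /= => t01; case: (dF l t ld t01).
have ubF l t : [set` `]-d, d[] l -> [set` `[0, 1]] t ->
    `|partial1of2 F l t| <= cst M t.
  move=> /Id ld; rewrite /= in_itv /= => t01.
  rewrite partial1of2E; have [_ ->] := dF l t ld t01; have /andP[t0 t1] := t01.
  rewrite normrM -[leRHS]mul1r ler_pM //.
    by rewrite normrX ger0_norm // exprn_ile1.
  apply: MP; rewrite normrZ ger0_norm //; apply: le_trans (rhod l ld).
  by rewrite ler_piMl.
have m01 : measurable ([set` `[0, 1]] : set (measurableTypeR R)) by [].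
have dI := @derivable_under_integral R _ _ mu F _ m01 0 (-d) d I0 intF derF
  (cst M) (fun=> M0) (integrable_cst01 M) ubF.
have pI := @differentiation_under_integral R _ _ mu F _ m01 0 (-d) d I0 intF derF
  (cst M) (fun=> M0) (integrable_cst01 M) ubF.
have E : (fun l : R => \int[mu]_(t in `[0, 1]) F l t) =
         (fun l : R => avg p f (l *: 'e_j + x)) by [].
apply: DeriveDef; first by apply/derivable1P; rewrite -E.
have -> : 'D_'e_j (avg p f) x =
    'D_1 (fun l : R => avg p f (l *: 'e_j + x)) 0.
  rewrite /derive; set u := (X in lim (X @ _)); set w := (X in _ = lim (X @ _)).
  suff -> : u = w by [].
  by apply/funext => h; rewrite /u /w /= scale0r add0r addr0 [h *: 1]mulr1.
rewrite -E -derive1E pI; apply: eq_Rintegral => t; rewrite inE /= in_itv /= => t01.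
rewrite partial1of2E; have d0' : `|0 : R| < d by rewrite normr0.
have [_ ->] := dF 0 t d0' t01.
by rewrite scale0r add0r.
Qed.

Lemma partial_avg r p f x j : Ck 1 (cball r) f -> cball r x ->
  partial j (avg p f) x = avg p.+1 (partial j f) x.
Proof. by move=> Cf xr; have [] := is_derive_avg p j Cf xr. Qed.

Lemma lipschitz_cball r rho f : Ck 1 (cball r) f -> 0 <= rho < r ->
  exists2 K : R, 0 <= K & forall x y, `|x| < rho -> `|y| < rho ->
    `|f y - f x| <= K * `|y - x|.
Proof.
move=> Cf rr; have rhor : rho < r by case/andP: rr.
have H i := bounded_cball (CkS_partial i Cf) rr.
have /choice[M MP] := H.
pose K := \sum_i M i.
have M0 i : 0 <= M i by case: (MP i).
have K0 : 0 <= K by apply: sumr_ge0.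
have MK i : M i <= K by rewrite /K (bigD1 i) //= lerDl sumr_ge0.
pose h x : 'rV[R]_1 := \row_j f x.
have hE (j : 'I_1) : (fun y => h y 0 j) = f by apply/funext => y; rewrite mxE.
exists (K *+ m); first by rewrite mulrn_wge0.
move=> x y xr yr.
have := @lipschitz_partial R m 1 h 0 rho K K0 _ x y.
rewrite !subr0 => /(_ _ xr yr) L; apply: le_trans (L _).
  by have := rV_coord_le (h y - h x) 0; rewrite !mxE.
move=> z i j; rewrite subr0 hE => zr; split.
  by apply: CkS_derivable Cf _; apply: lt_trans rhor.
by case: (MP i) => _ /(_ z (ltW zr)) /le_trans; apply.
Qed.

(** One order is given away, since continuity of the average is read off from a Lipschitz bound on
    [f]; for smooth [f] this costs nothing. *)
Lemma Ck_avg r k p f : Ck k.+1 (cball r) f -> Ck k (cball r) (avg p f).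
Proof.
elim: k p f => [|k IH] p f Cf.
  split=> // x xr; have C0f := CkW Cf.
  pose rho := (`|x| + r) / 2.
  have xrho : `|x| < rho by rewrite /rho ltr_pdivlMr // mulr_natr mulr2n ltrD2l.
  have rhor : rho < r by rewrite /rho ltr_pdivrMr // mulr_natr mulr2n ltrD2r.
  have rr : 0 <= rho < r by rewrite rhor andbT (le_trans _ (ltW xrho)).
  have [K K0 KP] := lipschitz_cball Cf rr.
  apply/continuous_rV_realP => e e0.
  have K1 : 0 < K + 1 by rewrite ltr_wpDl.
  exists (Num.min (rho - `|x|) (e / (K + 1))).
    by rewrite lt_min subr_gt0 xrho divr_gt0.
  move=> y; rewrite lt_min => /andP[yx ye].
  have yrho : `|y| < rho.
    rewrite -(subrK x y); apply: le_lt_trans (ler_normD _ _) _.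
    by rewrite -ltrBrDr.
  have yr : cball r y by apply: lt_trans rhor.
  rewrite distrC /avg -RintegralB //; last 2 first.
  - exact: integrable_ray C0f xr.
  - exact: integrable_ray C0f yr.
  have iB : mu.-integrable `[0, 1]
     (EFin \o (fun t : R => t ^+ p * f (t *: x) - t ^+ p * f (t *: y))).
    apply: continuous_compact_integrable; first exact: segment_compact.
    apply: continuous_in_subspaceT => t; rewrite inE /= in_itv /= => t01.
    exact: (@continuousB _ _ _ (fun t : R => t ^+ p * f (t *: x))
      (fun t : R => t ^+ p * f (t *: y)) t
      (@continuous_ray r p f x C0f xr t t01) (@continuous_ray r p f y C0f yr t t01)).
  apply: le_lt_trans (le_normr_Rintegral _ iB) _ => //.
  apply: (@le_lt_trans _ _ (\int[mu]_(t in `[0, 1]) (cst (K * `|y - x|) t))).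
    apply: le_Rintegral => //.
    - exact: (integrable_norm iB).
    - exact: integrable_cst01.
    move=> t /=; rewrite in_itv /= => t01; have /andP[t0 t1] := t01.
    rewrite -mulrBr normrM -[leRHS]mul1r ler_pM //.
      by rewrite normrX ger0_norm // exprn_ile1.
    have sc (z : 'rV[R]_m) : `|z| < rho -> `|t *: z| < rho.
      by move=> H; apply: (@cballZ rho z t).
    rewrite distrC; apply: le_trans (KP _ _ (sc _ xrho) (sc _ yrho)) _.
    by rewrite ler_wpM2l // -scalerBr normrZ ger0_norm // ler_piMl.
  rewrite Rintegral_cst //= lebesgue_measure_itv /= lte_fin ltr01 oppr0 adde0 mulr1.
  rewrite ltr_pdivlMr // mulrC in ye; apply: le_lt_trans ye.
  by rewrite ler_wpM2r // lerDl.
split=> [x xr|i].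
  by apply: Ck_continuous (IH p f (CkW Cf)) xr.
have C1f : Ck 1 (cball r) f by elim: (k) Cf => [/CkW //|k' IH' /CkW]; exact: IH'.
split=> [x xr|]; first by case: (is_derive_avg p i C1f xr).
apply: (@eq_Ck _ _ _ _ (avg p.+1 (partial i f))); first exact: open_cball.
  by move=> x; rewrite inE => xr; rewrite (partial_avg p i C1f xr).
by apply: IH; apply: CkS_partial.
Qed.

(** The fundamental theorem of calculus for [t |-> t * f (t *: x)] on [0, 1], whose end values are 0
    and [f x]. *)
Lemma avg_fundamental r f x : Ck 1 (cball r) f -> cball r x ->
  f x = avg 0 f x + \sum_i x 0 i * avg 1 (partial i f) x.
Proof.
move=> Cf xr; have C0f := CkW Cf.
have C0p i : Ck 0 (cball r) (partial i f) by apply: CkS_partial.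
pose F (t : R) := t * f (t *: x).
pose G (t : R) := t ^+ 0 * f (t *: x) + \sum_i x 0 i * (t ^+ 1 * partial i f (t *: x)).
have dF (t : R) : 0 <= t <= 1 -> is_derive t 1 F (G t).
  move=> t01; have tr := cballZ t01 xr.
  have D : is_derive t 1 (fun t : R => f (t *: x))
      (\sum_j x 0 j * partial j f (t *: x)).
    have H := @is_derive_comp_C1 R R m (cball r) f (fun t : R => t *: x) t 1
      (open_cball (r := r)) tr Cf (fun j => @derivable_scale x 1 t j).
    apply: is_derive_eq H _; apply: eq_bigr => j _; congr (_ * _).
    rewrite (_ : (fun _ => _) = fun t : R => t * x 0 j); last first.
      by apply/funext => s; rewrite mxE.
    by rewrite -derive1E derive1Mr // derive1_id mul1r.
  have [D1 D2] := D.
  have Did : derivable (fun t : R => t) t 1 by [].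
  apply: DeriveDef; first by have := derivableM Did D1.
  rewrite -[LHS]/('D_1 ((fun t : R => t) * (fun t : R => f (t *: x))) t).
  rewrite (deriveM Did D1) D2 derive_id /G expr0 mul1r addrC; congr (_ + _).
    by rewrite [f _ *: _]mulr1.
  rewrite -[LHS]/(t * _) mulr_sumr; apply: eq_bigr => i _.
  by rewrite expr1 mulrCA.
have cF (t : R) : 0 <= t <= 1 -> {for t, continuous F}.
  move=> t01; apply: differentiable_continuous; apply/derivable1_diffP.
  by case: (dF t t01).
have cG : {within `[0, 1], continuous G}.
  apply: continuous_in_subspaceT => t; rewrite inE /= in_itv /= => t01.
  have c1 := @continuous_ray r 0 f x C0f xr t t01.
  have c2 : {for t, continuous (\sum_i (fun t => x 0 i * (t ^+ 1 * partial i f (t *: x))))}.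
    elim/big_ind: _ => [|g h cg ch|i _].
    - exact: cst_continuous.
    - exact: continuousD cg ch.
    - exact: (@continuousM _ _ (fun=> x 0 i) _ t (@cst_continuous _ _ _ t)
        (@continuous_ray r 1 _ x (C0p i) xr t t01)).
  have := continuousD c1 c2; rewrite (_ : _ + _ = G) //.
  by apply/funext => s; rewrite /G fctE fct_sumE.
have zero01 : 0 <= (0 : R) <= 1 by rewrite lexx ler01.
have one01 : 0 <= (1 : R) <= 1 by rewrite lexx ler01.
have oo (t : R) : t \in `]0, 1[ -> 0 <= t <= 1.
  by rewrite in_itv /= => /andP[? ?]; rewrite !ltW.
have H : (\int[mu]_(t in `[0%R, 1%R]) (G t)%:E = (F 1)%:E - (F 0)%:E)%E.
  apply: continuous_FTC2 => //.
    split.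
    - by move=> t /oo t01; case: (dF t t01).
    - exact/cvg_at_right_filter/cF.
    - exact/cvg_at_left_filter/cF.
  by move=> t /oo t01; rewrite derive1E; case: (dF t t01).
have {H} : \int[mu]_(t in `[0, 1]) G t = f x.
  by rewrite /Rintegral H /F /= mul0r subr0 mul1r scale1r.
move=> <-; rewrite /G /avg RintegralD //; last 2 first.
- exact: integrable_ray C0f xr.
- apply: continuous_compact_integrable; first exact: segment_compact.
  apply: continuous_in_subspaceT => t; rewrite inE /= in_itv /= => t01.
  rewrite -[X in continuous_at _ X]/(fun t : R => _).
  have c2 : {for t, continuous (\sum_i (fun t => x 0 i * (t ^+ 1 * partial i f (t *: x))))}.
    elim/big_ind: _ => [|g h cg ch|i _].
    - exact: cst_continuous.
    - exact: continuousD cg ch.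
    - exact: (@continuousM _ _ (fun=> x 0 i) _ t (@cst_continuous _ _ _ t)
        (@continuous_ray r 1 _ x (C0p i) xr t t01)).
  by move: c2; rewrite fct_sumE.
congr (_ + _).
have m01 : measurable ([set` `[0, 1]] : set (measurableTypeR R)) by [].
have IS (s : seq 'I_m) : mu.-integrable `[0, 1]
    (EFin \o (fun t : R => \sum_(i <- s) x 0 i * (t ^+ 1 * partial i f (t *: x)))) /\
  \int[mu]_(t in `[0, 1]) (\sum_(i <- s) x 0 i * (t ^+ 1 * partial i f (t *: x))) =
  \sum_(i <- s) x 0 i * \int[mu]_(t in `[0, 1]) (t ^+ 1 * partial i f (t *: x)).
  elim: s => [|i s [I1 I2]].
    rewrite (_ : (fun t : R => _) = cst 0); last first.
      by apply/funext => t; rewrite big_nil.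
    split; first exact: integrable_cst01.
    by rewrite big_nil [LHS]Rintegral_cst // mul0r.
  have I3 : mu.-integrable `[0, 1]
      (EFin \o (fun t : R => x 0 i * (t ^+ 1 * partial i f (t *: x)))).
    have := integrableZl m01 (x 0 i) (integrable_ray 1 (C0p i) xr).
    by apply: eq_integrable.
  split.
    have := integrableD m01 I3 I1.
    by apply: eq_integrable => // t _; rewrite /= big_cons EFinD.
  rewrite big_cons -I2 -RintegralZl //; last exact: integrable_ray (C0p i) xr.
  rewrite -RintegralD //; apply: eq_Rintegral => t _; by rewrite big_cons.
by case: (IS (index_enum 'I_m)).
Qed.

(** Poincare's homotopy operator: the integral of the 1-form with components [f i] along the segment
    from 0 to [x]. *)
Definition homot (f : 'I_m -> 'rV[R]_m -> R) x : R := \sum_i x 0 i * avg 0 (f i) x.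

Lemma Ck_homot r k (f : 'I_m -> 'rV[R]_m -> R) :
  (forall i, Ck k.+1 (cball r) (f i)) -> Ck k (cball r) (homot f).
Proof.
move=> Cf; apply: Ck_sum => [|i]; first exact: open_cball.
apply: CkM; [exact: open_cball|exact: Ck_coord|exact: Ck_avg].
Qed.

Lemma homotB r (f g : 'I_m -> 'rV[R]_m -> R) x :
  (forall i, Ck 0 (cball r) (f i)) -> (forall i, Ck 0 (cball r) (g i)) ->
  cball r x -> homot f x - homot g x = homot (fun i y => f i y - g i y) x.
Proof.
move=> Cf Cg xr; rewrite /homot -sumrB; apply: eq_bigr => i _.
by rewrite (avgB _ (Cf i) (Cg i) xr) mulrBr.
Qed.

Lemma sum_coord_le r (c : R) (u : 'I_m -> R) x : cball r x -> 0 <= c ->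
  (forall i, `|u i| <= c) -> `|\sum_i x 0 i * u i| <= r * c *+ m.
Proof.
move=> xr c0 uc; apply: le_trans (ler_norm_sum _ _ _) _.
have B i : `|x 0 i * u i| <= r * c.
  rewrite normrM ler_pM //.
  by apply: le_trans (rV_coord_le x i) (ltW _).
apply: le_trans (ler_sum _ (fun i _ => B i)) _.
by rewrite sumr_const card_ord.
Qed.

Lemma homot_le r (f : 'I_m -> 'rV[R]_m -> R) x (c : R) :
  (forall i, Ck 0 (cball r) (f i)) -> cball r x -> 0 <= c ->
  (forall i y, cball r y -> `|f i y| <= c) -> `|homot f x| <= r * c *+ m.
Proof.
move=> Cf xr c0 fc; apply: sum_coord_le => // i.
by apply: avg_le (Cf i) xr _ => y; apply: fc.
Qed.

(* Poincare's homotopy formula: the defect [d_j (H f) - f_j] is an average of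
   the components of the exterior derivative of [sum_i f_i dx_i]. *)
Lemma partial_homot r (f : 'I_m -> 'rV[R]_m -> R) x j :
  (forall i, Ck 2 (cball r) (f i)) -> cball r x ->
  partial j (homot f) x - f j x =
  \sum_i x 0 i * avg 1 (fun y => partial j (f i) y - partial i (f j) y) x.
Proof.
move=> C2f xr; have C1f i := CkW (C2f i).
have C0p i k : Ck 0 (cball r) (partial i (f k)) by apply: CkS_partial.
have dav i : derivable (avg 0 (f i)) x 'e_j.
  by case: (is_derive_avg 0 j (C1f i) xr).
have dco i : derivable (fun y : 'rV[R]_m => y 0 i) x 'e_j.
  by case: (is_derive_coord i x 'e_j).
have dpr i : derivable (fun y : 'rV[R]_m => y 0 i * avg 0 (f i) y) x 'e_j.
  exact: derivableM.
have [_ ->] := partial_sum (index_enum 'I_m) dpr.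
rewrite (avg_fundamental (C1f j) xr).
have -> : \sum_i partial j (fun y : 'rV[R]_m => y 0 i * avg 0 (f i) y) x =
    avg 0 (f j) x + \sum_i x 0 i * avg 1 (partial j (f i)) x.
  have E i : partial j (fun y : 'rV[R]_m => y 0 i * avg 0 (f i) y) x =
      (i == j)%:R * avg 0 (f i) x + x 0 i * avg 1 (partial j (f i)) x.
    rewrite partialM // partial_coord (partial_avg 0 j (C1f i) xr) addrC.
    by rewrite mulrC.
  rewrite (eq_bigr _ (fun i _ => E i)) big_split /=; congr (_ + _).
  rewrite (bigD1 j) //= eqxx mul1r big1 ?addr0 // => i /negPf ->.
  by rewrite mul0r.
rewrite opprD addrACA subrr add0r -sumrB; apply: eq_bigr => i _.
by rewrite (avgB _ (C0p j i) (C0p i j) xr) mulrBr.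
Qed.

Lemma partial_homot_le r (f : 'I_m -> 'rV[R]_m -> R) x j (c : R) :
  (forall i, Ck 2 (cball r) (f i)) -> cball r x -> 0 <= c ->
  (forall i y, cball r y -> `|partial j (f i) y - partial i (f j) y| <= c) ->
  `|partial j (homot f) x - f j x| <= r * c *+ m.
Proof.
move=> C2f xr c0 fc; rewrite (partial_homot j C2f xr).
apply: sum_coord_le => // i.
apply: (@avg_le r) => //; last by move=> y; apply: fc.
by apply: CkB; [exact: open_cball|apply: CkS_partial; apply: CkW..].
Qed.

End radial_average.

(** * Limits of geometrically convergent sequences *)

Section uniform_limit.
Context (R : realType).

Lemma pow2_small (c e : R) : 0 <= c -> 0 < e -> exists k : nat, c / 2 ^+ k < e.
Proof.
move=> c0 e0; exists (Num.truncn (c / e)).+1.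
rewrite ltr_pdivrMr ?exprn_gt0 // mulrC -ltr_pdivrMr //.
apply: lt_trans (truncnS_gt _) _; rewrite -natrX ltr_nat.
exact: ltn_expl.
Qed.

Lemma le_pow2 (a b c : R) : 0 <= c ->
  (forall k : nat, a <= b + c / 2 ^+ k) -> a <= b.
Proof.
move=> c0 H; apply/ler_addgt0Pl => e e0; have [k ke] := pow2_small c0 e0.
by apply: le_trans (H k) _; rewrite addrC lerD2r ltW.
Qed.

(* A sequence with steps c / 2^k is squeezed between the monotone sequences
   u_k - 2 c / 2^k and u_k + 2 c / 2^k. *)
Lemma geometric_limit (u : nat -> R) (c : R) : 0 <= c ->
  (forall k, `|u k.+1 - u k| <= c / 2 ^+ k) ->
  exists l, forall k, `|l - u k| <= 2 * c / 2 ^+ k.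
Proof.
move=> c0 uc; pose d k := 2 * c / 2 ^+ k.
have dS k : d k = d k.+1 + c / 2 ^+ k.
  have p0 : (2 : R) ^+ k != 0 by rewrite expf_neq0.
  by rewrite /d exprS; field.
have step k n : `|u (n + k)%N - u k| <= d k - d (n + k)%N.
  elim: n => [|n IH]; first by rewrite !subrr normr0.
  rewrite addSn; have := uc (n + k)%N; rewrite (dS (n + k)%N) in IH.
  move: IH; rewrite !ler_norml.
  move=> /andP[? ?] /andP[? ?]; apply/andP; split; lra.
have d0 k : 0 <= d k by rewrite /d divr_ge0 ?mulr_ge0 // exprn_ge0.
have uu k l : u k - d k <= u l + d l.
  have [kl|/ltnW lk] := leqP k l.
    have := step k (l - k)%N; rewrite subnK // ler_norml.
    have := d0 l; have := d0 k; move=> ? ? /andP[? ?]; lra.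
  have := step l (k - l)%N; rewrite subnK // ler_norml.
  have := d0 l; have := d0 k; move=> ? ? /andP[? ?]; lra.
pose E := [set u k - d k | k in [set: nat]].
have hE : has_sup E.
  split; first by exists (u 0 - d 0); exists 0.
  by exists (u 0 + d 0) => _ [k _ <-]; apply: uu.
exists (sup E) => k.
have lo : u k - d k <= sup E by apply: ub_le_sup; [case: hE|exists k].
have hi : sup E <= u k + d k.
  by apply: ge_sup; [case: hE|move=> _ [l _ <-]; apply: uu].
by rewrite ler_norml -/(d k); apply/andP; split; lra.
Qed.

Lemma continuous_uniform_limit m (U : set 'rV[R]_m) (F : nat -> 'rV[R]_m -> R)
    (f : 'rV[R]_m -> R) (D : R) x : open U -> U x -> 0 <= D ->
  (forall k, {for x, continuous (F k)}) ->
  (forall k y, U y -> `|F k y - f y| <= D / 2 ^+ k) -> {for x, continuous f}.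
Proof.
move=> oU Ux D0 cF Ff; apply/continuous_rV_realP => e e0.
have e30 : 0 < e / 3 by rewrite divr_gt0.
have [k ke] := pow2_small D0 e30.
have [r1 r10 r1P] := open_ball_sub oU Ux.
have [r2 r20 r2P] := iffLR (continuous_rV_realP _ _) (cF k) _ e30.
exists (Num.min r1 r2); first by rewrite lt_min r10.
move=> y; rewrite lt_min => /andP[/r1P Uy /r2P].
have := le_lt_trans (Ff k x Ux) ke; have := le_lt_trans (Ff k y Uy) ke.
rewrite !ltr_norml => /andP[? ?] /andP[? ?] /andP[? ?].
by apply/andP; split; lra.
Qed.

(** The mean value theorem is applied to each [F k]. The intermediate point depends on [k], but
    continuity of [g] at [x] controls all of them by the same [e], after which [le_pow2] removes
    [k]. *)
Lemma is_derive_uniform_limit m (U : set 'rV[R]_m) (F : nat -> 'rV[R]_m -> R)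
    (f g : 'rV[R]_m -> R) (D : R) x j : open U -> U x -> 0 <= D ->
  (forall k y, U y -> derivable (F k) y 'e_j) ->
  (forall k y, U y -> `|F k y - f y| <= D / 2 ^+ k) ->
  (forall k y, U y -> `|partial j (F k) y - g y| <= D / 2 ^+ k) ->
  {for x, continuous g} -> is_derive x 'e_j f (g x).
Proof.
move=> oU Ux D0 dF Ff Fg cg.
have L : (fun t : R => t^-1 *: (f (t *: 'e_j + x) - f x)) @ (0 : R)^' --> g x.
  apply/cvgrPdist_le => e e0.
  have [r1 r10 r1P] := open_ball_sub oU Ux.
  have [r2 r20 r2P] := iffLR (continuous_rV_realP _ _) cg _ e0.
  have r0 : 0 < Num.min r1 r2 by rewrite lt_min r10.
  near=> t.
  have t0 : t != 0 by near: t; exact: nbhs_dnbhs_neq.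
  have ts : `|t| < Num.min r1 r2 by near: t; exact: dnbhs0_lt.
  have near_x (s : R) : 0 <= s <= 1 ->
      `|(s * t) *: 'e_j + x - x| < Num.min r1 r2.
    move=> /andP[s0 s1]; rewrite addrK; apply: le_lt_trans ts.
    rewrite normrZ normrM (ger0_norm s0) -[leRHS]mulr1 ler_pM ?mulr_ge0 //.
      by rewrite ler_piMl.
    by apply: rV_norm_le => // l; rewrite mxE /=; case: eqP; rewrite ?normr1 ?normr0.
  have near_U (s : R) : 0 <= s <= 1 -> U ((s * t) *: 'e_j + x).
    by move=> /near_x; rewrite lt_min => /andP[/r1P].
  have one01 : 0 <= (1 : R) <= 1 by rewrite ler01 lexx.
  have Ut : U (t *: 'e_j + x) by have := near_U 1 one01; rewrite mul1r.
  have key : `|f (t *: 'e_j + x) - f x - t * g x| <= `|t| * e.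
    apply: (@le_pow2 _ _ (2 * D + `|t| * D)).
      by rewrite addr_ge0 // mulr_ge0.
    move=> k; have [s s01|s s01 Es] := @mvt_line _ _ (F k) x 'e_j t.
      by apply: dF; apply: near_U.
    set xi := (s * t) *: 'e_j + x in Es.
    have gxi : `|g xi - g x| <= e.
      by apply/ltW/r2P; have := near_x s s01; rewrite lt_min => /andP[].
    have pxi : `|partial j (F k) xi - g xi| <= D / 2 ^+ k by apply/Fg/near_U.
    have -> : f (t *: 'e_j + x) - f x - t * g x =
        (F k x - f x) - (F k (t *: 'e_j + x) - f (t *: 'e_j + x))
        + t * ((partial j (F k) xi - g xi) + (g xi - g x)).
      have -> : t * ((partial j (F k) xi - g xi) + (g xi - g x)) =
          (F k (t *: 'e_j + x) - F k x) - t * g x.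
        by rewrite Es addrA subrK mulrBr.
      move: (F k x) (f x) (F k _) (f _) (t * _) => a b c d h; ring.
    have -> : `|t| * e + (2 * D + `|t| * D) / 2 ^+ k =
        (D / 2 ^+ k + D / 2 ^+ k) + `|t| * (D / 2 ^+ k + e).
      by move: (2 ^- k) => p; ring.
    apply: le_trans (ler_normD _ _) _; apply: lerD.
      by apply: le_trans (ler_normB _ _) _; apply: lerD; apply: Ff.
    rewrite normrM ler_wpM2l //; apply: le_trans (ler_normD _ _) _.
    exact: lerD.
  have -> : g x - t^-1 *: (f (t *: 'e_j + x) - f x) =
      - (t^-1 * (f (t *: 'e_j + x) - f x - t * g x)).
    by rewrite mulrBr mulKf // opprB.
  by rewrite normrN normrM normfV ler_pdivrMl ?normr_gt0.
apply: DeriveDef; first by apply/cvg_ex; exists (g x).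
exact: cvg_lim L.
Unshelve. all: by end_near. Qed.

End uniform_limit.

(** * Picard iteration for a completely integrable linear system *)

Section linear_frobenius.
Context (R : realType) (m N : nat).

Lemma derivable_mulmx (s : 'rV[R]_m -> 'rV[R]_N) (A : 'rV[R]_m -> 'M[R]_N) x j b :
  (forall a, derivable (fun y => s y 0 a) x 'e_j) ->
  (forall a, derivable (fun y => A y a b) x 'e_j) ->
  partial j (fun y => (s y *m A y) 0 b) x =
  \sum_a (partial j (fun y => s y 0 a) x * A x a b +
          s x 0 a * partial j (fun y => A y a b) x).
Proof.
move=> ds dA.
have dsA a : derivable (fun y => s y 0 a * A y a b) x 'e_j.
  exact: derivableM (ds a) (dA a).
rewrite (_ : (fun y => _) = fun y => \sum_a s y 0 a * A y a b); last first.
  by apply/funext => y; rewrite mxE.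
have [_ ->] := partial_sum (index_enum 'I_N) dsA.
apply: eq_bigr => a _; rewrite (partialM (ds a) (dA a)) addrC; congr (_ + _).
exact: mulrC.
Qed.

Lemma Ck_mulmx k (U : set 'rV[R]_m) (s : 'rV[R]_m -> 'rV[R]_N)
    (A : 'rV[R]_m -> 'M[R]_N) b : open U ->
  (forall a, Ck k U (fun y => s y 0 a)) -> (forall a, Ck k U (fun y => A y a b)) ->
  Ck k U (fun y => (s y *m A y) 0 b).
Proof.
move=> oU Cs CA; rewrite (_ : (fun y => _) = fun y => \sum_a s y 0 a * A y a b).
  by apply: Ck_sum => // a; apply: CkM.
by apply/funext => y; rewrite mxE.
Qed.

Lemma bounded_cball_fin (I : finType) (r rho : R) (g : I -> 'rV[R]_m -> R) :
  (forall i, Ck 0 (cball r) (g i)) -> 0 <= rho < r ->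
  exists M, 0 <= M /\ forall i y, `|y| <= rho -> `|g i y| <= M.
Proof.
move=> Cg rr; have /choice[M MP] := fun i => bounded_cball (Cg i) rr.
have M0 i : 0 <= M i by case: (MP i).
exists (\sum_i M i); split; first by apply: sumr_ge0.
move=> i y yr; case: (MP i) => _ /(_ y yr) /le_trans; apply.
by rewrite (bigD1 i) //= lerDl sumr_ge0.
Qed.

Lemma norm_sum_le (u : 'I_N -> R) (c : R) : (forall a, `|u a| <= c) ->
  `|\sum_a u a| <= c *+ N.
Proof.
move=> uc; apply: le_trans (ler_norm_sum _ _ _) _.
by apply: le_trans (ler_sum _ (fun i _ => uc i)) _; rewrite sumr_const card_ord.
Qed.

(** [homot] gives a primitive of closed forms only, and the form built from an approximate solution
    is not closed. Under the integrability condition on [A], however, its exterior derivative is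
    controlled by the last step and the last defect of the equation, so the two decay together
    without loss of derivatives. *)
Lemma linear_frobenius0 (r0 : R) (A : 'I_m -> 'rV[R]_m -> 'M[R]_N) (s0 : 'rV[R]_N) :
  0 < r0 ->
  (forall i a b, smooth_on (cball r0) (fun x => A i x a b)) ->
  (forall x i j a b, cball r0 x ->
     partial j (fun y => A i y a b) x - partial i (fun y => A j y a b) x =
     (A i x *m A j x - A j x *m A i x) a b) ->
  exists r s, [/\ 0 < r, r <= r0, s 0 = s0, smooth_map (cball r) s &
    forall x i b, cball r x -> partial i (fun y => s y 0 b) x = (s x *m A i x) 0 b].
Proof.
move=> r00 sA flatA.
have CA0 l i a b : Ck l (cball r0) (fun x => A i x a b).
  exact: (iffLR (smooth_onP _ _) (sA i a b)).
pose rho := r0 / 2.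
have rr : 0 <= rho < r0.
  by rewrite divr_ge0 ?ltW //= ltr_pdivrMr // ltr_pMr // ltr1n.
have [K1 [K10 K1P]] := @bounded_cball_fin ('I_m * 'I_N * 'I_N)%type r0 rho
  (fun p x => A p.1.1 x p.1.2 p.2) (fun p => CA0 0%N _ _ _) rr.
have [K2 [K20 K2P]] := @bounded_cball_fin ('I_m * 'I_m * 'I_N * 'I_N)%type r0 rho
  (fun p => partial p.1.1.1 (fun x => A p.1.1.2 x p.1.2 p.2))
  (fun p => CkS_partial _ (CA0 1%N _ _ _)) rr.
pose K := K1 + K2; have K0 : 0 <= K by apply: addr_ge0.
pose L := K *+ N *+ m; have L0 : 0 <= L by rewrite !mulrn_wge0.
(* This ensures [r * L <= 8^-1]: the new defect is at most [4 * (r * L)] times the old bound, hence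
   half of it. The summand 1 covers [L = 0]. *)
pose r := Num.min rho (8 * (L + 1))^-1.
have L1 : 0 < L + 1 by rewrite ltr_wpDl.
have rpos : 0 < r by rewrite lt_min divr_gt0 //= invr_gt0 mulr_gt0.
have rL : r * L <= 8^-1.
  apply: le_trans (_ : (8 * (L + 1))^-1 * (L + 1) <= _).
    by rewrite ler_pM ?(ltW rpos) // ?lerDl // ge_min lexx orbT.
  by rewrite invfM -mulrA mulVf ?mulr1 // gt_eqF.
have rrho : r <= rho by rewrite ge_min lexx.
have rr0 : r <= r0 by apply: le_trans rrho _; case/andP: rr => _ /ltW.
have sub : cball r `<=` (cball r0 : set 'rV[R]_m).
  by move=> x xr; apply: lt_le_trans rr0.
have rhoP (x : 'rV[R]_m) : cball r x -> `|x| <= rho.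
  by move=> xr; apply: le_trans (ltW xr) rrho.
have CA l i a b : Ck l (cball r) (fun x => A i x a b) by apply: Ck_sub sub _.
have AK i x a b : cball r x -> `|A i x a b| <= K.
  move=> /rhoP xr; apply: le_trans (K1P (i, a, b) x xr) _.
  by rewrite lerDl.
have dAK j i x a b : cball r x -> `|partial j (fun x => A i x a b) x| <= K.
  move=> /rhoP xr; apply: le_trans (K2P (j, i, a, b) x xr) _.
  by rewrite lerDr.
pose S := fix S (k : nat) (x : 'rV[R]_m) : 'rV[R]_N := if k is k'.+1 then
  \row_b (s0 0 b + homot (fun i y => (S k' y *m A i y) 0 b) x) else 0.
have oB : open (cball r : set 'rV[R]_m) by apply: open_cball.
have CS k l b : Ck l (cball r) (fun x => S k x 0 b).
  elim: k l b => [|k IH] l b.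
    by rewrite (_ : (fun x => _) = fun=> 0);
      [apply: Ck_cst|apply/funext => x; rewrite mxE].
  rewrite (_ : (fun x => _) = fun x =>
      s0 0 b + homot (fun i y => (S k y *m A i y) 0 b) x); last first.
    by apply/funext => x; rewrite mxE.
  by apply: CkD => //; [apply: Ck_cst|apply: Ck_homot => i; apply: Ck_mulmx].
have Cf k l i b : Ck l (cball r) (fun y => (S k y *m A i y) 0 b).
  by apply: Ck_mulmx.
have dS k x j a : cball r x -> derivable (fun y => S k y 0 a) x 'e_j.
  by move=> xr; apply: CkS_derivable (CS k 1%N a) xr.
have dA i x j a b : cball r x -> derivable (fun y => A i y a b) x 'e_j.
  by move=> xr; apply: CkS_derivable (CA 1%N i a b) xr.
have pS k x j b : cball r x -> partial j (fun y => S k.+1 y 0 b) x =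
    partial j (homot (fun i y => (S k y *m A i y) 0 b)) x.
  move=> xr; rewrite (_ : (fun y => S k.+1 y 0 b) = fun x =>
      s0 0 b + homot (fun i y => (S k y *m A i y) 0 b) x); last first.
    by apply/funext => y; rewrite mxE.
  rewrite partialD; [by rewrite partial_cst add0r|exact: derivable_cst|].
  by apply: CkS_derivable (@Ck_homot R m r 1 _ (fun i => Cf k 2%N i b)) xr.
pose C := `|s0|.
(* Step and defect are estimated together. The iteration starts from [S 0 = 0], so [S 1] is the
   constant [s0], the first step is at most [C] and the first defect is zero. *)
have P k x : cball r x -> (forall b, `|S k.+1 x 0 b - S k x 0 b| <= C / 2 ^+ k) /\
    forall j b, `|partial j (fun y => S k.+1 y 0 b) x - (S k x *m A j x) 0 b|
      <= C / 2 ^+ k.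
  elim: k x => [|k IH] x xr.
    have h0 b y : homot (fun i y => (S 0%N y *m A i y) 0 b) y = 0.
      rewrite /homot big1 // => i _.
      rewrite (_ : (fun y => _) = fun=> 0); last first.
        by apply/funext => z; rewrite mul0mx mxE.
      by rewrite /avg; under eq_Rintegral do rewrite mulr0; rewrite Rintegral_cst // mul0r mulr0.
    rewrite expr0 divr1; split=> [b|j b].
      by rewrite !mxE h0 addr0 subr0; apply: rV_coord_le.
    rewrite pS // mul0mx mxE subr0 (_ : homot _ = fun=> 0).
      by rewrite partial_cst normr0 /C.
    by apply/funext => y; apply: h0.
  pose dl := C / 2 ^+ k.
  have dl0 : 0 <= dl by apply: divr_ge0; [exact: normr_ge0|exact: exprn_ge0].
  have dlS : C / 2 ^+ k.+1 = dl / 2.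
    have p0 : (2 : R) ^+ k != 0 by rewrite expf_neq0.
    by rewrite /dl exprS; field.
  rewrite dlS; split=> [b|j b].
    have -> : S k.+2 x 0 b - S k.+1 x 0 b =
        homot (fun i y => (S k.+1 y *m A i y) 0 b) x -
        homot (fun i y => (S k y *m A i y) 0 b) x.
      by rewrite mxE [in X in _ - X]mxE opprD addrACA subrr add0r.
    rewrite (@homotB R m r) //.
    have c0 : 0 <= (dl * K) *+ N by rewrite mulrn_wge0 // mulr_ge0.
    apply: le_trans (homot_le (r := r) _ xr c0 _) _.
    - by move=> i; apply: CkB.
    - move=> i y yr; rewrite !mxE -sumrB; apply: norm_sum_le => a.
      rewrite -mulrBl normrM ler_pM //; first by case: (IH y yr).
      exact: AK.
    have -> : r * (dl * K *+ N) *+ m = dl * (r * L).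
      by rewrite /L -!mulrnAr mulrCA.
    apply: (ler_wpM2l dl0); apply: le_trans rL _.
    by rewrite lef_pV2 ?posrE // ler_nat.
  rewrite pS //.
  have c0 : 0 <= (4 * dl * K) *+ N.
    by apply: mulrn_wge0; apply: mulr_ge0 => //; apply: mulr_ge0.
  apply: le_trans (partial_homot_le (r := r) _ xr c0 _) _.
  - by move=> i; apply: Cf.
  - move=> i y yr; have [IHe IHw] := IH y yr.
    rewrite (derivable_mulmx (fun a => dS k.+1 y j a yr) (fun a => dA i y j a b yr)).
    rewrite (derivable_mulmx (fun a => dS k.+1 y i a yr) (fun a => dA j y i a b yr)).
    pose w j a := partial j (fun y => S k.+1 y 0 a) y - (S k y *m A j y) 0 a.
    pose e a := S k.+1 y 0 a - S k y 0 a.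
    pose dd a := partial j (fun y => A i y a b) y - partial i (fun y => A j y a b) y.
    have -> : \sum_a (partial j (fun y => S k.+1 y 0 a) y * A i y a b +
          S k.+1 y 0 a * partial j (fun y => A i y a b) y) -
        \sum_a (partial i (fun y => S k.+1 y 0 a) y * A j y a b +
          S k.+1 y 0 a * partial i (fun y => A j y a b) y) =
        \sum_a (w j a * A i y a b - w i a * A j y a b + e a * dd a).
      (* The terms in [S k] alone cancel by [flatA]; what remains of the exterior derivative is
         linear in the defect [w] and the step [e]. Its three summands are at most [dl * K],
         [dl * K] and [dl * (K + K)], whence the factor 4. *)
      have Z : \sum_a ((S k y *m A j y) 0 a * A i y a b -
          (S k y *m A i y) 0 a * A j y a b + S k y 0 a * dd a) = 0.
        rewrite big_split /= sumrB.
        have -> : \sum_a (S k y *m A j y) 0 a * A i y a b = (S k y *m A j y *m A i y) 0 b.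
          by rewrite [RHS]mxE.
        have -> : \sum_a (S k y *m A i y) 0 a * A j y a b = (S k y *m A i y *m A j y) 0 b.
          by rewrite [RHS]mxE.
        have -> : \sum_a S k y 0 a * dd a =
            (S k y *m (A i y *m A j y - A j y *m A i y)) 0 b.
          by rewrite [RHS]mxE; apply: eq_bigr => a _; rewrite /dd flatA //; apply: sub.
        rewrite mulmxBr !mulmxA.
        move: (S k y *m A j y *m A i y) (S k y *m A i y *m A j y) => u v.
        by rewrite !mxE addrA subrK subrr.
      rewrite -sumrB -[LHS]subr0 -[X in _ - X]Z -sumrB.
      apply: eq_bigr => a _; rewrite /w /e /dd.
      move: (partial _ _ _) (partial _ _ _) (partial _ _ _) (partial _ _ _).
      move: ((_ *m _) _ _) ((_ *m _) _ _) (A i y a b) (A j y a b).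
      move: (S k.+1 y 0 a) (S k y 0 a) => u1 u2 u3 u4 u5 u6 p1 p2 p3 p4; ring.
    apply: norm_sum_le => a.
    have -> : 4 * dl * K = dl * K + dl * K + dl * (K + K) by ring.
    apply: le_trans (ler_normD _ _) _; apply: lerD.
      apply: le_trans (ler_normB _ _) _.
      by apply: lerD; rewrite normrM ler_pM //; first [exact: IHw|exact: AK].
    rewrite normrM ler_pM //; first exact: IHe.
    by apply: le_trans (ler_normB _ _) _; apply: lerD; apply: dAK.
  have -> : r * (4 * dl * K *+ N) *+ m = 4 * dl * (r * L).
    by rewrite /L -!mulrnAr mulrCA.
  have -> : dl / 2 = 4 * dl * 8^-1 by field.
  by apply: ler_wpM2l rL; rewrite mulr_ge0.
have C0 : 0 <= C by rewrite normr_ge0.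
have /choice[s sP] : forall x : 'rV[R]_m, exists v : 'rV[R]_N, cball r x ->
    forall k b, `|v 0 b - S k x 0 b| <= 2 * C / 2 ^+ k.
  move=> x; have [xr|nxr] := pselect (cball r x); last by exists 0.
  have H b : exists l : R, forall k, `|l - S k x 0 b| <= 2 * C / 2 ^+ k.
    by apply: geometric_limit => // k; case: (P k x xr).
  have /choice[v vP] := H; exists (\row_b v b) => _ k b.
  by rewrite mxE.
have SP k x b : cball r x -> `|S k x 0 b - s x 0 b| <= 2 * C / 2 ^+ k.
  by move=> xr; rewrite distrC; apply: sP.
have cs b x : cball r x -> {for x, continuous (fun y => s y 0 b)}.
  move=> xr; apply: (@continuous_uniform_limit _ _ (cball r)
    (fun k y => S k y 0 b) _ (2 * C)) => //; first by rewrite mulr_ge0.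
    by move=> k; apply: Ck_continuous (CS k 0%N b) xr.
  by move=> k y yr; apply: SP.
have Cs0 b : Ck 0 (cball r) (fun y => s y 0 b) by split=> // x; apply: cs.
have Ds x j b : cball r x ->
    is_derive x 'e_j (fun y => s y 0 b) ((s x *m A j x) 0 b).
  move=> xr; pose D := 2 * C + C + (2 * C * K) *+ N.
  have CK0 : 0 <= (2 * C * K) *+ N by rewrite mulrn_wge0 // !mulr_ge0.
  have D0 : 0 <= D by rewrite !addr_ge0 // mulr_ge0.
  have p0 k : 0 <= (2 ^+ k)^-1 :> R by rewrite invr_ge0 exprn_ge0.
  apply: (@is_derive_uniform_limit _ _ (cball r) (fun k y => S k.+1 y 0 b) _
    (fun y => (s y *m A j y) 0 b) D) => //.
  - by move=> k y yr; apply: dS.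
  - move=> k y yr; apply: le_trans (SP k.+1 y b yr) _.
    apply: (@le_trans _ _ (2 * C / 2 ^+ k)).
      rewrite ler_wpM2l ?mulr_ge0 // lef_pV2 ?posrE ?exprn_gt0 //.
      by rewrite ler_eXn2l ?ltr1n.
    rewrite ler_wpM2r // /D -addrA lerDl addr_ge0 //.
  - move=> k y yr.
    have E : (S k y *m A j y) 0 b - (s y *m A j y) 0 b =
        \sum_a (S k y 0 a - s y 0 a) * A j y a b.
      by rewrite !mxE -sumrB; apply: eq_bigr => a _; rewrite mulrBl.
    have B1 : `|(S k y *m A j y) 0 b - (s y *m A j y) 0 b| <=
        (2 * C / 2 ^+ k * K) *+ N.
      rewrite E; apply: norm_sum_le => a; rewrite normrM ler_pM //.
        exact: SP.
      exact: AK.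
    have [_ /(_ j b) B2] := P k y yr.
    rewrite -(subrK ((S k y *m A j y) 0 b) (partial _ _ _)) -addrA.
    apply: le_trans (ler_normD _ _) _; apply: le_trans (lerD B2 B1) _.
    rewrite mulrAC -mulrnAl -mulrDl ler_wpM2r // /D -addrA lerDr mulr_ge0 //.
  - exact: Ck_continuous (Ck_mulmx oB Cs0 (fun a => CA 0%N j a b)) xr.
(* The equation expresses the partial derivatives of [s] through [s] itself, so regularity
   bootstraps from continuity. *)
have Cs l b : Ck l (cball r) (fun y => s y 0 b).
  elim: l b => [|l IH] b //.
  split=> [x|i]; first exact: cs.
  split=> [x xr|]; first by case: (Ds x i b xr).
  apply: (@eq_Ck _ _ _ _ (fun y => (s y *m A i y) 0 b)) => //.
    by move=> x; rewrite inE => xr; case: (Ds x i b xr).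
  exact: Ck_mulmx.
exists r, s; split=> //.
- apply/rowP => b; apply/eqP; rewrite -subr_eq0 -normr_le0.
  have c00 : cball r (0 : 'rV[R]_m) by rewrite /cball /= normr0.
  apply: (@le_pow2 _ _ _ (2 * C)); first by rewrite mulr_ge0.
  move=> k; rewrite add0r; have := sP 0 c00 k.+1 b.
  have -> : S k.+1 0 0 b = s0 0 b.
    by rewrite mxE /homot big1 ?addr0 // => i _; rewrite mxE mul0r.
  move/le_trans; apply; rewrite ler_wpM2l ?mulr_ge0 // lef_pV2 ?posrE ?exprn_gt0 //.
  by rewrite ler_eXn2l ?ltr1n.
- by move=> b; apply/smooth_onP.
- by move=> x i b xr; case: (Ds x i b xr).
Qed.

End linear_frobenius.

(** * Curvature of a connection in coordinates *)

Section connection.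
Context (R : realType) (m : nat).
Implicit Types (U : set 'rV[R]_m) (G : christoffel R m).

(** The d/dx_l-component of R(d/dx_i, d/dx_j) d/dx_k. *)
Definition curv_coef G (x : 'rV[R]_m) (i j k l : 'I_m) : R :=
  partial i (fun y => G y j k l) x - partial j (fun y => G y i k l) x +
  \sum_p (G x j k p * G x i p l - G x i k p * G x j p l).

Lemma curv_coefC G x i j k l : curv_coef G x i j k l = - curv_coef G x j i k l.
Proof.
rewrite /curv_coef opprD opprB -sumrN; congr (_ + _).
by apply: eq_bigr => p _; rewrite opprB.
Qed.

(** For symmetric [G] the derivative part [p] and the quadratic part [q] are symmetric in their last
    two indices, so the cyclic sum cancels in pairs. *)
Lemma curv_coef_bianchi U G x i j k l : open U -> U x ->
  (forall y a b c, U y -> G y a b c = G y b a c) ->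
  curv_coef G x i j k l + curv_coef G x j k i l + curv_coef G x k i j l = 0.
Proof.
move=> oU Ux symG.
pose p a b c := partial a (fun y => G y b c l) x.
pose q a b c := \sum_e G x b c e * G x a e l.
have cE a b c : curv_coef G x a b c l = p a b c - p b a c + (q a b c - q b a c).
  by rewrite /curv_coef sumrB.
rewrite !cE.
have ps a b c : p a b c = p a c b.
  by apply: (eq_partial _ oU Ux) => y; rewrite inE => Uy; exact: symG.
have qs a b c : q a b c = q a c b.
  by apply: eq_bigr => e _; rewrite (symG x b c e Ux).
move: p q ps qs {cE} => p q ps qs.
rewrite (ps i j k) (ps j i k) (ps k i j) (qs i j k) (qs j i k) (qs k i j).
ring.
Qed.

Lemma smooth_onW U f k : smooth_on U f -> Ck k U f.
Proof. by move=> sf; exact: (iffLR (smooth_onP _ _) sf). Qed.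

Lemma smooth_derivable U f x i : smooth_on U f -> U x ->
  derivable f x 'e_i.
Proof. by move=> sf Ux; apply: (CkS_derivable (k := 0)) Ux; apply: smooth_onW. Qed.

Lemma smooth_partial U f i : smooth_on U f -> smooth_on U (partial i f).
Proof.
by move=> sf; apply/smooth_onP => k; apply: CkS_partial; apply: smooth_onW.
Qed.

Lemma smooth_cst U (c : R) : smooth_on U (fun=> c).
Proof. by apply/smooth_onP => k; apply: Ck_cst. Qed.

Lemma smooth_cst_map U k (v : 'rV[R]_k) : smooth_map U (cst v).
Proof. by move=> j; apply: smooth_cst. Qed.

Lemma smoothM U f g : open U -> smooth_on U f -> smooth_on U g ->
  smooth_on U (fun y => f y * g y).
Proof. by move=> oU sf sg; apply/smooth_onP => k; apply: CkM => //; apply: smooth_onW. Qed.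

Lemma smoothD U f g : open U -> smooth_on U f -> smooth_on U g ->
  smooth_on U (fun y => f y + g y).
Proof. by move=> oU sf sg; apply/smooth_onP => k; apply: CkD => //; apply: smooth_onW. Qed.

Lemma smoothB U f g : open U -> smooth_on U f -> smooth_on U g ->
  smooth_on U (fun y => f y - g y).
Proof. by move=> oU sf sg; apply/smooth_onP => k; apply: CkB => //; apply: smooth_onW. Qed.

Lemma smooth_sum U (I : Type) (r : seq I) (F : I -> 'rV[R]_m -> R) : open U ->
  (forall i, smooth_on U (F i)) -> smooth_on U (fun y => \sum_(i <- r) F i y).
Proof. by move=> oU sf; apply/smooth_onP => k; apply: Ck_sum => // i; apply: smooth_onW. Qed.

Lemma smooth_coord U j : smooth_on U (fun y => y 0 j).
Proof. by apply/smooth_onP => k; apply: Ck_coord. Qed.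

Lemma smooth_sub U V f : V `<=` U -> smooth_on U f -> smooth_on V f.
Proof. by move=> VU sf; apply/smooth_onP => k; apply: Ck_sub VU _; apply: smooth_onW. Qed.

Lemma partial_bigsum U (I : Type) (r : seq I) (F : I -> 'rV[R]_m -> R) i x :
  U x -> (forall j, smooth_on U (F j)) ->
  partial i (fun y => \sum_(j <- r) F j y) x = \sum_(j <- r) partial i (F j) x.
Proof.
move=> Ux sF.
have dF j : derivable (F j) x 'e_i by exact: smooth_derivable (sF j) Ux.
by case: (partial_sum r dF).
Qed.

Lemma covdE G X Y x k : covd G X Y x 0 k =
  \sum_i X x 0 i * partial i (fun y => Y y 0 k) x +
  \sum_i \sum_j G x i j k * X x 0 i * Y x 0 j.
Proof.
rewrite /covd !mxE summxE; congr (_ + _).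
by apply: eq_bigr => i _; rewrite !mxE.
Qed.

Lemma bracketE (X Y : 'rV[R]_m -> 'rV[R]_m) x k : bracket X Y x 0 k =
  \sum_i (X x 0 i * partial i (fun y => Y y 0 k) x -
          Y x 0 i * partial i (fun y => X y 0 k) x).
Proof.
by rewrite /bracket summxE; apply: eq_bigr => i _; rewrite !mxE.
Qed.

Lemma partial_covd U G X Y x i l : open U -> U x ->
  (forall i j k, smooth_on U (fun y => G y i j k)) ->
  smooth_map U X -> smooth_map U Y ->
  partial i (fun y => covd G X Y y 0 l) x =
  \sum_j (partial i (fun y => X y 0 j) x * partial j (fun y => Y y 0 l) x +
          X x 0 j * partial i (partial j (fun y => Y y 0 l)) x) +
  \sum_j \sum_k (partial i (fun y => G y j k l) x * X x 0 j * Y x 0 k +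
     G x j k l * partial i (fun y => X y 0 j) x * Y x 0 k +
     G x j k l * X x 0 j * partial i (fun y => Y y 0 k) x).
Proof.
move=> oU Ux sG sX sY.
have E : (fun y => covd G X Y y 0 l) = (fun y =>
  \sum_i X y 0 i * partial i (fun y => Y y 0 l) y +
  \sum_i \sum_j G y i j l * X y 0 i * Y y 0 j).
  by apply/funext => y; rewrite covdE.
have s0 j : smooth_on U (partial j (fun y => Y y 0 l)) by exact: smooth_partial.
have s1 j : smooth_on U (fun y => X y 0 j * partial j (fun y => Y y 0 l) y).
  exact: smoothM oU (sX j) (s0 j).
have s2' j k : smooth_on U (fun y => G y j k l * X y 0 j).
  exact: smoothM oU (sG j k l) (sX j).
have s2 j k : smooth_on U (fun y => G y j k l * X y 0 j * Y y 0 k).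
  exact: smoothM oU (s2' j k) (sY k).
have s3 j : smooth_on U (fun y => \sum_k G y j k l * X y 0 j * Y y 0 k).
  exact: smooth_sum oU (s2 j).
have s4 : smooth_on U (fun y => \sum_j X y 0 j * partial j (fun y => Y y 0 l) y).
  exact: smooth_sum oU s1.
have s5 : smooth_on U (fun y => \sum_j \sum_k G y j k l * X y 0 j * Y y 0 k).
  exact: smooth_sum oU s3.
rewrite E (partialD (smooth_derivable s4 Ux) (smooth_derivable s5 Ux)).
rewrite (partial_bigsum _ _ Ux s1) (partial_bigsum _ _ Ux s3); congr (_ + _).
  apply: eq_bigr => j _.
  rewrite (partialM (smooth_derivable (sX j) Ux) (smooth_derivable (s0 j) Ux)).
  by rewrite addrC [in X in X + _]mulrC.
apply: eq_bigr => j _; rewrite (partial_bigsum _ _ Ux (s2 j)).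
apply: eq_bigr => k _.
rewrite (partialM (smooth_derivable (s2' j k) Ux) (smooth_derivable (sY k) Ux)).
rewrite (partialM (smooth_derivable (sG j k l) Ux) (smooth_derivable (sX j) Ux)).
move: (partial _ _ _) (partial _ _ _) (partial _ _ _) (G _ _ _ _) (X _ _ _) (Y _ _ _).
by move=> p q s t u v; ring.
Qed.

(** Tensoriality of the curvature, with the values and derivatives at one point as independent
    unknowns: [dX i j] is the derivative of the j-th component in direction i, while [ddZ] and [dG]
    refer to the l-component only. The one relation among them is the symmetry of [ddZ]. *)
Lemma curvature_algebra (X Y Z : 'I_m -> R) (dX dY dZ : 'I_m -> 'I_m -> R)
    (ddZ : 'I_m -> 'I_m -> R) (G : 'I_m -> 'I_m -> 'I_m -> R)
    (dG : 'I_m -> 'I_m -> 'I_m -> R) (l : 'I_m) :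
  (forall i j, ddZ i j = ddZ j i) ->
  let A X Y dY := \sum_i X i * (\sum_j (dY i j * dZ j l + Y j * ddZ i j) +
      \sum_j \sum_k (dG i j k * Y j * Z k + G j k l * dY i j * Z k +
                     G j k l * Y j * dZ i k)) +
    \sum_i \sum_p G i p l * X i *
      (\sum_j Y j * dZ j p + \sum_j \sum_k G j k p * Y j * Z k) in
  let B j := \sum_i (X i * dY i j - Y i * dX i j) in
  A X Y dY - A Y X dX - (\sum_j B j * dZ j l + \sum_j \sum_k G j k l * B j * Z k) =
  \sum_i \sum_j \sum_k X i * Y j * Z k *
    (dG i j k - dG j i k + \sum_p (G j k p * G i p l - G i k p * G j p l)).
Proof.
move=> sym A B.
(* [P X dY] is the derivative of Y along X. All derivatives of X and Y enter [A] through such terms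
   and are removed by the bracket, which leaves the antisymmetric part of [Q]. *)
pose P (X : 'I_m -> R) (dY : 'I_m -> 'I_m -> R) j := \sum_i X i * dY i j.
pose Q i j := ddZ i j + \sum_k (dG i j k * Z k + G j k l * dZ i k) +
  \sum_p G i p l * (dZ j p + \sum_k G j k p * Z k).
have AE X' Y' dY' : A X' Y' dY' = \sum_j P X' dY' j * (dZ j l + \sum_k G j k l * Z k)
    + \sum_i \sum_j X' i * Y' j * Q i j.
  have -> : \sum_j P X' dY' j * (dZ j l + \sum_k G j k l * Z k) =
     \sum_i \sum_j X' i * dY' i j * (dZ j l + \sum_k G j k l * Z k).
    by rewrite exchange_big; apply: eq_bigr => j _; rewrite mulr_suml.
  rewrite -!big_split /A -big_split /=; apply: eq_bigr => i _.
  have -> : \sum_p G i p l * X' i *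
      (\sum_j Y' j * dZ j p + \sum_j \sum_k G j k p * Y' j * Z k) =
    \sum_j X' i * (Y' j * \sum_p G i p l * (dZ j p + \sum_k G j k p * Z k)).
    under eq_bigr => p _.
      rewrite -big_split /= mulr_sumr; over.
    rewrite exchange_big; apply: eq_bigr => j _ /=.
    rewrite !mulr_sumr; apply: eq_bigr => p _.
    rewrite !mulrDr !mulr_sumr; congr (_ + _); first by ring.
    by apply: eq_bigr => k _; ring.
  rewrite -big_split mulr_sumr -!big_split /=; apply: eq_bigr => j _.
  have -> : \sum_k (dG i j k * Y' j * Z k + G j k l * dY' i j * Z k +
      G j k l * Y' j * dZ i k) =
    dY' i j * (\sum_k G j k l * Z k) + Y' j * \sum_k (dG i j k * Z k + G j k l * dZ i k).
    by rewrite !mulr_sumr -big_split /=; apply: eq_bigr => k _; ring.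
  rewrite /Q; move: (\sum_k _) (\sum_k _) (\sum_p _) => s1 s2 s3; ring.
rewrite !AE.
have -> : \sum_j B j * dZ j l + \sum_j \sum_k G j k l * B j * Z k =
  \sum_j P X dY j * (dZ j l + \sum_k G j k l * Z k) -
  \sum_j P Y dX j * (dZ j l + \sum_k G j k l * Z k).
  rewrite -big_split -sumrB /=; apply: eq_bigr => j _.
  have -> : B j = P X dY j - P Y dX j by rewrite /B sumrB.
  rewrite -mulrBl mulrDr; congr (_ + _); rewrite mulr_sumr.
  by apply: eq_bigr => k _; ring.
have -> : \sum_i \sum_j Y i * X j * Q i j = \sum_i \sum_j X i * Y j * Q j i.
  by rewrite exchange_big; apply: eq_bigr => i _; apply: eq_bigr => j _; ring.
set a := \sum_j P X dY j * _; set b := \sum_j P Y dX j * _.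
set c := \sum_i _; set d := \sum_i _.
have -> : a + c - (b + d) - (a - b) = c - d by ring.
rewrite /c /d -sumrB; apply: eq_bigr => i _; rewrite -sumrB; apply: eq_bigr => j _.
rewrite -mulrBr.
have -> : \sum_k X i * Y j * Z k *
    (dG i j k - dG j i k + \sum_p (G j k p * G i p l - G i k p * G j p l)) =
  X i * Y j * \sum_k Z k *
    (dG i j k - dG j i k + \sum_p (G j k p * G i p l - G i k p * G j p l)).
  by rewrite mulr_sumr; apply: eq_bigr => k _; rewrite mulrA.
congr (_ * _).
have QE i' j' : Q i' j' = ddZ i' j' + (\sum_k G j' k l * dZ i' k + \sum_k G i' k l * dZ j' k)
   + \sum_k Z k * (dG i' j' k + \sum_p G j' k p * G i' p l).
  have -> : \sum_k Z k * (dG i' j' k + \sum_p G j' k p * G i' p l) =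
     \sum_k dG i' j' k * Z k + \sum_p \sum_k G i' p l * (G j' k p * Z k).
    rewrite [X in _ + X]exchange_big -big_split /=; apply: eq_bigr => k _.
    rewrite mulrDr mulr_sumr; congr (_ + _); first by ring.
    by apply: eq_bigr => p _; ring.
  rewrite /Q big_split /=.
  have -> : \sum_p G i' p l * (dZ j' p + \sum_k G j' k p * Z k) =
    \sum_p G i' p l * dZ j' p + \sum_p \sum_k G i' p l * (G j' k p * Z k).
    rewrite -big_split /=; apply: eq_bigr => p _.
    by rewrite mulrDr mulr_sumr.
  move: (\sum_k _) (\sum_k _) (\sum_k _) (\sum_k _) => s1 s2 s3 s4; ring.
rewrite !QE (sym j i) [X in _ + X + _ - _]addrC.
set u := ddZ i j + _; set v := \sum_k _; set w := \sum_k _.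
have -> : u + v - (u + w) = v - w by ring.
rewrite /v /w -sumrB; apply: eq_bigr => k _; rewrite -mulrBr sumrB.
by congr (_ * _); ring.
Qed.

Lemma curvature_tensorial U G X Y Z x l : open U -> U x ->
  (forall i j k, smooth_on U (fun y => G y i j k)) ->
  smooth_map U X -> smooth_map U Y -> smooth_map U Z ->
  curvature G X Y Z x 0 l =
  \sum_i \sum_j \sum_k X x 0 i * Y x 0 j * Z x 0 k * curv_coef G x i j k l.
Proof.
move=> oU Ux sG sX sY sZ.
have H := @curvature_algebra (fun i => X x 0 i) (fun i => Y x 0 i) (fun i => Z x 0 i)
  (fun i j => partial i (fun y => X y 0 j) x) (fun i j => partial i (fun y => Y y 0 j) x)
  (fun i j => partial i (fun y => Z y 0 j) x)
  (fun i j => partial i (partial j (fun y => Z y 0 l)) x)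
  (fun i j k => G x i j k) (fun i j k => partial i (fun y => G y j k l) x) l.
rewrite -H => {H}; last first.
  by move=> i j; apply: (schwarz _ _ oU Ux); apply: smooth_onW.
rewrite /curvature ![(_ - _ : 'rV__) 0 l]mxE ![(- _ : 'rV__) 0 l]mxE.
have AE X' Y' : smooth_map U X' -> smooth_map U Y' ->
    covd G X' (covd G Y' Z) x 0 l =
  \sum_i X' x 0 i * (\sum_j (partial i (fun y => Y' y 0 j) x * partial j (fun y => Z y 0 l) x
      + Y' x 0 j * partial i (partial j (fun y => Z y 0 l)) x) +
    \sum_j \sum_k (partial i (fun y => G y j k l) x * Y' x 0 j * Z x 0 k +
      G x j k l * partial i (fun y => Y' y 0 j) x * Z x 0 k +
      G x j k l * Y' x 0 j * partial i (fun y => Z y 0 k) x)) +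
    \sum_i \sum_p G x i p l * X' x 0 i *
      (\sum_j Y' x 0 j * partial j (fun y => Z y 0 p) x +
       \sum_j \sum_k G x j k p * Y' x 0 j * Z x 0 k).
  move=> sX' sY'; rewrite covdE; congr (_ + _).
    by apply: eq_bigr => i _; rewrite (partial_covd i l oU Ux sG sY' sZ).
  by apply: eq_bigr => i _; apply: eq_bigr => p _; rewrite covdE.
rewrite (AE _ _ sX sY) (AE _ _ sY sX) covdE; congr (_ - (_ + _)).
  by apply: eq_bigr => i _; rewrite bracketE.
by apply: eq_bigr => i _; apply: eq_bigr => j _; rewrite bracketE.
Qed.

End connection.

(** * Symmetries of the Riemann tensor *)

Section levi_civita_symmetries.
Context (R : realType) (m : nat) (U : set 'rV[R]_m) (g : 'rV[R]_m -> 'M[R]_m).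
Hypothesis oU : open U.
Hypothesis sg : forall i j, smooth_on U (fun x => g x i j).
Hypothesis symg : forall x i j, U x -> g x i j = g x j i.
Hypothesis ug : forall x, U x -> g x \in unitmx.

Local Notation L := (levi_civita g).

(** Christoffel symbols of the first kind; [d] is the lowered index. *)
Let lo x a b d : R := 2^-1 * (partial a (fun y => g y b d) x +
  partial b (fun y => g y a d) x - partial d (fun y => g y a b) x).

Lemma partial_sym_metric x i j k : U x ->
  partial k (fun y => g y i j) x = partial k (fun y => g y j i) x.
Proof.
move=> Ux; apply: (eq_partial _ oU Ux) => y; rewrite inE; exact: symg.
Qed.

Let smooth_sum_g a b d : smooth_on U (fun x => partial a (fun y => g y b d) x +
  partial b (fun y => g y a d) x - partial d (fun y => g y a b) x).
Proof.
exact: smoothB oU (smoothD oU (smooth_partial a (sg b d)) (smooth_partial b (sg a d)))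
  (smooth_partial d (sg a b)).
Qed.

Lemma smooth_levi_civita a b k : smooth_on U (fun x => L x a b k).
Proof.
have S l := smoothM oU (smooth_invmx k l oU ug sg) (smooth_sum_g a b l).
exact (@smoothM R m U (fun=> 2^-1) _ oU (smooth_cst (U := U) _)
  (smooth_sum (index_enum 'I_m) oU S)).
Qed.

Let smooth_lo a b d : smooth_on U (fun x => lo x a b d).
Proof. exact (@smoothM R m U (fun=> 2^-1) _ oU (smooth_cst (U := U) _) (smooth_sum_g a b d)). Qed.

Lemma levi_civita_sym x a b k : U x -> L x a b k = L x b a k.
Proof.
move=> Ux; rewrite /levi_civita; congr (_ * _); apply: eq_bigr => l _.
congr (_ * _); congr (_ - _); first exact: addrC.
exact: partial_sym_metric.
Qed.

Lemma levi_civita_lower x a b d : U x -> \sum_l L x a b l * g x l d = lo x a b d.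
Proof.
move=> Ux; rewrite /levi_civita /lo.
under eq_bigr => l _ do rewrite -mulrA mulr_suml.
rewrite -mulr_sumr exchange_big /=; congr (_ * _).
set T := fun e => partial a (fun y => g y b e) x + partial b (fun y => g y a e) x
   - partial e (fun y => g y a b) x.
have E e : \sum_l invmx (g x) l e * T e * g x l d = (d == e)%:R * T e.
  have := congr1 (fun A : 'M[R]_m => A d e) (mulmxV (ug Ux)); rewrite !mxE => <-.
  rewrite mulr_suml; apply: eq_bigr => l _.
  by rewrite (symg l d Ux) mulrC mulrA.
rewrite (eq_bigr _ (fun e _ => E e)) (bigD1 d) //= eqxx mul1r big1 ?addr0 //.
by move=> e /negPf; rewrite eq_sym => ->; rewrite mul0r.
Qed.

(** Compatibility of the Levi-Civita connection with the metric. *)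
Let dg x a l d : U x -> partial a (fun y => g y l d) x = lo x a l d + lo x a d l.
Proof.
move=> Ux; rewrite /lo (partial_sym_metric d l a Ux).
move: (partial _ _ _) (partial _ _ _) (partial _ _ _) => p q s; by field.
Qed.

Let sum4 (p q s t : 'I_m -> R) : \sum_l (p l - q l + (s l - t l)) =
  \sum_l p l - \sum_l q l + (\sum_l s l - \sum_l t l).
Proof. by rewrite -!sumrB -big_split. Qed.

Definition lower_curv x a b c d : R := \sum_l curv_coef L x a b c l * g x l d.

(** Differentiating [levi_civita_lower] by the Leibniz rule, the derivatives of [g] split by [dg]
    into two products, one of which cancels the quadratic part of [curv_coef]. In this form the
    inverse metric is no longer differentiated. *)
Let lower_curvE x a b c d : U x -> lower_curv x a b c d =
  partial a (fun y => lo y b c d) x - partial b (fun y => lo y a c d) x -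
  (\sum_p L x b c p * lo x a d p - \sum_p L x a c p * lo x b d p).
Proof.
move=> Ux.
have D a' b' : \sum_l partial a' (fun y => L y b' c l) x * g x l d =
    partial a' (fun y => lo y b' c d) x -
    (\sum_p L x b' c p * lo x a' p d + \sum_p L x b' c p * lo x a' d p).
  have s l : smooth_on U (fun y => L y b' c l * g y l d).
    exact: smoothM oU (smooth_levi_civita b' c l) (sg l d).
  have -> : partial a' (fun y => lo y b' c d) x =
      partial a' (fun y => \sum_l L y b' c l * g y l d) x.
    apply: (eq_partial _ oU Ux) => y; rewrite inE => Uy.
    by rewrite levi_civita_lower.
  rewrite (partial_bigsum _ _ Ux s) -big_split -sumrB /=; apply: eq_bigr => l _.
  rewrite (partialM (smooth_derivable (smooth_levi_civita b' c l) Ux)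
     (smooth_derivable (sg l d) Ux)) (dg a' l d Ux).
  by rewrite mulrDr addrAC subrr add0r mulrC.
have Q a' b' : \sum_l (\sum_p L x b' c p * L x a' p l) * g x l d =
    \sum_p L x b' c p * lo x a' p d.
  under eq_bigr => l _ do rewrite mulr_suml.
  rewrite exchange_big /=; apply: eq_bigr => p _.
  rewrite -(levi_civita_lower a' p d Ux) mulr_sumr; apply: eq_bigr => l _.
  by rewrite mulrA.
rewrite /lower_curv /curv_coef.
under eq_bigr => l _ do rewrite sumrB mulrDl !mulrBl.
have alg (p q s t u v : R) : p - (s + t) - (q - (u + v)) + (s - u) = p - q - (t - v).
  by ring.
rewrite -[RHS](alg _ _ (\sum_p L x b c p * lo x a p d) _
  (\sum_p L x a c p * lo x b p d)).
apply: etrans (sum4 _ _ _ _) _.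
congr (_ - _ + (_ - _)); [exact: D|exact: D|exact: Q|exact: Q].
Qed.

Lemma lower_curvC12 x a b c d : lower_curv x a b c d = - lower_curv x b a c d.
Proof.
rewrite /lower_curv -sumrN; apply: eq_bigr => l _; rewrite -mulNr; congr (_ * _).
exact: curv_coefC.
Qed.

(** The derivative parts add up to an antisymmetrised second derivative of a metric coefficient,
    zero by [schwarz]; the quadratic parts cancel because [Sw] exchanges the two factors. *)
Lemma lower_curvC34 x a b c d : U x -> lower_curv x a b c d = - lower_curv x a b d c.
Proof.
move=> Ux; apply/eqP; rewrite -addr_eq0; apply/eqP; rewrite !lower_curvE //.
have P a' b' : partial a' (fun y => lo y b' c d) x + partial a' (fun y => lo y b' d c) x =
    partial a' (partial b' (fun y => g y c d)) x.
  rewrite -(partialD (smooth_derivable (smooth_lo b' c d) Ux)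
    (smooth_derivable (smooth_lo b' d c) Ux)).
  by apply: (eq_partial _ oU Ux) => y; rewrite inE => Uy; rewrite (dg b' c d Uy).
have Sw a' b' c' d' : \sum_p L x b' c' p * lo x a' d' p = \sum_p L x a' d' p * lo x b' c' p.
  under eq_bigr => p _ do rewrite -(levi_civita_lower a' d' p Ux) mulr_sumr.
  rewrite exchange_big /=; apply: eq_bigr => q _.
  rewrite -(levi_civita_lower b' c' q Ux) mulr_sumr; apply: eq_bigr => p _.
  by rewrite (symg q p Ux) mulrCA.
have := P a b; have := P b a.
rewrite (schwarz a b oU Ux (smooth_onW 2 (sg c d))) => <-.
rewrite (Sw a b c d) (Sw a b d c).
move: (partial _ _ _) (partial _ _ _) (partial _ _ _) (partial _ _ _).
move: (\sum_p _) (\sum_p _) => s1 s2 p1 p2 p3 p4 H; lra.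
Qed.

Lemma lower_curv_bianchi x a b c d : U x ->
  lower_curv x a b c d + lower_curv x b c a d + lower_curv x c a b d = 0.
Proof.
move=> Ux; rewrite /lower_curv -!big_split /= big1 // => l _; rewrite -!mulrDl.
rewrite (curv_coef_bianchi a b c l oU Ux) ?mul0r // => y i j k Uy.
exact: levi_civita_sym.
Qed.

Lemma riemannE x X Y Z l : U x -> riemann g x X Y Z 0 l =
  \sum_a \sum_b \sum_c X 0 a * Y 0 b * Z 0 c * curv_coef L x a b c l.
Proof.
move=> Ux; rewrite /riemann (curvature_tensorial l oU Ux smooth_levi_civita) //;
  exact: smooth_cst_map.
Qed.

Lemma riemann4E x X Y Z W : U x -> riemann4 g x X Y Z W =
  \sum_a \sum_b \sum_c \sum_d X 0 a * Y 0 b * Z 0 c * W 0 d * lower_curv x a b c d.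
Proof.
move=> Ux; rewrite /riemann4 /pairing mxE.
under eq_bigr => d _.
  rewrite mxE mulr_suml.
  under eq_bigr => l _ do rewrite (riemannE X Y Z l Ux) !mulr_suml.
  rewrite exchange_big /=.
  under eq_bigr => a _.
    under eq_bigr => l _ do rewrite !mulr_suml.
    rewrite exchange_big /=.
    under eq_bigr => b _.
      under eq_bigr => l _ do rewrite !mulr_suml.
      rewrite exchange_big /=.
      under eq_bigr => c _.
        rewrite (_ : \sum_l _ = X 0 a * Y 0 b * Z 0 c * W 0 d * lower_curv x a b c d).
        over.
        rewrite /lower_curv mulr_sumr; apply: eq_bigr => l _; rewrite mxE.
        by move: (curv_coef _ _ _ _ _ _) => z; ring.
      over.
    over.
  over.
rewrite exchange_big /=; apply: eq_bigr => a _.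
rewrite exchange_big /=; apply: eq_bigr => b _.
by rewrite exchange_big.
Qed.

Lemma sum_rot3 (F : 'I_m -> 'I_m -> 'I_m -> R) :
  \sum_a \sum_b \sum_c F a b c = \sum_a \sum_b \sum_c F b c a.
Proof.
by rewrite [RHS]exchange_big; apply: eq_bigr => b _; rewrite exchange_big.
Qed.

Lemma riemann4C12 x X Y Z W : U x -> riemann4 g x X Y Z W = - riemann4 g x Y X Z W.
Proof.
move=> Ux; rewrite !riemann4E // [in RHS]exchange_big -sumrN; apply: eq_bigr => a _.
rewrite -sumrN; apply: eq_bigr => b _; rewrite -sumrN; apply: eq_bigr => c _.
rewrite -sumrN; apply: eq_bigr => d _; rewrite lower_curvC12 mulrN.
by congr (- (_ * _)); rewrite (mulrC (X 0 a)).
Qed.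

Lemma riemann4C34 x X Y Z W : U x -> riemann4 g x X Y Z W = - riemann4 g x X Y W Z.
Proof.
move=> Ux; rewrite !riemann4E // -sumrN; apply: eq_bigr => a _.
rewrite -sumrN; apply: eq_bigr => b _; rewrite [in RHS]exchange_big -sumrN.
apply: eq_bigr => c _; rewrite -sumrN; apply: eq_bigr => d _.
rewrite lower_curvC34 // mulrN; congr (- (_ * _)); by rewrite mulrAC.
Qed.

Lemma riemann4_bianchi x X Y Z W : U x ->
  riemann4 g x X Y Z W + riemann4 g x Y Z X W + riemann4 g x Z X Y W = 0.
Proof.
move=> Ux; rewrite !riemann4E // [X in _ + X + _]sum_rot3.
rewrite [X in _ + _ + X]sum_rot3 [X in _ + _ + X]sum_rot3.
rewrite -!big_split big1 // => a _; rewrite -!big_split big1 // => b _.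
rewrite -!big_split big1 // => c _; rewrite -!big_split big1 // => d _ /=.
have := lower_curv_bianchi a b c d Ux.
move: (lower_curv _ _ _ _ _) (lower_curv _ _ _ _ _) (lower_curv _ _ _ _ _) => p q s H.
rewrite (_ : _ + _ + _ = X 0 a * Y 0 b * Z 0 c * W 0 d * (s + q + p)); last by ring.
by rewrite H mulr0.
Qed.

(** The classical octahedron argument: four Bianchi identities combined linearly with the two skew
    symmetries. *)
Lemma riemann4_pair x X Y Z W : U x -> riemann4 g x X Y Z W = riemann4 g x Z W X Y.
Proof.
move=> Ux; have B := fun X Y Z W => @riemann4_bianchi x X Y Z W Ux.
have A12 := fun X Y Z W => @riemann4C12 x X Y Z W Ux.
have A34 := fun X Y Z W => @riemann4C34 x X Y Z W Ux.
have := B Z X Y W; have := B X Y W Z; have := B Y W Z X; have := B W Z X Y.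
have := A34 X Y W Z; have := A34 Z X W Y; have := A34 Y W X Z; have := A12 Z Y W X.
have := A34 Y Z W X; have := A12 X W Z Y; have := A34 W X Z Y; have := A34 W Z Y X.
have := A12 Z W X Y.
move: (riemann4 g x) => r; lra.
Qed.

Lemma riemann4_lin1 x (k : R) X X' Y Z W : U x ->
  riemann4 g x (k *: X + X') Y Z W = k * riemann4 g x X Y Z W + riemann4 g x X' Y Z W.
Proof.
move=> Ux; rewrite !riemann4E //; do 4!(rewrite mulr_sumr -big_split;
  apply: eq_bigr => ? _); rewrite !mxE /=; move: (lower_curv _ _ _ _ _) => r; ring.
Qed.

Lemma riemann4_lin2 x (k : R) X Y Y' Z W : U x ->
  riemann4 g x X (k *: Y + Y') Z W = k * riemann4 g x X Y Z W + riemann4 g x X Y' Z W.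
Proof.
move=> Ux; have C := fun X Y => riemann4C12 X Y Z W Ux.
have := riemann4_lin1 k Y Y' X Z W Ux; move: (riemann4 g x) C => r C H.
by rewrite (C X (k *: Y + Y')) H (C X Y) (C X Y') mulrN opprD.
Qed.

Lemma riemann4_lin3 x (k : R) X Y Z Z' W : U x ->
  riemann4 g x X Y (k *: Z + Z') W = k * riemann4 g x X Y Z W + riemann4 g x X Y Z' W.
Proof.
move=> Ux; have C := fun Z => riemann4_pair X Y Z W Ux.
have := riemann4_lin1 k Z Z' W X Y Ux; move: (riemann4 g x) C => r C H.
by rewrite (C (k *: Z + Z')) H (C Z) (C Z').
Qed.

Lemma riemann4_lin4 x (k : R) X Y Z W W' : U x ->
  riemann4 g x X Y Z (k *: W + W') = k * riemann4 g x X Y Z W + riemann4 g x X Y Z W'.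
Proof.
move=> Ux; have C := fun W => riemann4C34 X Y Z W Ux.
have := riemann4_lin3 k X Y W W' Z Ux; move: (riemann4 g x) C => r C H.
by rewrite (C (k *: W + W')) H (C W) (C W') mulrN opprD.
Qed.

End levi_civita_symmetries.

(** * Levi-Civita connection of the modified Riemannian extension *)

Lemma sum_delta (R : realType) n (F : 'I_n -> R) j : \sum_p (p == j)%:R * F p = F j.
Proof.
rewrite (bigD1 j) //= eqxx mul1r big1 ?addr0 // => p /negPf ->.
by rewrite mul0r.
Qed.

Lemma sum_deltar (R : realType) n (F : 'I_n -> R) j : \sum_p (j == p)%:R * F p = F j.
Proof. by rewrite -[RHS](sum_delta F j); apply: eq_bigr => p _; rewrite eq_sym. Qed.

(** * Functions pulled back from the base *)

Section base_functions.
Context (R : realType) (n : nat) (B : set 'rV[R]_n).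
Hypothesis oB : open B.

Local Notation lft := (@lshift n n).
Local Notation rgt := (@rshift n n).
Local Notation W := [set w : 'rV[R]_(n + n) | B (lsubmx w)].

Lemma open_lsub : open W.
Proof.
apply: open_rV => w Bw; have [r r0 rP] := open_ball_sub oB Bw.
exists r => // y yw; apply: rP; apply: le_lt_trans yw.
apply: rV_norm_le => // i.
by have := rV_coord_le (y - w) (lft i); rewrite !mxE.
Qed.

Let oW := open_lsub.

Lemma smooth_lsub f : smooth_on B f -> smooth_on W (fun w => f (lsubmx w)).
Proof.
move=> sf; apply/smooth_onP => k.
apply: (@Ck_comp _ _ _ _ _ B (fun w => lsubmx w) f) => //; last exact: smooth_onW.
move=> j; rewrite (_ : (fun _ => _) = fun w : 'rV[R]_(n + n) => w 0 (lft j)).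
  exact: Ck_coord.
by apply/funext => w; rewrite mxE.
Qed.

Let partial_lsubC w i j :
  partial i (fun y : 'rV[R]_(n + n) => (lsubmx y) 0 j) w = (lft j == i)%:R.
Proof.
rewrite (_ : (fun _ => _) = fun w : 'rV[R]_(n + n) => w 0 (lft j)).
  by rewrite partial_coord.
by apply/funext => y; rewrite mxE.
Qed.

Let partial_lsub f w i : smooth_on B f -> B (lsubmx w) ->
  partial i (fun w => f (lsubmx w)) w = \sum_j (lft j == i)%:R * partial j f (lsubmx w).
Proof.
move=> sf Bw; rewrite (@partial_comp _ _ _ B f (fun w => lsubmx w)) //.
- by apply: eq_bigr => j _; rewrite partial_lsubC.
- exact: smooth_onW.
- move=> j; rewrite (_ : (fun _ => _) = fun w : 'rV[R]_(n + n) => w 0 (lft j)).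
    by case: (is_derive_coord (lft j) w 'e_i).
  by apply/funext => y; rewrite mxE.
Qed.

Lemma partial_lsub_l f w i : smooth_on B f -> B (lsubmx w) ->
  partial (lft i) (fun w => f (lsubmx w)) w = partial i f (lsubmx w).
Proof.
move=> sf Bw; rewrite partial_lsub // -[RHS](sum_delta (fun j => partial j f (lsubmx w)) i).
by apply: eq_bigr => j _; rewrite (inj_eq (@lshift_inj n n)).
Qed.

Lemma partial_lsub_r f w i : smooth_on B f -> B (lsubmx w) ->
  partial (rgt i) (fun w => f (lsubmx w)) w = 0.
Proof.
move=> sf Bw; rewrite partial_lsub // big1 // => j _.
by rewrite eq_lrshift mul0r.
Qed.

End base_functions.

(** * Christoffel symbols and curvature coefficients of g_N *)

Section extension_metric.
Context (R : realType) (n : nat) (M : affine_manifold R n) (a : chart M).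

Local Notation U := (chart_map a @` chart_dom a).
Local Notation G := (gamma a).
Local Notation W := (cot_image a).
Local Notation Phi := (ext_block a).
Local Notation g := (ext_metric a).
Local Notation lft := (@lshift n n).
Local Notation rgt := (@rshift n n).

Let oU : open U. Proof. exact: chart_image_open. Qed.

Let sG i j k : smooth_on U (fun x => G x i j k).
Proof. exact: gamma_smooth. Qed.

(** The torsion is evaluated on two constant coordinate fields, whose bracket and derivatives
    vanish. *)
Lemma gamma_sym x i j k : U x -> G x i j k = G x j i k.
Proof.
move=> Ux; have H := @gamma_torsion_free R n M a (cst 'e_i)
  (cst 'e_j) (@smooth_cst_map R n U n 'e_i)
  (@smooth_cst_map R n U n 'e_j) x Ux.
have := congr1 (fun u : 'rV[R]_n => u 0 k) H.
rewrite /torsion ![(_ - _ : 'rV__) 0 k]mxE ![(- _ : 'rV__) 0 k]mxE !covdE bracketE.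
have Z (v : 'rV[R]_n) (c : 'I_n -> R) :
    \sum_i c i * partial i (fun y : 'rV[R]_n => (cst v : 'rV[R]_n -> 'rV[R]_n) y 0 k) x = 0.
  by rewrite big1 // => p _; rewrite /= partial_cst mulr0.
rewrite !Z !add0r [X in _ - X](_ : _ = 0); last first.
  by rewrite sumrB !Z subr0.
have D (p q : 'I_n) : \sum_i' \sum_j' G x i' j' k * (cst 'e_p : 'rV[R]_n -> 'rV[R]_n) x 0 i' *
    (cst 'e_q : 'rV[R]_n -> 'rV[R]_n) x 0 j' = G x p q k.
  rewrite -[RHS](sum_delta (fun i' => G x i' q k) p); apply: eq_bigr => i' _.
  rewrite -[in RHS](sum_delta (fun j' => G x i' j' k) q) mulr_sumr.
  by apply: eq_bigr => j' _; rewrite !mxE /=; ring.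
by rewrite !D subr0 mxE => /eqP; rewrite subr_eq0 => /eqP.
Qed.

Let oW : open W := open_lsub oU.

Lemma ext_blockE w i j : Phi w i j =
  w 0 (rgt i) * w 0 (rgt j) - 2 * \sum_k w 0 (rgt k) * G (lsubmx w) i j k.
Proof.
rewrite !mxE; congr (_ - _ * _); apply: eq_bigr => k _; by rewrite mxE.
Qed.

Lemma ext_block_sym w i j : W w -> Phi w i j = Phi w j i.
Proof.
move=> Ww; rewrite !ext_blockE mulrC; congr (_ - _ * _); apply: eq_bigr => k _.
by rewrite gamma_sym.
Qed.

Let sterm i j k : smooth_on W (fun w => w 0 (rgt k) * G (lsubmx w) i j k).
Proof. exact: smoothM oW (smooth_coord _) (smooth_lsub oU (sG i j k)). Qed.

Let ssum i j : smooth_on W (fun w => \sum_k w 0 (rgt k) * G (lsubmx w) i j k).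
Proof. exact: smooth_sum oW (sterm i j). Qed.

Lemma smooth_ext_block i j : smooth_on W (fun w => Phi w i j).
Proof.
rewrite (_ : (fun _ => _) = fun w : 'rV[R]_(n + n) =>
  w 0 (rgt i) * w 0 (rgt j) - 2 * \sum_k w 0 (rgt k) * G (lsubmx w) i j k); last first.
  by apply/funext => w; rewrite ext_blockE.
have s1 : smooth_on W (fun w : 'rV[R]_(n + n) => w 0 (rgt i) * w 0 (rgt j)).
  exact: smoothM oW (smooth_coord _) (smooth_coord _).
apply: (smoothB oW s1).
exact (@smoothM R _ W (fun=> 2) _ oW (@smooth_cst _ _ _ _) (ssum i j)).
Qed.

Lemma partial_ext_block_r w i j l : W w -> partial (rgt l) (fun w => Phi w i j) w =
  (i == l)%:R * w 0 (rgt j) + (j == l)%:R * w 0 (rgt i) - 2 * G (lsubmx w) i j l.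
Proof.
move=> Ww; rewrite (_ : (fun w => _) = fun w : 'rV[R]_(n + n) =>
  w 0 (rgt i) * w 0 (rgt j) + (-2) * \sum_k w 0 (rgt k) * G (lsubmx w) i j k); last first.
  by apply/funext => y; rewrite ext_blockE mulNr.
have s1 : smooth_on W (fun w : 'rV[R]_(n + n) => w 0 (rgt i) * w 0 (rgt j)).
  exact: smoothM oW (smooth_coord _) (smooth_coord _).
have d2 := smooth_derivable (i := rgt l) (ssum i j) Ww.
rewrite (partialD (smooth_derivable s1 Ww) (derivable_mulc d2)) (partialZ (-2) d2).
rewrite (partialM (smooth_derivable (smooth_coord (rgt i)) Ww)
  (smooth_derivable (smooth_coord (rgt j)) Ww)) !partial_coord.
rewrite (partial_bigsum _ _ Ww (sterm i j)).
have E k : partial (rgt l) (fun w => w 0 (rgt k) * G (lsubmx w) i j k) w =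
    (k == l)%:R * G (lsubmx w) i j k.
  rewrite (partialM (smooth_derivable (smooth_coord (rgt k)) Ww)
    (smooth_derivable (smooth_lsub oU (sG i j k)) Ww)) partial_coord.
  rewrite (partial_lsub_r oU _ (sG i j k) Ww) mulr0 add0r mulrC.
  by rewrite (inj_eq (@rshift_inj n n)).
rewrite (eq_bigr _ (fun k _ => E k)) sum_delta !(inj_eq (@rshift_inj n n)); ring.
Qed.

Lemma partial_ext_block_l w i j k : W w -> partial (lft k) (fun w => Phi w i j) w =
  - 2 * \sum_l w 0 (rgt l) * partial k (fun x => G x i j l) (lsubmx w).
Proof.
move=> Ww; rewrite (_ : (fun w => _) = fun w : 'rV[R]_(n + n) =>
  w 0 (rgt i) * w 0 (rgt j) + (-2) * \sum_k w 0 (rgt k) * G (lsubmx w) i j k); last first.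
  by apply/funext => y; rewrite ext_blockE mulNr.
have s1 : smooth_on W (fun w : 'rV[R]_(n + n) => w 0 (rgt i) * w 0 (rgt j)).
  exact: smoothM oW (smooth_coord _) (smooth_coord _).
have d2 := smooth_derivable (i := lft k) (ssum i j) Ww.
rewrite (partialD (smooth_derivable s1 Ww) (derivable_mulc d2)) (partialZ (-2) d2).
rewrite (partialM (smooth_derivable (smooth_coord (rgt i)) Ww)
  (smooth_derivable (smooth_coord (rgt j)) Ww)) !partial_coord !eq_rlshift !mulr0 !add0r.
rewrite (partial_bigsum _ _ Ww (sterm i j)); congr (_ * _); apply: eq_bigr => l _.
rewrite (partialM (smooth_derivable (smooth_coord (rgt l)) Ww)
    (smooth_derivable (smooth_lsub oU (sG i j l)) Ww)) partial_coord eq_rlshift mulr0 addr0.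
by rewrite (partial_lsub_l oU _ (sG i j l) Ww).
Qed.

Lemma ext_metricE_ll w i j : g w (lft i) (lft j) = Phi w i j.
Proof. by rewrite /ext_metric block_mxEul. Qed.

Lemma ext_metricE_lr w i j : g w (lft i) (rgt j) = (i == j)%:R.
Proof. by rewrite /ext_metric block_mxEur mxE. Qed.

Lemma ext_metricE_rl w i j : g w (rgt i) (lft j) = (i == j)%:R.
Proof. by rewrite /ext_metric block_mxEdl mxE. Qed.

Lemma ext_metricE_rr w i j : g w (rgt i) (rgt j) = 0.
Proof. by rewrite /ext_metric block_mxEdr mxE. Qed.

Lemma smooth_ext_metric i j : smooth_on W (fun w => g w i j).
Proof.
case: (split_ordP i) => i' ->; case: (split_ordP j) => j' ->.
- rewrite (_ : (fun _ => _) = fun w => Phi w i' j'); first exact: smooth_ext_block.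
  by apply/funext => w; rewrite ext_metricE_ll.
- rewrite (_ : (fun _ => _) = fun w => (i' == j')%:R); first exact: smooth_cst.
  by apply/funext => w; rewrite ext_metricE_lr.
- rewrite (_ : (fun _ => _) = fun w => (i' == j')%:R); first exact: smooth_cst.
  by apply/funext => w; rewrite ext_metricE_rl.
- rewrite (_ : (fun _ => _) = fun w => 0); first exact: smooth_cst.
  by apply/funext => w; rewrite ext_metricE_rr.
Qed.

Lemma ext_metric_sym w i j : W w -> g w i j = g w j i.
Proof.
move=> Ww; case: (split_ordP i) => i' ->; case: (split_ordP j) => j' ->.
- by rewrite !ext_metricE_ll ext_block_sym.
- by rewrite ext_metricE_lr ext_metricE_rl eq_sym.
- by rewrite ext_metricE_lr ext_metricE_rl eq_sym.
- by rewrite !ext_metricE_rr.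
Qed.

Lemma ext_metric_mul w : g w *m block_mx 0 1%:M 1%:M (- Phi w) = 1%:M.
Proof.
rewrite /ext_metric mulmx_block !mulmx0 !mul0mx !mulmx1 !mul1mx add0r !addr0 subrr.
by rewrite -scalar_mx_block.
Qed.

Lemma ext_metric_unit w : g w \in unitmx.
Proof. by case: (mulmx1_unit (ext_metric_mul w)). Qed.

Lemma invmx_ext_metric w : invmx (g w) = block_mx 0 1%:M 1%:M (- Phi w).
Proof.
by rewrite -[LHS]mulmx1 -(ext_metric_mul w) mulmxA mulVmx ?mul1mx // ext_metric_unit.
Qed.

Local Notation L := (levi_civita g).

(** Row [lft l] of the inverse metric picks out the index [rgt l], and metric entries with a
    vertical index are constant, so only one of the three derivatives survives. *)
Lemma levi_civita_ext w b c l : L w b c (lft l) =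
  - 2^-1 * partial (rgt l) (fun y => g y b c) w.
Proof.
have key (T : 'I_(n + n) -> R) :
    \sum_e block_mx 0 1%:M 1%:M (- Phi w) (lft l) e * T e = T (rgt l).
  rewrite big_split_ord /= big1 ?add0r => [|e _]; last by rewrite block_mxEul mxE mul0r.
  rewrite -[RHS](sum_deltar (fun e => T (rgt e)) l); apply: eq_bigr => e _.
  by rewrite block_mxEur mxE.
rewrite /levi_civita invmx_ext_metric.
apply: etrans (congr1 (fun s => 2^-1 * s) (key _)) _.
have Z d e : partial d (fun y => g y e (rgt l)) w = 0.
  case: (split_ordP e) => e' ->.
  - rewrite (_ : (fun _ => _) = fun w => (e' == l)%:R) ?partial_cst //.
    by apply/funext => y; rewrite ext_metricE_lr.
  - rewrite (_ : (fun _ => _) = fun w => 0) ?partial_cst //.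
    by apply/funext => y; rewrite ext_metricE_rr.
by rewrite !Z !add0r mulrN mulNr.
Qed.

(** The symbols of D after the projective change by -1/2 times the tautological 1-form x'; the
    change comes from the term x'_i x'_j of the metric. *)
Definition ext_gamma (w : 'rV[R]_(n + n)) i j l : R :=
  G (lsubmx w) i j l - 2^-1 * ((i == l)%:R * w 0 (rgt j) + (j == l)%:R * w 0 (rgt i)).

Lemma levi_civita_ll w i j l : W w -> L w (lft i) (lft j) (lft l) = ext_gamma w i j l.
Proof.
move=> Ww; rewrite levi_civita_ext.
rewrite (_ : (fun y => _) = fun y => Phi y i j); last first.
  by apply/funext => y; rewrite ext_metricE_ll.
rewrite partial_ext_block_r // /ext_gamma; by field.
Qed.

(** Covariant derivatives along vertical coordinate fields have no d/dx_l-component;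
    [levi_civita_0r] says the same for derivatives of such fields, that is, the vertical bundle is
    parallel. *)
Lemma levi_civita_r0 w b c l : L w (rgt b) c (lft l) = 0.
Proof.
rewrite levi_civita_ext; case: (split_ordP c) => c' ->.
- rewrite (_ : (fun _ => _) = fun w => (b == c')%:R) ?partial_cst ?mulr0 //.
  by apply/funext => y; rewrite ext_metricE_rl.
- rewrite (_ : (fun _ => _) = fun w => 0) ?partial_cst ?mulr0 //.
  by apply/funext => y; rewrite ext_metricE_rr.
Qed.

Lemma levi_civita_0r w b c l : L w b (rgt c) (lft l) = 0.
Proof.
rewrite levi_civita_ext; case: (split_ordP b) => b' ->.
- rewrite (_ : (fun _ => _) = fun w => (b' == c)%:R) ?partial_cst ?mulr0 //.
  by apply/funext => y; rewrite ext_metricE_lr.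
- rewrite (_ : (fun _ => _) = fun w => 0) ?partial_cst ?mulr0 //.
  by apply/funext => y; rewrite ext_metricE_rr.
Qed.

Let slin (i j l : 'I_n) : smooth_on W (fun w : 'rV[R]_(n + n) =>
  (i == l)%:R * w 0 (rgt j) + (j == l)%:R * w 0 (rgt i)).
Proof.
exact: smoothD oW (smoothM oW (smooth_cst (U := W) _) (smooth_coord _))
  (smoothM oW (smooth_cst (U := W) _) (smooth_coord _)).
Qed.

Lemma partial_ext_gamma w i j l A : W w ->
  partial A (fun y => L y (lft i) (lft j) (lft l)) w =
  partial A (fun y => G (lsubmx y) i j l) w -
  2^-1 * ((i == l)%:R * (rgt j == A)%:R + (j == l)%:R * (rgt i == A)%:R).
Proof.
move=> Ww; rewrite (@eq_partial _ _ W _ (fun y => G (lsubmx y) i j l + (- 2^-1) *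
    ((i == l)%:R * y 0 (rgt j) + (j == l)%:R * y 0 (rgt i)))) //; last first.
  by move=> y; rewrite inE => Wy; rewrite levi_civita_ll // /ext_gamma mulNr.
have dc k : derivable (fun y : 'rV[R]_(n + n) => y 0 (rgt k)) w 'e_A.
  exact: smooth_derivable (smooth_coord (U := W) (rgt k)) Ww.
have d1 := smooth_derivable (i := A) (smooth_lsub oU (sG i j l)) Ww.
have d2 := smooth_derivable (i := A) (slin i j l) Ww.
rewrite (partialD d1 (derivable_mulc d2)) (partialZ _ d2) mulNr.
rewrite (partialD (derivable_mulc (dc j)) (derivable_mulc (dc i))).
by rewrite (partialZ _ (dc j)) (partialZ _ (dc i)) !partial_coord.
Qed.

Let Lz w A B C l : (forall y, L y B C (lft l) = 0) ->
  partial A (fun y => L y B C (lft l)) w = 0.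
Proof.
move=> H; rewrite (_ : (fun y => _) = fun=> 0) ?partial_cst //.
by apply/funext => y.
Qed.

Lemma curv_coef_0r w A B c l : curv_coef L w A B (rgt c) (lft l) = 0.
Proof.
rewrite /curv_coef !Lz; try by move=> y; apply: levi_civita_0r.
rewrite subrr add0r big_split_ord /= !big1 ?addr0 // => p _.
  by rewrite !levi_civita_0r !mulr0 subrr.
by rewrite !levi_civita_0r !mul0r subrr.
Qed.

Lemma curv_coef_rr w i j k l : curv_coef L w (rgt i) (rgt j) k (lft l) = 0.
Proof.
rewrite /curv_coef !Lz; try by move=> y; apply: levi_civita_r0.
rewrite subrr add0r big1 // => p _; case: (split_ordP p) => p' ->.
  by rewrite !levi_civita_r0 !mulr0 subrr.
by rewrite !levi_civita_0r !mulr0 subrr.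
Qed.

(** Nonzero even for flat D: a fibre derivative of the projective term in [ext_gamma] leaves
    Kronecker symbols. *)
Lemma curv_coef_rl w i j k l : W w -> curv_coef L w (rgt i) (lft j) (lft k) (lft l) =
  - 2^-1 * ((j == l)%:R * (k == i)%:R + (k == l)%:R * (j == i)%:R).
Proof.
move=> Ww; rewrite /curv_coef partial_ext_gamma // Lz => [|y]; last exact: levi_civita_r0.
rewrite (partial_lsub_r oU _ (sG j k l) Ww) big1 => [|p _]; last first.
  case: (split_ordP p) => p' ->.
    by rewrite !levi_civita_r0 mulr0 mul0r subrr.
  by rewrite !levi_civita_0r !mulr0 subrr.
by rewrite !(inj_eq (@rshift_inj n n)); ring.
Qed.

Let gamma_mul w i j k l : W w ->
  \sum_p ext_gamma w j k p * ext_gamma w i p l =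
  \sum_p G (lsubmx w) j k p * G (lsubmx w) i p l
  - 2^-1 * (i == l)%:R * (\sum_p w 0 (rgt p) * G (lsubmx w) j k p)
  - 2^-1 * w 0 (rgt i) * G (lsubmx w) j k l
  - 2^-1 * w 0 (rgt k) * ext_gamma w i j l - 2^-1 * w 0 (rgt j) * ext_gamma w i k l.
Proof.
move=> Ww.
have E p : ext_gamma w j k p * ext_gamma w i p l =
    G (lsubmx w) j k p * G (lsubmx w) i p l +
    (- (2^-1 * (i == l)%:R)) * (w 0 (rgt p) * G (lsubmx w) j k p) +
    (p == l)%:R * (- (2^-1 * w 0 (rgt i)) * G (lsubmx w) j k p) +
    (j == p)%:R * (- (2^-1 * w 0 (rgt k)) * ext_gamma w i p l) +
    (k == p)%:R * (- (2^-1 * w 0 (rgt j)) * ext_gamma w i p l).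
  rewrite {1 2}/ext_gamma.
  have -> : ext_gamma w i p l = G (lsubmx w) i p l -
    2^-1 * ((i == l)%:R * w 0 (rgt p) + (p == l)%:R * w 0 (rgt i)) by [].
  ring.
rewrite (eq_bigr _ (fun p _ => E p)) !big_split /= -mulr_sumr.
rewrite (sum_delta (fun p => - (2^-1 * w 0 (rgt i)) * G (lsubmx w) j k p) l).
rewrite (sum_deltar (fun p => - (2^-1 * w 0 (rgt k)) * ext_gamma w i p l) j).
rewrite (sum_deltar (fun p => - (2^-1 * w 0 (rgt j)) * ext_gamma w i p l) k).
by rewrite !mulNr.
Qed.

(** The projective term is constant along base directions, so it contributes only through products,
    and these recombine into [Phi]. The remainder does not vanish here; it is cancelled in
    [lsub_riemannE]. *)
Lemma curv_coef_ll w i j k l : W w ->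
  curv_coef L w (lft i) (lft j) (lft k) (lft l) = curv_coef G (lsubmx w) i j k l +
  4^-1 * ((i == l)%:R * Phi w j k - (j == l)%:R * Phi w i k).
Proof.
move=> Ww; rewrite {1}/curv_coef !partial_ext_gamma //.
rewrite !(partial_lsub_l oU _ (sG _ _ l) Ww).
rewrite !eq_rlshift !mulr0 addr0 mulr0 !subr0.
rewrite big_split_ord /= [X in _ + (_ + X)]big1 ?addr0 => [|p _]; last first.
  by rewrite !levi_civita_0r !mulr0 subrr.
rewrite /curv_coef -[RHS]addrA; congr (_ + _).
have -> : \sum_p (L w (lft j) (lft k) (lft p) * L w (lft i) (lft p) (lft l) -
    L w (lft i) (lft k) (lft p) * L w (lft j) (lft p) (lft l)) =
  \sum_p ext_gamma w j k p * ext_gamma w i p l -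
  \sum_p ext_gamma w i k p * ext_gamma w j p l.
  by rewrite -sumrB; apply: eq_bigr => p _; rewrite !levi_civita_ll.
rewrite sumrB !gamma_mul // !ext_blockE.
rewrite /ext_gamma (gamma_sym j i l Ww).
move: (\sum_p _) (\sum_p _) (\sum_p _) (\sum_p _) => s1 s2 s3 s4.
by field.
Qed.

End extension_metric.

(** * The para-Hermitian structure *)

Section para_structure.
Context (R : realType) (n : nat) (M : affine_manifold R n) (a : chart M).
Context (w : 'rV[R]_(n + n)).
Hypothesis Ww : cot_image a w.

Local Notation U := (chart_map a @` chart_dom a).
Local Notation G := (gamma a).
Local Notation W := (cot_image a).
Local Notation Phi := (ext_block a).
Local Notation g := (ext_metric a).
Local Notation J := (para_J a w).
Local Notation lft := (@lshift n n).
Local Notation rgt := (@rshift n n).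
Local Notation r := (riemann4 (ext_metric a) w).
Local Notation "<| u , v |>" := (pairing (ext_metric a w) u v).

Let oW : open W := open_lsub (@chart_image_open R n M a).
Let sL : forall i j, smooth_on W (fun x => g x i j) := @smooth_ext_metric R n M a.
Let symL x i j : W x -> g x i j = g x j i. Proof. exact: ext_metric_sym. Qed.
Let uL x (_ : W x) : g x \in unitmx := ext_metric_unit a x.

Lemma para_J_lsub v : lsubmx (J v) = lsubmx v.
Proof.
by rewrite /para_J -{1}[v]hsubmxK mul_row_block mulmx1 mulmx0 addr0 row_mxKl.
Qed.

Lemma para_J_rsub v : rsubmx (J v) = - (lsubmx v *m Phi w) - rsubmx v.
Proof.
by rewrite /para_J -{1}[v]hsubmxK mul_row_block row_mxKr !mulmxN mulmx1.
Qed.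

Lemma rV_hsub_eq (u v : 'rV[R]_(n + n)) :
  lsubmx u = lsubmx v -> rsubmx u = rsubmx v -> u = v.
Proof. by move=> H K; rewrite -[u]hsubmxK H K hsubmxK. Qed.

Lemma para_JK v : J (J v) = v.
Proof.
apply: rV_hsub_eq; first by rewrite !para_J_lsub.
by rewrite !para_J_rsub para_J_lsub opprD !opprK addrA addNr add0r.
Qed.

Lemma para_J_lin k u v : J (k *: u + v) = k *: J u + J v.
Proof. by rewrite /para_J mulmxDl scalemxAl. Qed.

Lemma para_JD u v : J (u + v) = J u + J v.
Proof. by have := para_J_lin 1 u v; rewrite !scale1r. Qed.

Lemma para_JN u : J (- u) = - J u.
Proof. by rewrite /para_J mulNmx. Qed.

Lemma para_JB u v : J (u - v) = J u - J v.
Proof. by rewrite para_JD para_JN. Qed.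

Lemma pairingC u v : <| u, v |> = <| v, u |>.
Proof.
have sg : (g w)^T = g w by apply/matrixP => i j; rewrite mxE symL.
have E (A : 'M[R]_1) : A 0 0 = A^T 0 0 by rewrite mxE.
rewrite /pairing E.
by rewrite !trmx_mul trmxK sg mulmxA.
Qed.

Lemma pairing_lin1 k u u' v : <| k *: u + u', v |> = k * <| u, v |> + <| u', v |>.
Proof. by rewrite /pairing !mulmxDl -!scalemxAl !mxE. Qed.

Lemma pairing0l v : <| 0, v |> = 0.
Proof. by rewrite /pairing !mul0mx mxE. Qed.

Lemma pairingD1 u u' v : <| u + u', v |> = <| u, v |> + <| u', v |>.
Proof. by have := pairing_lin1 1 u u' v; rewrite scale1r mul1r. Qed.

Lemma pairingZ1 k u v : <| k *: u, v |> = k * <| u, v |>.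
Proof. by have := pairing_lin1 k u 0 v; rewrite pairing0l !addr0. Qed.

Lemma pairingN1 u v : <| - u, v |> = - <| u, v |>.
Proof. by rewrite -scaleN1r pairingZ1 mulN1r. Qed.

Lemma pairingD2 u v v' : <| u, v + v' |> = <| u, v |> + <| u, v' |>.
Proof. by rewrite pairingC pairingD1 !(pairingC u). Qed.

Lemma pairingZ2 k u v : <| u, k *: v |> = k * <| u, v |>.
Proof. by rewrite pairingC pairingZ1 (pairingC u). Qed.

Lemma pairing_vertical u v : lsubmx v = 0 ->
  <| u, v |> = \sum_l lsubmx u 0 l * rsubmx v 0 l.
Proof.
move=> v0; rewrite /pairing mxE big_split_ord /= [X in X + _]big1 => [|l _]; last first.
  have := congr1 (fun z : 'rV[R]_n => z 0 l) v0; rewrite !mxE => ->.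
  by rewrite mulr0.
rewrite add0r; apply: eq_bigr => l _; rewrite !mxE; congr (_ * _).
rewrite big_split_ord /= [X in _ + X]big1 ?addr0 => [|p _]; last first.
  by rewrite ext_metricE_rr mulr0.
rewrite -[RHS](sum_delta (fun p => u 0 (lft p)) l); apply: eq_bigr => p _.
by rewrite ext_metricE_lr mulrC.
Qed.

Lemma pairing_nondeg u v : (forall Z, <| u, Z |> = <| v, Z |>) -> u = v.
Proof.
move=> H; have E : u *m g w = v *m g w.
  apply/rowP => j; have := H 'e_j; rewrite /pairing !trmx_delta.
  by rewrite -!colE !mxE.
by rewrite -[u]mulmx1 -[v]mulmx1 -(mulmxV (uL Ww)) !mulmxA E.
Qed.

Lemma pairing_J u v : <| J u, v |> = - <| u, J v |>.
Proof.
rewrite /pairing /para_J trmx_mul tr_block_mx !mulmxA -!(mulmxA u) /ext_metric !mulmx_block.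
have -> : (- Phi w)^T = - Phi w.
  apply/matrixP => i j; rewrite mxE [LHS]mxE [RHS]mxE; congr (- _).
  exact: ext_block_sym.
rewrite !trmx0 !trmx1 !mulmx0 !mul0mx !mulmx1 !mul1mx !addr0 !add0r.
rewrite (_ : (- 1%:M)^T = - 1%:M); last by rewrite linearN /= trmx1.
rewrite subrr (_ : block_mx 0 1%:M (- 1%:M) 0 = - block_mx 0 (- 1%:M) 1%:M 0).
  by rewrite mulNmx mulmxN mxE.
by rewrite opp_block_mx !opprK oppr0.
Qed.

Definition Dcurv (x y z : 'rV[R]_n) : 'rV[R]_n :=
  \row_l \sum_i \sum_j \sum_k x 0 i * y 0 j * z 0 k * curv_coef G (lsubmx w) i j k l.

Let trisplit (X Y Z : 'I_(n + n) -> R) (T : 'I_(n + n) -> 'I_(n + n) -> 'I_(n + n) -> R) :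
  (forall A B c, T A B (rgt c) = 0) -> (forall i j k, T (rgt i) (rgt j) k = 0) ->
  \sum_A \sum_B \sum_C X A * Y B * Z C * T A B C =
  \sum_i \sum_j \sum_k X (lft i) * Y (lft j) * Z (lft k) * T (lft i) (lft j) (lft k) +
  \sum_i \sum_j \sum_k X (lft i) * Y (rgt j) * Z (lft k) * T (lft i) (rgt j) (lft k) +
  \sum_i \sum_j \sum_k X (rgt i) * Y (lft j) * Z (lft k) * T (rgt i) (lft j) (lft k).
Proof.
move=> T0 Trr.
have S A B : \sum_C X A * Y B * Z C * T A B C =
    \sum_k X A * Y B * Z (lft k) * T A B (lft k).
  by rewrite big_split_ord /= [X in _ + X]big1 ?addr0 // => k _; rewrite T0 mulr0.
under eq_bigr => A _ do under eq_bigr => B _ do rewrite S.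
rewrite [LHS]big_split_ord -[X in _ = X + _]big_split /=; congr (_ + _).
  by apply: eq_bigr => i _; rewrite big_split_ord.
apply: eq_bigr => i _; rewrite big_split_ord /= [X in _ + X]big1 ?addr0 // => j _.
by rewrite big1 // => k _; rewrite Trr mulr0.
Qed.

(** Here [x'] is the vertical part of the +1 eigenvector of J over [x]; substituting it turns the
    Kronecker symbols of [curv_coef_rl] into entries of [Phi]. *)
Let mixed (x y z x' : 'I_n -> R) l :
  (forall i, x' i = - 2^-1 * \sum_p x p * Phi w p i) ->
  \sum_i \sum_j \sum_k x' i * y j * z k *
     (- 2^-1 * ((j == l)%:R * (k == i)%:R + (k == l)%:R * (j == i)%:R)) =
  \sum_i \sum_j \sum_k x i * y j * z k *
     (4^-1 * ((j == l)%:R * Phi w i k + (k == l)%:R * Phi w i j)).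
Proof.
move=> E; rewrite [LHS]exchange_big [RHS]exchange_big; apply: eq_bigr => j _ /=.
rewrite [LHS]exchange_big [RHS]exchange_big; apply: eq_bigr => k _ /=.
have -> : \sum_i x' i * y j * z k *
     (- 2^-1 * ((j == l)%:R * (k == i)%:R + (k == l)%:R * (j == i)%:R)) =
   y j * z k * - 2^-1 * ((j == l)%:R * \sum_i (k == i)%:R * x' i +
      (k == l)%:R * \sum_i (j == i)%:R * x' i).
  rewrite mulrDr !mulr_sumr -big_split; apply: eq_bigr => i _ /=; ring.
rewrite !sum_deltar !E mulrDr !mulr_sumr -big_split; apply: eq_bigr => i _ /=.
by field.
Qed.

Lemma lsub_riemann0 X Y Z : lsubmx Z = 0 -> lsubmx (riemann g w X Y Z) = 0.
Proof.
move=> Z0; apply/rowP => l; rewrite [LHS]mxE [RHS]mxE (riemannE oW sL uL) //.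
rewrite big1 // => A _; rewrite big1 // => B _; rewrite big1 // => C _.
case: (split_ordP C) => c ->; last by rewrite curv_coef_0r mulr0.
have := congr1 (fun z : 'rV[R]_n => z 0 c) Z0; rewrite !mxE => ->.
by rewrite mulr0 mul0r.
Qed.

(** The two sums with one vertical entry contribute multiples of [Phi] by 1/4 that cancel exactly
    those of [curv_coef_ll], the vertical parts of vectors of E being prescribed by [Phi]. *)
Lemma lsub_riemannE X Y Z : J X = X -> J Y = Y -> J Z = Z ->
  lsubmx (riemann g w X Y Z) = Dcurv (lsubmx X) (lsubmx Y) (lsubmx Z).
Proof.
move=> JX JY JZ; apply/rowP => l; rewrite [LHS]mxE (riemannE oW sL uL) // trisplit;
  [|by move=> *; exact: curv_coef_0r|by move=> *; exact: curv_coef_rr].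
have E (V : 'rV[R]_(n + n)) i : J V = V ->
    V 0 (rgt i) = - 2^-1 * \sum_p V 0 (lft p) * Phi w p i.
  move=> /(congr1 (fun V => rsubmx V 0 i)); rewrite para_J_rsub.
  rewrite [LHS]mxE [(- rsubmx V) _ _]mxE [(- (_ *m _)) _ _]mxE [(_ *m _) _ _]mxE.
  rewrite [rsubmx V 0 i]mxE.
  have -> : \sum_j lsubmx V 0 j * Phi w j i = \sum_p V 0 (lft p) * Phi w p i.
    by apply: eq_bigr => p _; rewrite [lsubmx V _ _]mxE.
  move: (\sum_p _) (V 0 _) => s t H; lra.
have Srl (V1 V2 : 'rV[R]_(n + n)) : J V1 = V1 ->
    \sum_i \sum_j \sum_k V1 0 (rgt i) * V2 0 (lft j) * Z 0 (lft k) *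
      curv_coef (levi_civita g) w (rgt i) (lft j) (lft k) (lft l) =
    \sum_i \sum_j \sum_k V1 0 (lft i) * V2 0 (lft j) * Z 0 (lft k) *
     (4^-1 * ((j == l)%:R * Phi w i k + (k == l)%:R * Phi w i j)).
  move=> J1; rewrite -(@mixed (fun i => V1 0 (lft i)) (fun j => V2 0 (lft j))
     (fun k => Z 0 (lft k)) (fun i => V1 0 (rgt i)) l (fun i => E V1 i J1)).
  apply: eq_bigr => i _; apply: eq_bigr => j _; apply: eq_bigr => k _.
  by rewrite curv_coef_rl.
have Slr : \sum_i \sum_j \sum_k X 0 (lft i) * Y 0 (rgt j) * Z 0 (lft k) *
      curv_coef (levi_civita g) w (lft i) (rgt j) (lft k) (lft l) =
    \sum_i \sum_j \sum_k X 0 (lft i) * Y 0 (lft j) * Z 0 (lft k) *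
     (- 4^-1 * ((i == l)%:R * Phi w j k + (k == l)%:R * Phi w i j)).
  transitivity (- \sum_i \sum_j \sum_k Y 0 (rgt i) * X 0 (lft j) * Z 0 (lft k) *
      curv_coef (levi_civita g) w (rgt i) (lft j) (lft k) (lft l)).
    rewrite exchange_big -sumrN; apply: eq_bigr => i _ /=; rewrite -sumrN.
    apply: eq_bigr => j _; rewrite -sumrN; apply: eq_bigr => k _.
    by rewrite curv_coefC mulrN (mulrC (X 0 _)).
  rewrite (Srl Y X JY) exchange_big -sumrN; apply: eq_bigr => i _ /=; rewrite -sumrN.
  apply: eq_bigr => j _; rewrite -sumrN; apply: eq_bigr => k _.
  rewrite (ext_block_sym j i Ww); ring.
rewrite (Srl X Y JX) Slr -!big_split /Dcurv [RHS]mxE; apply: eq_bigr => i _ /=.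
rewrite -!big_split; apply: eq_bigr => j _ /=.
rewrite -!big_split; apply: eq_bigr => k _ /=.
rewrite curv_coef_ll // ![lsubmx _ _ _]mxE.
by move: (curv_coef _ _ _ _ _ _) => c; ring.
Qed.

End para_structure.

(** * Flatness and the pointwise curvature conditions *)

Section flatness.
Context (R : realType) (n : nat) (M : affine_manifold R n).

Lemma flatP : flat M <-> forall (a : chart M) x i j k l,
  (chart_map a @` chart_dom a) x -> curv_coef (gamma a) x i j k l = 0.
Proof.
have H (a : chart M) X Y Z x l := @curvature_tensorial R n _ (gamma a) X Y Z x l
  (@chart_image_open _ _ _ a).
split=> [F a x i j k l Ux | F a X Y Z sX sY sZ x Ux].
  have C (v : 'rV[R]_n) := @smooth_cst_map R n (chart_map a @` chart_dom a) n v.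
  have := F a _ _ _ (C 'e_i) (C 'e_j) (C 'e_k) x Ux.
  move=> /(congr1 (fun v : 'rV[R]_n => v 0 l)).
  rewrite (H a _ _ _ _ l Ux (@gamma_smooth _ _ _ a)
     (C _) (C _) (C _)) [RHS]mxE => <-.
  rewrite -[LHS](sum_delta (fun p => curv_coef (gamma a) x p j k l) i).
  apply: eq_bigr => p _.
  rewrite -[in LHS](sum_delta (fun q => curv_coef (gamma a) x p q k l) j) mulr_sumr.
  apply: eq_bigr => q _.
  rewrite -[in LHS](sum_delta (fun s => curv_coef (gamma a) x p q s l) k) !mulr_sumr.
  by apply: eq_bigr => s _; rewrite !mxE /= !mulrA.
apply/rowP => l; rewrite (H a _ _ _ _ l Ux
  (@gamma_smooth _ _ _ a) sX sY sZ) [RHS]mxE.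
rewrite big1 // => i _; rewrite big1 // => j _; rewrite big1 // => k _.
by rewrite F ?mulr0.
Qed.

Lemma cot_imageP (a : chart M) (z : cotangent M) : chart_dom a (foot z) ->
  cot_image a (cot_coord a z).
Proof. by move=> az; exists (foot z) => //; rewrite /cot_coord row_mxKl. Qed.

(** Supplies a point of the cotangent bundle over any given [p], with components in all charts at
    once. *)
Definition zero_covector (p : M) : cotangent M.
Proof.
apply: (@Cotangent R n M p (fun=> 0)) => // a b i _ _.
by rewrite mxE big1 // => j _; rewrite mxE mulr0.
Defined.

End flatness.

(** * Third Gray identity, commutation and flatness at one point *)

Section pointwise.
Context (R : realType) (n : nat) (M : affine_manifold R n) (a : chart M).
Context (w : 'rV[R]_(n + n)).
Hypothesis Ww : cot_image a w.

Local Notation U := (chart_map a @` chart_dom a).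
Local Notation G := (gamma a).
Local Notation W := (cot_image a).
Local Notation g := (ext_metric a).
Local Notation J := (para_J a w).
Local Notation r := (riemann4 (ext_metric a) w).
Local Notation "<| u , v |>" := (pairing (ext_metric a w) u v).

Let oW : open W := open_lsub (@chart_image_open R n M a).
Let sL : forall i j, smooth_on W (fun x => g x i j) := @smooth_ext_metric R n M a.
Let symL x i j : W x -> g x i j = g x j i. Proof. exact: ext_metric_sym. Qed.
Let uL x (_ : W x) : g x \in unitmx := ext_metric_unit a x.

Let C12 X Y Z V : r X Y Z V = - r Y X Z V.
Proof. exact (riemann4C12 oW sL uL X Y Z V Ww). Qed.
Let C34 X Y Z V : r X Y Z V = - r X Y V Z.
Proof. exact (riemann4C34 oW sL symL uL X Y Z V Ww). Qed.
Let Cp X Y Z V : r X Y Z V = r Z V X Y.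
Proof. exact (riemann4_pair oW sL symL uL X Y Z V Ww). Qed.
Let lin1 k (X X' Y Z V : 'rV[R]_(n + n)) : r (k *: X + X') Y Z V = k * r X Y Z V + r X' Y Z V.
Proof. exact (riemann4_lin1 oW sL uL k X X' Y Z V Ww). Qed.
Let lin2 k (X Y Y' Z V : 'rV[R]_(n + n)) : r X (k *: Y + Y') Z V = k * r X Y Z V + r X Y' Z V.
Proof. exact (riemann4_lin2 oW sL uL k X Y Y' Z V Ww). Qed.
Let lin3 k (X Y Z Z' V : 'rV[R]_(n + n)) : r X Y (k *: Z + Z') V = k * r X Y Z V + r X Y Z' V.
Proof. exact (riemann4_lin3 oW sL symL uL k X Y Z Z' V Ww). Qed.
Let lin4 k (X Y Z V V' : 'rV[R]_(n + n)) : r X Y Z (k *: V + V') = k * r X Y Z V + r X Y Z V'.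
Proof. exact (riemann4_lin4 oW sL symL uL k X Y Z V V' Ww). Qed.

(** The coefficients 1 and -1 stay explicit so that both vectors have the shape [k *: X + X'] of the
    linearity lemmas. *)
Lemma J_decomposition (X : 'rV[R]_(n + n)) : exists E V : 'rV[R]_(n + n),
  [/\ J E = E, lsubmx V = 0, X = 1 *: V + E & J X = (-1) *: V + E].
Proof.
exists (2^-1 *: (X + J X)), (2^-1 *: (X - J X)); split.
- have := para_J_lin a w 2^-1 (X + J X) 0; rewrite !addr0 => ->.
  by rewrite /para_J mul0mx addr0 -/(para_J a w _) para_JD para_JK addrC.
- by rewrite linearZ linearB /= para_J_lsub subrr scaler0.
- rewrite scale1r -scalerDr; apply/matrixP => i j; rewrite !mxE.
  by move: (X i j) (\sum__ _) => s t; field.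
- apply/matrixP => i j; rewrite !mxE.
  by move: (X i j) (\sum__ _) => s t; field.
Qed.

Lemma para_J_vertical V : lsubmx V = 0 -> J V = - V.
Proof.
move=> V0; apply: rV_hsub_eq; first by rewrite para_J_lsub linearN /= V0 oppr0.
by rewrite para_J_rsub V0 mul0mx oppr0 add0r linearN.
Qed.

Let r_vert X Y Z V : lsubmx V = 0 ->
  r X Y Z V = \sum_l lsubmx (riemann g w X Y Z) 0 l * rsubmx V 0 l.
Proof. exact: pairing_vertical. Qed.

(* Flatness of D kills every curvature component with an odd number of arguments
   in the -1 eigenspace of J; on the others the signs cancel. *)
Lemma flat_gray (flatG : forall i j k l, curv_coef G (lsubmx w) i j k l = 0) X Y Z V :
  r X Y Z V = r (J X) (J Y) (J Z) (J V).
Proof.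
(* The curvature operators preserve the vertical bundle, which is isotropic. *)
have A X' Y' Z' V' : lsubmx Z' = 0 -> lsubmx V' = 0 -> r X' Y' Z' V' = 0.
  move=> Z0 V0; rewrite r_vert // lsub_riemann0 // big1 // => l _.
  by rewrite mxE mul0r.
have B E1 E2 E3 V' : J E1 = E1 -> J E2 = E2 -> J E3 = E3 -> lsubmx V' = 0 ->
    r E1 E2 E3 V' = 0.
  move=> ? ? ? V0; rewrite r_vert // lsub_riemannE // big1 // => l _.
  rewrite mxE big1 ?mul0r // => i _; rewrite big1 // => j _; rewrite big1 // => k _.
  by rewrite flatG mulr0.
have [E1 [V1 [JE1 V10 -> ->]]] := J_decomposition X.
have [E2 [V2 [JE2 V20 -> ->]]] := J_decomposition Y.
have [E3 [V3 [JE3 V30 -> ->]]] := J_decomposition Z.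
have [E4 [V4 [JE4 V40 -> ->]]] := J_decomposition V.
rewrite !lin1 !lin2 !lin3 !lin4.
have o1 : r E1 E2 E3 V4 = 0 by exact: B.
have o2 : r E1 E2 V3 E4 = 0 by rewrite C34 B ?oppr0.
have o3 : r E1 V2 E3 E4 = 0 by rewrite Cp B.
have o4 : r V1 E2 E3 E4 = 0 by rewrite C12 Cp B ?oppr0.
have o5 : r E1 V2 V3 V4 = 0 by exact: A.
have o6 : r V1 E2 V3 V4 = 0 by exact: A.
have o7 : r V1 V2 E3 V4 = 0 by rewrite Cp A.
have o8 : r V1 V2 V3 E4 = 0 by rewrite Cp A.
rewrite o1 o2 o3 o4 o5 o6 o7 o8; move: (riemann4 _ _) => s; ring.
Qed.

(** Since J is skew for the metric, the Gray identity at (T, eta, eta, J Z) shows that passing J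
    through the Jacobi operator of eta gives minus that of J eta. The difference of the operators at
    xi and J xi is therefore preserved, whatever the length of xi. *)
Lemma gray_commutes (gray : forall X Y Z V, r X Y Z V = r (J X) (J Y) (J Z) (J V)) xi :
  J \o para_jacobi a w xi =1 para_jacobi a w xi \o J.
Proof.
move=> Y /=; apply: (pairing_nondeg Ww) => Z.
have key eta T : <| J (riemann g w T eta eta), Z |> =
    - <| riemann g w (J T) (J eta) (J eta), Z |>.
  rewrite (pairing_J Ww); congr (- _).
  by have := gray T eta eta (J Z); rewrite (para_JK a w Z).
have PB u v : <| u - v, Z |> = <| u, Z |> - <| v, Z |>.
  by rewrite pairingD1 pairingN1.
rewrite /para_jacobi /jacobi para_JB [LHS]PB [RHS]PB !key para_JK opprK.
by rewrite addrC.
Qed.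

(* Polarising over xi = e + v with e in the +1 and v in the -1 eigenspace of J shows
   that R^D(x, y)z is skew in y, z; the Bianchi identity then gives 3 R^D = 0. *)
Lemma commutes_flat (comm : forall P : {vspace 'rV[R]_(n + n)}, para_plane a w P ->
    forall xi, xi \in P -> <| xi, xi |> = 1 ->
    J \o para_jacobi a w xi =1 para_jacobi a w xi \o J) i j k l :
  curv_coef G (lsubmx w) i j k l = 0.
Proof.
(* For [e] in E and [v] vertical, both isotropic, the pairing 1/2 makes [e + v] a unit vector and
   the span of [e] and [v] a nondegenerate J-invariant plane. *)
have key e v Y Z : J e = e -> lsubmx v = 0 -> J Y = Y -> J Z = Z ->
    <| e, v |> = 2^-1 -> r e Z Y v + r e Y Z v = 0.
  move=> Je v0 JY JZ ev; have Jv := para_J_vertical v0.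
  have ee0 : <| e, e |> = 0.
    by have := pairing_J Ww e e; rewrite Je => H; lra.
  have vv0 : <| v, v |> = 0.
    have := pairing_J Ww v v; rewrite Jv pairingN1 (pairingC Ww v (- v)) pairingN1.
    by move=> H; lra.
  have ve : <| v, e |> = 2^-1 by rewrite (pairingC Ww).
  have qf c d c' d' : <| c *: e + d *: v, c' *: e + d' *: v |> = 2^-1 * (c * d' + d * c').
    rewrite pairingD1 !(pairingD2 Ww) !pairingZ1 !(pairingZ2 Ww) ee0 vv0 ev ve; ring.
  set P := (<[e]> + <[v]>)%VS.
  have memP x : reflect (exists c d, x = c *: e + d *: v) (x \in P).
    apply: (iffP memv_addP) => [[? /vlineP[c ->]] [? /vlineP[d ->] ->]|[c [d ->]]].
      by exists c, d.
    exists (c *: e); first by apply/vlineP; exists c.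
    by exists (d *: v) => //; apply/vlineP; exists d.
  have PP : para_plane a w P.
    split.
    - have E : (<[e]> :&: <[v]> = 0)%VS.
        apply/eqP; rewrite -subv0; apply/subvP => x; rewrite memv_cap memv0.
        move=> /andP[/vlineP[c xe] /vlineP[d xv]].
        have : <| x, v |> = 0 by rewrite xv pairingZ1 vv0 mulr0.
        rewrite {1}xe pairingZ1 ev => /eqP; rewrite mulf_eq0 invr_eq0 pnatr_eq0 orbF.
        by move=> /eqP c0; rewrite xe c0 scale0r.
      rewrite dimv_disjoint_sum // !dim_vline.
      have e0 : e != 0.
        by apply/eqP => e0; move: ev; rewrite e0 pairing0l; lra.
      have v0' : v != 0.
        by apply/eqP => v00; move: ve; rewrite v00 pairing0l; lra.
      by rewrite e0 v0'.
    - move=> x /memP[c [d ->]]; apply/memP; exists c, (- d).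
      rewrite para_J_lin Je -[X in J X]addr0 para_J_lin Jv (_ : J 0 = 0); last first.
        by rewrite /para_J mul0mx.
      by rewrite addr0 scalerN scaleNr.
    - move=> x /memP[c [d ->]] H.
      have m0 : 0 *: e + 1 *: v \in P by apply/memP; exists 0, 1.
      have m1 : 1 *: e + 0 *: v \in P by apply/memP; exists 1, 0.
      have := H _ m0; rewrite qf => H0; have := H _ m1; rewrite qf => H1.
      by rewrite (_ : c = 0) 1?(_ : d = 0) ?scale0r ?addr0 //; lra.
  have xiP : e + v \in P by apply/memP; exists 1, 1; rewrite !scale1r.
  have xi1 : <| e + v, e + v |> = 1.
    by have := qf 1 1 1 1; rewrite !scale1r => ->; field.
  (* For [Y] and [Z] fixed by J, skewness of J turns commutation into the vanishing of the operator
     between them. Subtracting the term at J xi = [e - v] keeps only the products of one [e] with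
     one [v]. *)
  have := comm P PP (e + v) xiP xi1 Y.
  move=> /(congr1 (fun u => <| u, Z |>)) /=.
  rewrite JY (pairing_J Ww) JZ /para_jacobi /jacobi para_JD Je Jv pairingD1 pairingN1.
  rewrite -/(r _ _ _ _) -/(r _ _ _ _).
  have <- : 1 *: v + e = e + v by rewrite scale1r addrC.
  have <- : (-1) *: v + e = e - v by rewrite scaleN1r addrC.
  rewrite !lin2 !lin3 => H.
  rewrite (Cp e Z Y v) (C34 e Y Z v) (C12 e Y v Z) opprK.
  have := C12 Y v e Z; have := C34 Y v e Z.
  move: (riemann4 _ _) H => s H; lra.
have lift (x : 'rV[R]_n) : exists e, J e = e /\ lsubmx e = x.
  exists (row_mx x (- 2^-1 *: (x *m ext_block a w))); rewrite row_mxKl; split=> //.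
  apply: rV_hsub_eq; first by rewrite para_J_lsub.
  rewrite para_J_rsub row_mxKl row_mxKr; apply/matrixP => p q; rewrite !mxE.
  by move: (\sum__ _) => s; field.
have Drow (x y z v : 'rV[R]_n) : (x *m v^T) 0 0 = 2^-1 ->
    \sum_q (Dcurv a w x z y + Dcurv a w x y z) 0 q * v 0 q = 0.
  move=> xv; have [e [Je le]] := lift x; have [Y [JY lY]] := lift y.
  have [Z [JZ lZ]] := lift z; pose v' : 'rV[R]_(n + n) := row_mx 0 v.
  have v0 : lsubmx v' = 0 by rewrite row_mxKl.
  have ev : <| e, v' |> = 2^-1.
    rewrite pairing_vertical // le row_mxKr -xv mxE.
    by apply: eq_bigr => q _; rewrite mxE.
  have := key e v' Y Z Je v0 JY JZ ev; rewrite !r_vert // !lsub_riemannE //.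
  rewrite le lY lZ row_mxKr -big_split /= => H0; apply: etrans H0.
  by apply: eq_bigr => q _; rewrite mxE mulrDl.
pose C i j k := curv_coef G (lsubmx w) i j k l.
have Dd p q s t : Dcurv a w 'e_p 'e_q 'e_s 0 t =
    curv_coef G (lsubmx w) p q s t.
  rewrite mxE -[RHS](sum_delta (fun p => curv_coef G (lsubmx w) p q s t) p).
  apply: eq_bigr => p' _.
  rewrite -[in RHS](sum_delta (fun q => curv_coef G (lsubmx w) p' q s t) q) mulr_sumr.
  apply: eq_bigr => q' _.
  rewrite -[in RHS](sum_delta (fun s => curv_coef G (lsubmx w) p' q' s t) s) !mulr_sumr.
  by apply: eq_bigr => s' _; rewrite !mxE /= !mulrA.
have anti p q s : C p q s = - C p s q.
  apply/eqP; rewrite -addr_eq0; apply/eqP.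
  have dd (t t' : 'I_n) : (('e_t : 'rV[R]_n) *m ('e_t' : 'rV[R]_n)^T) 0 0 = (t == t')%:R.
    by rewrite trmx_delta mul_delta_mx_cond; case: (t == t'); rewrite !mxE ?eqxx.
  have S (v : 'rV[R]_n) : (('e_p : 'rV[R]_n) *m v^T) 0 0 = 2^-1 ->
      \sum_t (curv_coef G (lsubmx w) p q s t + curv_coef G (lsubmx w) p s q t) * v 0 t = 0.
    move=> /(Drow _ 'e_s 'e_q) H0; apply: etrans H0.
    by apply: eq_bigr => t _; rewrite mxE !Dd.
  have eqs (t : 'I_n) (c : R) : \sum_t' (curv_coef G (lsubmx w) p q s t' +
      curv_coef G (lsubmx w) p s q t') * (c *: 'e_t : 'rV[R]_n) 0 t' =
      c * (curv_coef G (lsubmx w) p q s t + curv_coef G (lsubmx w) p s q t).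
    rewrite -[in RHS](sum_delta (fun t => curv_coef G (lsubmx w) p q s t +
      curv_coef G (lsubmx w) p s q t) t) mulr_sumr; apply: eq_bigr => t' _.
    have -> : (c *: 'e_t : 'rV[R]_n) 0 t' = c * (t' == t)%:R by rewrite !mxE eqxx.
    move: (curv_coef _ _ _ _ _ _) (curv_coef _ _ _ _ _ _) => s1 s2; ring.
  (* Among the covectors pairing to 1/2 with ['e_p], half of ['e_p] gives the component [p]; adding
     ['e_l] to it then gives the component [l] when [l] differs from [p]. *)
  have S1 := S (2^-1 *: 'e_p).
  rewrite eqs linearZ /= -scalemxAr mxE dd eqxx mulr1 in S1.
  have {}S1 := S1 erefl.
  have [lp|lp] := eqVneq p l; first by rewrite /C -lp; lra.
  have S2 := S (2^-1 *: 'e_p + 1 *: 'e_l).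
  have dpl : (('e_p : 'rV[R]_n) *m
      (2^-1 *: 'e_p + 1 *: 'e_l : 'rV[R]_n)^T) 0 0 = 2^-1.
    rewrite linearD !linearZ /= mulmxDr -!scalemxAr [LHS]mxE ![(_ *: (_ *m _)) _ _]mxE.
    by rewrite !dd eqxx (negPf lp) mulr1 mulr0 addr0.
  have {}S2 := S2 dpl.
  have SD (u v : 'rV[R]_n) (T : 'I_n -> R) : \sum_t T t * (u + v) 0 t =
      \sum_t T t * u 0 t + \sum_t T t * v 0 t.
    by rewrite -big_split; apply: eq_bigr => t _; rewrite mxE mulrDr.
  by move: S2; rewrite SD !eqs S1 add0r mul1r.
have alt p q s : C p q s = - C q p s by exact: curv_coefC.
have bia p q s : C p q s + C q s p + C s p q = 0.
  apply: (@curv_coef_bianchi R n U) => //; first exact: chart_image_open.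
  by move=> y p' q' s'; exact: gamma_sym.
have := bia i j k; have := anti i j k; have := alt j k i; have := anti k i j.
have := alt k i j; have := anti j k i; have := alt i j k; have := alt i k j; have := anti i k j.
rewrite -/(C i j k); move: C {anti alt bia Dd} => C; lra.
Qed.

End pointwise.

(** * Integrability implies flatness *)

Section integrability_condition.
Context (R : realType) (n : nat) (M : affine_manifold R n) (a : chart M).

Local Notation U := (chart_map a @` chart_dom a).
Local Notation G := (gamma a).
Local Notation W := (cot_image a).
Local Notation Phi := (ext_block a).
Local Notation lft := (@lshift n n).
Local Notation rgt := (@rshift n n).

(** The left side is twice the d/dx'_m-coefficient of [e_i, e_k]. Terms of degree two and three in
    the covector cancel under the exchange of [i] and [k], leaving the curvature contracted with the
    covector. *)
Lemma ext_block_commutator w i k m : W w ->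
  partial (lft k) (fun y => Phi y i m) w - partial (lft i) (fun y => Phi y k m) w +
  2^-1 * \sum_j (Phi w i j * partial (rgt j) (fun y => Phi y k m) w -
                 Phi w k j * partial (rgt j) (fun y => Phi y i m) w) =
  2 * \sum_l w 0 (rgt l) * curv_coef G (lsubmx w) i k m l.
Proof.
move=> Ww.
pose x' l := w 0 (rgt l); pose Ga i j l := G (lsubmx w) i j l.
have PG i' j' : Phi w i' j' = x' i' * x' j' - 2 * \sum_l x' l * Ga i' j' l by exact: ext_blockE.
have S i' k' : \sum_j Phi w i' j * partial (rgt j) (fun y => Phi y k' m) w =
    Phi w i' k' * x' m + Phi w i' m * x' k' -
    2 * (x' i' * (\sum_j x' j * Ga k' m j) - 2 * \sum_l x' l * \sum_j Ga k' m j * Ga i' j l).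
  have -> : \sum_l x' l * (\sum_j Ga k' m j * Ga i' j l) =
      \sum_j (\sum_l x' l * Ga i' j l) * Ga k' m j.
    under eq_bigr => l _ do rewrite mulr_sumr.
    rewrite exchange_big; apply: eq_bigr => j _; rewrite mulr_suml.
    by apply: eq_bigr => l _; rewrite mulrA mulrAC.
  have -> : x' i' * (\sum_j x' j * Ga k' m j) -
      2 * (\sum_j (\sum_l x' l * Ga i' j l) * Ga k' m j) = \sum_j Phi w i' j * Ga k' m j.
    rewrite !mulr_sumr -sumrB; apply: eq_bigr => j _; rewrite PG.
    move: (\sum_l _) => s; ring.
  rewrite -(sum_deltar (fun j => Phi w i' j * x' m) k').
  rewrite -(sum_deltar (fun j => Phi w i' j * x' k') m).
  rewrite mulr_sumr -big_split -sumrB; apply: eq_bigr => j _ /=.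
  rewrite (partial_ext_block_r k' m j Ww) -/(Ga k' m j) -/(x' m) -/(x' k').
  by move: (Phi w i' j) => s; ring.
rewrite sumrB !S !partial_ext_block_l // -/x'.
have -> : \sum_l x' l * curv_coef G (lsubmx w) i k m l =
   \sum_l x' l * partial i (fun x => G x k m l) (lsubmx w) -
   \sum_l x' l * partial k (fun x => G x i m l) (lsubmx w) +
   (\sum_l x' l * (\sum_j Ga k m j * Ga i j l) - \sum_l x' l * (\sum_j Ga i m j * Ga k j l)).
  rewrite -!sumrB -big_split; apply: eq_bigr => l _ /=.
  rewrite /curv_coef sumrB mulrDr !mulrBr; congr (_ + _).
rewrite (ext_block_sym k i Ww) !PG.
move: (\sum_l _) (\sum_l _) (\sum_l _) (\sum_l _) (\sum_l _) (\sum_l _) (\sum_l _).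
by move=> s1 s2 s3 s4 s5 s6 s7; field.
Qed.

(** The commutator argument with derivatives at one point as unknowns: [F] is [Phi], [Q] and [QQ]
    are fibre derivatives of q, [DQ] the mixed ones. The last hypothesis is the symmetry of second
    base derivatives, rewritten by means of e_i q = 0. *)
Let comm_algebra (F QQ : 'I_n -> 'I_n -> R) (Q : 'I_n -> R)
    (dL dR : 'I_n -> 'I_n -> 'I_n -> R) (DQ : 'I_n -> 'I_n -> R) i k :
  (forall j m, QQ j m = QQ m j) ->
  (forall k j, DQ k j = 2^-1 * \sum_m (dR j k m * Q m + F k m * QQ j m)) ->
  2^-1 * (\sum_j (dL k i j * Q j + F i j * DQ k j)) =
  2^-1 * (\sum_j (dL i k j * Q j + F k j * DQ i j)) ->
  \sum_m (dL k i m - dL i k m + 2^-1 * \sum_j (F i j * dR j k m - F k j * dR j i m)) * Q m = 0.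
Proof.
move=> QS DE H.
have S i' k' : \sum_j F i' j * DQ k' j = \sum_m (2^-1 * \sum_j F i' j * dR j k' m) * Q m +
    2^-1 * \sum_j \sum_m F i' j * F k' m * QQ j m.
  have -> : \sum_m (2^-1 * \sum_j F i' j * dR j k' m) * Q m =
      \sum_j \sum_m 2^-1 * (F i' j * dR j k' m * Q m).
    rewrite exchange_big; apply: eq_bigr => m _; rewrite mulr_sumr mulr_suml.
    by apply: eq_bigr => j _; rewrite !mulrA.
  rewrite mulr_sumr -big_split; apply: eq_bigr => j _ /=.
  rewrite DE !mulr_sumr -big_split; apply: eq_bigr => m _ /=; ring.
have Sy : \sum_j \sum_m F i j * F k m * QQ j m = \sum_j \sum_m F k j * F i m * QQ j m.
  rewrite exchange_big; apply: eq_bigr => j _; apply: eq_bigr => m _.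
  by rewrite (QS m j) (mulrC (F i m)).
move: H; rewrite !big_split /= !S Sy => H.
have -> : \sum_m (dL k i m - dL i k m +
     2^-1 * \sum_j (F i j * dR j k m - F k j * dR j i m)) * Q m =
   \sum_j dL k i j * Q j - \sum_j dL i k j * Q j +
   (\sum_m (2^-1 * \sum_j F i j * dR j k m) * Q m -
    \sum_m (2^-1 * \sum_j F k j * dR j i m) * Q m).
  rewrite -!sumrB -big_split; apply: eq_bigr => m _ /=; rewrite sumrB.
  move: (\sum_j _) (\sum_j _) => s t; ring.
move: (\sum_j _) (\sum_j _) (\sum_m _) (\sum_m _) (\sum_j _) H => s1 s2 s3 s4 s5; lra.
Qed.

(* The operators d/dx_i - 1/2 sum_j Phi_ij d/dx_j' annihilate q, hence so does
   their commutator, which is vertical with coefficients the curvature. *)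
Lemma transport_curvature (V : set 'rV[R]_(n + n)) (q : 'rV[R]_(n + n) -> R) w i k :
  open V -> V `<=` W -> smooth_on V q -> V w ->
  (forall y i, V y -> partial (lft i) q y = 2^-1 * \sum_j Phi y i j * partial (rgt j) q y) ->
  \sum_m (\sum_l w 0 (rgt l) * curv_coef G (lsubmx w) i k m l) * partial (rgt m) q w = 0.
Proof.
move=> oV VW sq Vw E; have Ww := VW _ Vw.
have sQ j : smooth_on V (partial (rgt j) q) := smooth_partial (rgt j) sq.
have sP i' j : smooth_on V (fun y => Phi y i' j) := smooth_sub VW (smooth_ext_block i' j).
have sPQ i' j : smooth_on V (fun y => Phi y i' j * partial (rgt j) q y).
  exact: smoothM oV (sP i' j) (sQ j).
have sS i' : smooth_on V (fun y => \sum_j Phi y i' j * partial (rgt j) q y).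
  exact: smooth_sum oV (sPQ i').
have D A i' : partial A (partial (lft i') q) w = 2^-1 * \sum_j
    (partial A (fun y => Phi y i' j) w * partial (rgt j) q w +
     Phi w i' j * partial A (partial (rgt j) q) w).
  rewrite (@eq_partial _ _ V _ (fun y => 2^-1 * \sum_j Phi y i' j * partial (rgt j) q y) A w oV Vw);
    last by move=> y; rewrite inE => Vy; exact: E.
  rewrite (partialZ 2^-1 (smooth_derivable (sS i') Vw)) (partial_bigsum _ _ Vw (sPQ i')).
  congr (_ * _); apply: eq_bigr => j _.
  rewrite (partialM (smooth_derivable (sP i' j) Vw) (smooth_derivable (sQ j) Vw)).
  by rewrite addrC; congr (_ + _); rewrite mulrC.
have sch A B := schwarz A B oV Vw (smooth_onW 2 sq).
have := @comm_algebra (fun i j => Phi w i j) (fun j m => partial (rgt j) (partial (rgt m) q) w)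
  (fun j => partial (rgt j) q w) (fun k i j => partial (lft k) (fun y => Phi y i j) w)
  (fun j k m => partial (rgt j) (fun y => Phi y k m) w)
  (fun k j => partial (lft k) (partial (rgt j) q) w) i k.
have h1 j m : partial (rgt j) (partial (rgt m) q) w = partial (rgt m) (partial (rgt j) q) w.
  exact: sch.
have h2 k' j : partial (lft k') (partial (rgt j) q) w = 2^-1 * \sum_m
    (partial (rgt j) (fun y => Phi y k' m) w * partial (rgt m) q w +
     Phi w k' m * partial (rgt j) (partial (rgt m) q) w).
  by rewrite (sch (lft k')); exact: D.
have h3 := etrans (esym (D (lft k) i)) (etrans (sch (lft k) (lft i)) (D (lft i) k)).
move=> /(_ h1 h2 h3) H.
have {}H : \sum_m (2 * \sum_l w 0 (rgt l) * curv_coef G (lsubmx w) i k m l) *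
    partial (rgt m) q w = 0.
  apply: etrans H; apply: eq_bigr => m _; congr (_ * _).
  by apply: esym; exact: ext_block_commutator.
apply: (@mulfI R 2); first by rewrite pnatr_eq0.
rewrite mulr0 -[RHS]H mulr_sumr; apply: eq_bigr => m _; exact: mulrA.
Qed.

(** Transfers the action of J between the Jacobian of a coordinate map and that of its inverse. *)
Lemma mulmx_conj m (A B C D : 'M[R]_m) : A *m B = 1%:M -> B *m C = D *m B -> C *m A = A *m D.
Proof.
move=> AB BC; rewrite -[C]mul1mx -AB -(mulmxA A B C) BC -!mulmxA (mulmx1C AB).
by rewrite mulmx1.
Qed.

Lemma row_swap_mul_l (B : 'M[R]_(n + n)) (b : 'I_n) :
  row (lft b) (block_mx 0 1%:M 1%:M 0 *m B) = row (rgt b) B.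
Proof.
rewrite -{1}[B]vsubmxK mul_block_col !mul0mx !mul1mx add0r addr0.
by apply/rowP => d; rewrite mxE col_mxEu !mxE.
Qed.

Lemma row_swap_mul_r (B : 'M[R]_(n + n)) (b : 'I_n) :
  row (rgt b) (block_mx 0 1%:M 1%:M 0 *m B) = row (lft b) B.
Proof.
rewrite -{1}[B]vsubmxK mul_block_col !mul0mx !mul1mx add0r addr0.
by apply/rowP => d; rewrite mxE col_mxEd !mxE.
Qed.

Lemma mul_swap (A : 'M[R]_(n + n)) :
  A *m block_mx 0 1%:M 1%:M 0 = row_mx (rsubmx A) (lsubmx A).
Proof. by rewrite -{1}[A]hsubmxK mul_row_block !mulmx0 !mulmx1 add0r addr0. Qed.

Lemma mul_para (w : 'rV[R]_(n + n)) (A : 'M[R]_(n + n)) :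
  block_mx 1%:M (- Phi w) 0 (- 1%:M) *m A =
  col_mx (usubmx A - Phi w *m dsubmx A) (- dsubmx A).
Proof. by rewrite -{1}[A]vsubmxK mul_block_col !mulNmx !mul1mx mul0mx add0r. Qed.

Lemma mul_para_l (w : 'rV[R]_(n + n)) (A : 'M[R]_(n + n)) (i : 'I_n) c :
  (block_mx 1%:M (- Phi w) 0 (- 1%:M) *m A : 'M[R]_(n + n)) (lft i) c =
  A (lft i) c - \sum_j Phi w i j * A (rgt j) c.
Proof.
rewrite mul_para col_mxEu !mxE.
by congr (_ - _); apply: eq_bigr => j _; rewrite [dsubmx A j c]mxE.
Qed.

Lemma mul_para_r (w : 'rV[R]_(n + n)) (A : 'M[R]_(n + n)) (i : 'I_n) c :
  (block_mx 1%:M (- Phi w) 0 (- 1%:M) *m A : 'M[R]_(n + n)) (rgt i) c = - A (rgt i) c.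
Proof. by rewrite mul_para col_mxEd !mxE. Qed.

Lemma integrable_flat_at (x0 : 'rV[R]_n) (V : set 'rV[R]_(n + n))
    (F H : 'rV[R]_(n + n) -> 'rV[R]_(n + n)) i j k l :
  V (row_mx x0 0) -> V `<=` W -> local_coordinates V F H ->
  (forall w i, V w ->
     para_J a w (partial_map (lft i) H (F w)) = partial_map (rgt i) H (F w) /\
     para_J a w (partial_map (rgt i) H (F w)) = partial_map (lft i) H (F w)) ->
  curv_coef G x0 i j k l = 0.
Proof.
move=> V0 VW [oV oFV sF sH HF] JH.
have AB w : V w -> jacm F w *m jacm H (F w) = 1%:M.
  move=> Vw; apply/matrixP => b c; rewrite mxE [RHS]mxE.
  have FVw : (F @` V) (F w) by exists w.
  have -> : (b == c)%:R = partial b (fun y => H (F y) 0 c) w.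
    rewrite (@eq_partial _ _ V _ (fun y => y 0 c) b w oV Vw) ?partial_coord ?(eq_sym c) //.
    by move=> y; rewrite inE => Vy; rewrite HF.
  rewrite (@partial_comp _ _ _ (F @` V) (fun y => H y 0 c) F w b) //.
  - by apply: eq_bigr => d _; rewrite !mxE.
  - exact: smooth_onW (sH c).
  - move=> d; exact: smooth_derivable (sF d) Vw.
(* The difference u - v of paired coordinates: J exchanges du and dv, so the differential of [q al]
   changes sign under J and vanishes on E. *)
pose q al w := F w 0 (lft al) - F w 0 (rgt al).
have sq al : smooth_on V (q al) by exact: smoothB oV (sF _) (sF _).
have dq al b w : V w -> partial b (q al) w = jacm F w b (lft al) - jacm F w b (rgt al).
  move=> Vw; have d1 := smooth_derivable (i := b) (sF (lft al)) Vw.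
  have d2 := smooth_derivable (i := b) (sF (rgt al)) Vw.
  rewrite (_ : q al = fun y => F y 0 (lft al) + (-1) * F y 0 (rgt al)); last first.
    by apply/funext => y; rewrite mulN1r.
  by rewrite (partialD d1 (derivable_mulc d2)) (partialZ (-1) d2) mulN1r ![jacm _ _ _ _]mxE.
have JA w : V w -> block_mx 1%:M (- Phi w) 0 (- 1%:M) *m jacm F w =
    jacm F w *m block_mx 0 1%:M 1%:M 0.
  move=> Vw; apply: mulmx_conj (AB w Vw) _.
  have rE c : row c (jacm H (F w)) = partial_map c H (F w).
    by apply/rowP => d; rewrite !mxE.
  apply/row_matrixP => b; rewrite row_mul rE; case: (split_ordP b) => b' ->.
  - by rewrite row_swap_mul_l rE; case: (JH w b' Vw).
  - by rewrite row_swap_mul_r rE; case: (JH w b' Vw).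
have E al y i' : V y -> partial (lft i') (q al) y =
    2^-1 * \sum_j Phi y i' j * partial (rgt j) (q al) y.
  move=> Vy; have := congr1 (fun A : 'M[R]_(n + n) => A (lft i') (lft al)) (JA y Vy).
  have := congr1 (fun A : 'M[R]_(n + n) => A (lft i') (rgt al)) (JA y Vy).
  rewrite /= !mul_para_l mul_swap row_mxEl row_mxEr [rsubmx _ _ _]mxE [lsubmx _ _ _]mxE dq //.
  have -> : \sum_j Phi y i' j * partial (rgt j) (q al) y =
      \sum_j Phi y i' j * jacm F y (rgt j) (lft al) -
      \sum_j Phi y i' j * jacm F y (rgt j) (rgt al).
    by rewrite -sumrB; apply: eq_bigr => j' _; rewrite dq // mulrBr.
  move: (\sum_j _) (\sum_j _) (jacm F y _ _) (jacm F y _ _) => s1 s2 s3 s4 e1 e2; lra.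
(* On vertical vectors dv = - du. A vertical vector killed by all the [q al] is thus killed by the
   whole Jacobian of [F], which is invertible. *)
have nd w (c : 'I_n -> R) : V w ->
    (forall al, \sum_m c m * partial (rgt m) (q al) w = 0) -> forall m, c m = 0.
  move=> Vw cq m.
  have Fr m' al : jacm F w (rgt m') (rgt al) = - jacm F w (rgt m') (lft al).
    have := congr1 (fun A : 'M[R]_(n + n) => A (rgt m') (lft al)) (JA w Vw).
    by rewrite /= mul_para_r mul_swap row_mxEl [rsubmx _ _ _]mxE.
  have cl al : \sum_m c m * jacm F w (rgt m) (lft al) = 0.
    apply: (@mulfI R 2); first by rewrite pnatr_eq0.
    rewrite mulr0 -[RHS](cq al) mulr_sumr; apply: eq_bigr => m' _.
    rewrite dq // Fr; move: (jacm F w _ _) => s; ring.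
  have uA : row_mx 0 (\row_m c m) *m jacm F w = 0 :> 'rV[R]_(n + n).
    apply/rowP => d; rewrite mxE big_split_ord /= [RHS]mxE [X in X + _]big1 ?add0r => [|p _];
      last by rewrite row_mxEl mxE mul0r.
    case: (split_ordP d) => al ->.
      rewrite -[RHS](cl al); apply: eq_bigr => p _.
      by rewrite row_mxEr mxE.
    rewrite -[RHS]oppr0 -[in RHS](cl al) -sumrN; apply: eq_bigr => p _.
    by rewrite row_mxEr mxE Fr mulrN.
  have : row_mx 0 (\row_m c m) = 0 :> 'rV[R]_(n + n).
    by rewrite -[LHS]mulmx1 -(AB w Vw) mulmxA uA mul0mx.
  by move=> /(congr1 (fun u : 'rV[R]_(n + n) => u 0 (rgt m))); rewrite row_mxEr !mxE.
have [e e0 eV] := open_ball_sub oV V0.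
(* The curvature occurs contracted with the covector and is invisible at the zero covector; this one
   lies in [V] and isolates the index [l]. *)
pose w : 'rV[R]_(n + n) := row_mx x0 ((e / 2) *: 'e_l).
have Vw : V w.
  apply: eV; rewrite /w opp_row_mx add_row_mx subrr oppr0 addr0.
  apply: rV_norm_lt => // c; case: (split_ordP c) => c' ->.
    by rewrite row_mxEl mxE normr0.
  rewrite row_mxEr !mxE eqxx /=; case: (c' == l); rewrite ?mulr1 ?mulr0 ?normr0 //.
  by rewrite gtr0_norm ?divr_gt0 // ltr_pdivrMr // mulr2n; lra.
have := nd w (fun m => \sum_l w 0 (rgt l) * curv_coef G (lsubmx w) i j m l) Vw.
move=> /(_ _ k) /=; rewrite row_mxKl => H0.
have {}H0 := H0 (fun al => _).
have : (e / 2) * curv_coef G x0 i j k l = 0.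
  rewrite -[RHS]H0 => [|al]; last first.
    have := @transport_curvature V (q al) w i j oV VW (sq al) Vw (E al).
    by rewrite row_mxKl.
  rewrite -[in LHS](sum_delta (fun l => curv_coef G x0 i j k l) l) mulr_sumr.
  apply: eq_bigr => l' _; rewrite /w row_mxEr !mxE eqxx /= mulrA; congr (_ * _).
by move=> /eqP; rewrite mulf_eq0 => /orP[|/eqP //]; lra.
Qed.

End integrability_condition.

(** * Para-complex coordinates of a flat connection *)

Lemma open_nonzero (R : realType) m (U : set 'rV[R]_m) (f : 'rV[R]_m -> R) :
  open U -> smooth_on U f -> open [set x | U x /\ f x != 0].
Proof.
move=> oU sf; apply: open_rV => x [Ux fx]; have [r r0 rP] := open_ball_sub oU Ux.
have fx0 : 0 < `|f x| by rewrite normr_gt0.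
have [e e0 eP] := iffLR (continuous_rV_realP _ _) (Ck_continuous (smooth_onW 0 sf) Ux) _ fx0.
exists (Num.min r e); first by rewrite lt_min r0.
move=> y; rewrite lt_min => /andP[yr ye]; split; first exact: rP.
by apply/eqP => fy; have := eP y ye; rewrite fy sub0r normrN ltxx.
Qed.

(** * Translation of the base point *)

Section shift.
Context (R : realType) (m : nat).

Lemma open_shift (U : set 'rV[R]_m) c : open U -> open [set x | U (x + c)].
Proof.
move=> oU; apply: open_rV => x Ux; have [r r0 rP] := open_ball_sub oU Ux.
by exists r => // y yx; apply: rP; rewrite opprD addrACA subrr addr0.
Qed.

Let partial_addc (c : 'rV[R]_m) i j x :
  derivable (fun y : 'rV[R]_m => (y + c) 0 j) x 'e_i /\
  partial i (fun y : 'rV[R]_m => (y + c) 0 j) x = (j == i)%:R.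
Proof.
have s1 := @smooth_coord R m setT j.
have s2 := @smooth_cst R m setT (c 0 j).
rewrite (_ : (fun y : 'rV[R]_m => (y + c) 0 j) = fun y => y 0 j + c 0 j); last first.
  by apply/funext => y; rewrite mxE.
have d1 := @smooth_derivable R m setT _ x i s1 I.
have d2 := @smooth_derivable R m setT _ x i s2 I.
split; first exact (@smooth_derivable R m setT _ x i (smoothD openT s1 s2) I).
rewrite (partialD d1 d2).
by rewrite partial_coord partial_cst addr0.
Qed.

Lemma smooth_shift (U : set 'rV[R]_m) f c : open U -> smooth_on U f ->
  smooth_on [set x | U (x + c)] (fun x => f (x + c)).
Proof.
move=> oU sf; apply/smooth_onP => k.
apply: (@Ck_comp _ _ _ _ _ U (fun w => w + c) f) => //; first exact: open_shift.
  move=> j; rewrite (_ : (fun _ => _) = fun y : 'rV[R]_m => y 0 j + c 0 j); last first.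
    by apply/funext => y; rewrite mxE.
  apply: CkD; [exact: open_shift|exact: Ck_coord|exact: Ck_cst].
exact: smooth_onW.
Qed.

Lemma partial_shift (U : set 'rV[R]_m) f c i x : open U -> U (x + c) -> smooth_on U f ->
  partial i (fun y => f (y + c)) x = partial i f (x + c).
Proof.
move=> oU Ux sf; rewrite (@partial_comp _ _ _ U f (fun w => w + c)) //.
- rewrite -[RHS](sum_delta (fun j => partial j f (x + c)) i).
  by apply: eq_bigr => j _; have [_ ->] := partial_addc c i j x.
- exact: smooth_onW.
- by move=> j; have [] := partial_addc c i j x.
Qed.

Lemma linear_frobenius N (U : set 'rV[R]_m) x0 (A : 'I_m -> 'rV[R]_m -> 'M[R]_N)
    (s0 : 'rV[R]_N) :
  open U -> U x0 -> (forall i a b, smooth_on U (fun x => A i x a b)) ->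
  (forall x i j a b, U x ->
     partial j (fun y => A i y a b) x - partial i (fun y => A j y a b) x =
     (A i x *m A j x - A j x *m A i x) a b) ->
  exists (r : R) s, [/\ 0 < r, [set x | `|x - x0| < r] `<=` U, s x0 = s0,
    smooth_map [set x | `|x - x0| < r] s &
    forall x i b, `|x - x0| < r -> partial i (fun y => s y 0 b) x = (s x *m A i x) 0 b].
Proof.
move=> oU Ux0 sA flatA; have [r0 r00 rU] := open_ball_sub oU Ux0.
have cU x : cball r0 x -> U (x + x0).
  by move=> xr; apply: rU; rewrite addrK.
have [||r [s [r1 rr ss sm se]]] := @linear_frobenius0 R m N r0 (fun i x => A i (x + x0)) s0 r00.
- by move=> i a b; apply: smooth_sub cU _; exact: smooth_shift (sA i a b).
- move=> x i j a b /cU Ux; rewrite -flatA //.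
  by rewrite (partial_shift _ oU Ux (sA i a b)) (partial_shift _ oU Ux (sA j a b)).
exists r, (fun x => s (x - x0)); split=> //.
- by move=> x xr; apply: rU; exact: lt_le_trans xr rr.
- by rewrite subrr.
- by move=> b; exact: smooth_shift (open_cball (r := r)) (sm b).
- move=> x i b xr.
  rewrite (@partial_shift (cball r) (fun x => s x 0 b) (- x0) i x (open_cball (r := r)) xr (sm b)).
  by rewrite se // subrK.
Qed.

End shift.

(** * Affine coordinates of a flat connection *)

Section flat_coordinates.
Context (R : realType) (n : nat) (U : set 'rV[R]_n) (G : christoffel R n).
Hypothesis oU : open U.
Hypothesis sG : forall i j k, smooth_on U (fun x => G x i j k).
Hypothesis symG : forall x i j k, U x -> G x i j k = G x j i k.
Hypothesis flatG : forall x i j k l, U x -> curv_coef G x i j k l = 0.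

(** [th] is the differential of [y], and the last clause says that it is parallel for [G]. *)
Definition affine_datum x0 (v : 'rV[R]_n) (r : R) y (th : 'rV[R]_n -> 'rV[R]_n) :=
  [/\ 0 < r, [set x | `|x - x0| < r] `<=` U, y x0 = 0 /\ th x0 = v,
    smooth_on [set x | `|x - x0| < r] y /\ smooth_map [set x | `|x - x0| < r] th &
    forall x i, `|x - x0| < r -> partial i y x = th x 0 i /\
      forall j, partial i (fun z => th z 0 j) x = \sum_k G x i j k * th x 0 k].

(* A parallel 1-form with value v at x0, together with a primitive: closedness
   comes from torsion-freeness, so both are solved for in one linear system. *)
Lemma affine_function x0 (v : 'rV[R]_n) : U x0 -> exists r y th, affine_datum x0 v r y th.
Proof.
(* The unknown is the row (y, th) of length [1 + n]: the left column of [A] encodes that th is the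
   differential of y, the lower right block that th is parallel. *)
move=> Ux0; pose A i x : 'M[R]_(1 + n) :=
  block_mx 0 0 (\col_k (k == i)%:R) (\matrix_(k, j) G x i j k).
have Aul i x p q : A i x (lshift n p) q = 0.
  by case: (split_ordP q) => q' ->; rewrite /A ?block_mxEul ?block_mxEur mxE.
have Adl i x k p : A i x (rshift 1 k) (lshift n p) = (k == i)%:R.
  by rewrite /A block_mxEdl mxE.
have Adr i x k j : A i x (rshift 1 k) (rshift 1 j) = G x i j k.
  by rewrite /A block_mxEdr mxE.
have [||r [s [r0 rU s0 ss se]]] := @linear_frobenius R n (1 + n) U x0 A (row_mx 0 v) oU Ux0.
- move=> i a b; case: (split_ordP a) => a' ->.
    rewrite (_ : (fun x => _) = fun=> 0); first exact: smooth_cst.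
    by apply/funext => x; rewrite Aul.
  case: (split_ordP b) => b' ->.
    rewrite (_ : (fun x => _) = fun=> (a' == i)%:R); first exact: smooth_cst.
    by apply/funext => x; rewrite Adl.
  rewrite (_ : (fun x => _) = fun x => G x i b' a'); first exact: sG.
  by apply/funext => x; rewrite Adr.
(* Integrability: the left column amounts to the symmetry of [G], the lower right block to its
   flatness. *)
- move=> x i j a b Ux.
  have Mc (c d : 'I_n) : (A c x *m A d x) a b = \sum_p A c x a (rshift 1 p) * A d x (rshift 1 p) b.
    rewrite mxE big_split_ord /= [X in X + _]big1 ?add0r // => p _.
    by rewrite Aul mulr0.
  rewrite [RHS]mxE [(- (_ *m _)) _ _]mxE !Mc {Mc}; case: (split_ordP a) => a' ->.
    have Z c : (fun y => A c y (lshift n a') b) = fun=> 0 by apply/funext => y; rewrite Aul.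
    by rewrite !Z !partial_cst !big1 ?subr0 // => p _; rewrite Aul mul0r.
  case: (split_ordP b) => b' ->.
    have Z c : (fun y => A c y (rshift 1 a') (lshift n b')) = fun=> (a' == c)%:R.
      by apply/funext => y; rewrite Adl.
    rewrite !Z !partial_cst subr0.
    have S c d : \sum_p A c x (rshift 1 a') (rshift 1 p) * A d x (rshift 1 p) (lshift n b') =
        G x c d a'.
      rewrite -[RHS](sum_delta (fun p => G x c p a') d); apply: eq_bigr => p _.
      by rewrite Adr Adl mulrC.
    by rewrite !S (symG i j a' Ux) subrr.
  have Z c : (fun y => A c y (rshift 1 a') (rshift 1 b')) = fun y => G y c b' a'.
    by apply/funext => y; rewrite Adr.
  have := flatG i j b' a' Ux; rewrite !Z /curv_coef sumrB.
  have S c d : \sum_p A c x (rshift 1 a') (rshift 1 p) * A d x (rshift 1 p) (rshift 1 b') =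
      \sum_p G x d b' p * G x c p a'.
    by apply: eq_bigr => p _; rewrite !Adr mulrC.
  rewrite !S; move: (partial _ _ _) (partial _ _ _) (\sum_p _) (\sum_p _) => p q u t H; lra.
exists r, (fun x => s x 0 (lshift n 0)), (fun x => rsubmx (s x)); split=> //.
- by rewrite s0 row_mxEl mxE row_mxKr.
- split; first exact: ss.
  move=> j; rewrite (_ : (fun x => _) = fun x => s x 0 (rshift 1 j)); first exact: ss.
  by apply/funext => x; rewrite mxE.
- move=> x i xr; split=> [|j].
    rewrite se // mxE big_split_ord /= [X in X + _]big1 ?add0r => [|p _]; last first.
      by rewrite Aul mulr0.
    rewrite [RHS]mxE -[RHS](sum_delta (fun p => s x 0 (rshift 1 p)) i).
    by apply: eq_bigr => p _; rewrite Adl mulrC.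
  rewrite (_ : (fun x => _) = fun x => s x 0 (rshift 1 j)); last first.
    by apply/funext => z; rewrite mxE.
  rewrite se // mxE big_split_ord /= [X in X + _]big1 ?add0r => [|p _]; last first.
    by rewrite Aul mulr0.
  by apply: eq_bigr => p _; rewrite Adr mxE mulrC.
Qed.

Lemma affine_coordinates x0 : U x0 ->
  exists (B : set 'rV[R]_n) (y : 'I_n -> 'rV[R]_n -> R) (T : 'rV[R]_n -> 'M[R]_n),
  [/\ open B, B x0, B `<=` U & [/\ forall x, B x -> T x \in unitmx,
    (forall al, smooth_on B (y al)) /\ (forall i al, smooth_on B (fun x => T x i al)),
    (forall al, y al x0 = 0) /\ T x0 = 1%:M,
    forall x i al, B x -> partial i (y al) x = T x i al &
    forall x i j al, B x ->
      partial i (fun x => T x j al) x = \sum_k G x i j k * T x k al]].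
Proof.
move=> Ux0.
pose P al (z : R * ('rV[R]_n -> R) * ('rV[R]_n -> 'rV[R]_n)) :=
  affine_datum x0 'e_al z.1.1 z.1.2 z.2.
have [f fP] : {f : _ & forall al, P al (f al)}.
  apply: choice => al; have [r [y [th H]]] := affine_function 'e_al Ux0.
  by exists (r, y, th).
pose rr al := (f al).1.1; pose yy al := (f al).1.2; pose th al := (f al).2.
have {P}fP al : affine_datum x0 'e_al (rr al) (yy al) (th al) by exact: fP.
(* As the default value of the minimum, [r0'] keeps the ball inside [U], also when [n] is 0. *)
have [r0' r0'0 r0'U] := open_ball_sub oU Ux0.
pose r : R := \big[Order.min/r0']_al rr al.
have r0 : 0 < r by apply: lt_bigmin => // al _; case: (fP al).
have rle al : r <= rr al by exact: bigmin_le_cond.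
pose B0 := [set x : 'rV[R]_n | `|x - x0| < r].
have B0sub al : B0 `<=` [set x | `|x - x0| < rr al].
  by move=> x xr; exact: lt_le_trans xr (rle al).
pose T x : 'M[R]_n := \matrix_(i, al) th al x 0 i.
have sT i al : smooth_on B0 (fun x => T x i al).
  rewrite (_ : (fun x => _) = fun x => th al x 0 i); last by apply/funext => x; rewrite mxE.
  by apply: smooth_sub (B0sub al) _; case: (fP al) => _ _ _ [_]; exact.
have oB0 : open B0 by exact: open_norm_ball.
have sdet : smooth_on B0 (fun x => \det (T x)).
  by apply/smooth_onP => k; apply: Ck_det => // i j; exact: smooth_onW.
pose B := [set x | B0 x /\ T x \in unitmx].
have BE : B = [set x | B0 x /\ \det (T x) != 0].
  by apply/funext => x; rewrite /B /= unitmxE unitfE.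
have oB : open B by rewrite BE; exact: open_nonzero.
have T0 : T x0 = 1%:M.
  by apply/matrixP => i al; case: (fP al) => _ _ [_ tx] _ _; rewrite !mxE tx mxE.
exists B, yy, T; split=> //.
- split; first by rewrite /B0 /= subrr normr0.
  by rewrite T0 unitmx1.
- move=> x [Bx _]; apply: r0'U; apply: lt_le_trans Bx _; exact: bigmin_le_id.
split.
- by move=> x [].
- split=> [al|i al]; last by apply: smooth_sub (sT i al) => x [].
  apply: (@smooth_sub _ _ [set x | `|x - x0| < rr al]) => [x [/B0sub] //|].
  by case: (fP al) => _ _ _ [].
- split=> [al|]; last exact: T0.
  by case: (fP al) => _ _ [].
- by move=> x i al [/(B0sub al) xr _]; rewrite mxE; case: (fP al) => _ _ _ _ /(_ x i xr) [].
- move=> x i j al [/(B0sub al) xr _]; case: (fP al) => _ _ _ _ /(_ x i xr) [_ /(_ j)] H.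
  rewrite (_ : (fun x => _) = fun x => th al x 0 j); last by apply/funext => z; rewrite mxE.
  by rewrite H; apply: eq_bigr => k _; rewrite mxE.
Qed.

End flat_coordinates.

(** * Construction of the para-complex coordinates *)

Section flat_para_coordinates.
Context (R : realType) (n : nat) (M : affine_manifold R n) (a : chart M).

Local Notation U := (chart_map a @` chart_dom a).
Local Notation G := (gamma a).
Local Notation W := (cot_image a).
Local Notation Phi := (ext_block a).
Local Notation lft := (@lshift n n).
Local Notation rgt := (@rshift n n).

Let oU : open U. Proof. exact: chart_image_open. Qed.

Hypothesis flatG : forall x i j k l, U x -> curv_coef G x i j k l = 0.

(* The J-eigenvector field with base component d/dx_i. *)
Definition lift_deriv (i : 'I_n) (f : 'rV[R]_(n + n) -> R) (w : 'rV[R]_(n + n)) : R :=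
  partial (lft i) f w - 2^-1 * \sum_j Phi w i j * partial (rgt j) f w.

Section derivation.
Context (V : set 'rV[R]_(n + n)) (w : 'rV[R]_(n + n)).
Hypotheses (oV : open V) (Vw : V w).

Lemma lift_derivM i f g : smooth_on V f -> smooth_on V g ->
  lift_deriv i (fun y => f y * g y) w = f w * lift_deriv i g w + g w * lift_deriv i f w.
Proof.
move=> sf sg.
have P b : partial b (fun y => f y * g y) w = f w * partial b g w + g w * partial b f w.
  exact: partialM (smooth_derivable (i := b) sf Vw) (smooth_derivable (i := b) sg Vw).
rewrite /lift_deriv P.
have -> : \sum_j Phi w i j * partial (rgt j) (fun y => f y * g y) w =
    f w * (\sum_j Phi w i j * partial (rgt j) g w) +
    g w * (\sum_j Phi w i j * partial (rgt j) f w).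
  rewrite !mulr_sumr -big_split; apply: eq_bigr => j _; rewrite P mulrDr.
  by rewrite /= !(mulrCA (Phi w i j)).
move: (partial _ _ _) (partial _ _ _) (\sum_j _) (\sum_j _) => p q s t; ring.
Qed.

Lemma lift_deriv_sum (I : Type) (r : seq I) i (F : I -> 'rV[R]_(n + n) -> R) :
  (forall j, smooth_on V (F j)) ->
  lift_deriv i (fun y => \sum_(j <- r) F j y) w = \sum_(j <- r) lift_deriv i (F j) w.
Proof.
move=> sF; rewrite /lift_deriv (partial_bigsum _ _ Vw sF) sumrB -mulr_sumr exchange_big /=.
congr (_ - _ * _); apply: eq_bigr => j _.
by rewrite (partial_bigsum _ _ Vw sF) mulr_sumr.
Qed.

Lemma lift_deriv_affine i (c d : R) f : smooth_on V f ->
  lift_deriv i (fun y => c + d * f y) w = d * lift_deriv i f w.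
Proof.
move=> sf.
have P b : partial b (fun y => c + d * f y) w = d * partial b f w.
  have df := smooth_derivable (i := b) sf Vw.
  have dc := smooth_derivable (i := b) (smooth_cst (U := V) c) Vw.
  by rewrite (partialD dc (derivable_mulc df)) (partialZ d df) partial_cst add0r.
rewrite /lift_deriv P mulrBr; congr (_ - _); rewrite !mulr_sumr.
by apply: eq_bigr => j _; rewrite P !mulrA; congr (_ * _); rewrite mulrC mulrA.
Qed.

Lemma lift_derivV i f : smooth_on V f -> f w != 0 ->
  lift_deriv i (fun y => (f y)^-1) w = - (f w) ^- 2 * lift_deriv i f w.
Proof.
move=> sf fw.
have P b : partial b (fun y => (f y)^-1) w = - (f w) ^- 2 * partial b f w.
  exact: partialV fw (smooth_derivable (i := b) sf Vw).
rewrite /lift_deriv P mulrBr; congr (_ - _); rewrite !mulr_sumr.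
by apply: eq_bigr => j _; rewrite P !mulrA; congr (_ * _); rewrite mulrC mulrA.
Qed.

End derivation.

Lemma smoothV m (V : set 'rV[R]_m) f : open V -> (forall x, V x -> f x != 0) ->
  smooth_on V f -> smooth_on V (fun x => (f x)^-1).
Proof.
by move=> oV f0 sf; apply/smooth_onP => k; apply: CkV => //; exact: smooth_onW.
Qed.

(** The columns of [T] are parallel 1-forms, so the rows of its inverse form the dual frame of
    vector fields; differentiating the relation between the two matrices shows that this frame is
    parallel too. *)
Lemma partial_frame (B : set 'rV[R]_n) (T : 'rV[R]_n -> 'M[R]_n) x i al k :
  open B -> B x -> (forall x, B x -> T x \in unitmx) ->
  (forall i al, smooth_on B (fun x => T x i al)) ->
  (forall j al, partial i (fun x => T x j al) x = \sum_k G x i j k * T x k al) ->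
  partial i (fun x => invmx (T x) al k) x = - \sum_j invmx (T x) al j * G x i j k.
Proof.
move=> oB Bx uT sT dT.
have sE b c : smooth_on B (fun x => invmx (T x) b c) by exact: smooth_invmx.
pose Ga : 'M[R]_n := \matrix_(j, k) G x i j k.
pose D : 'M[R]_n := \matrix_(al, k) partial i (fun x => invmx (T x) al k) x.
have H : D *m T x + invmx (T x) *m (Ga *m T x) = 0.
  apply/matrixP => b c; rewrite [RHS]mxE mxE ![(_ *m _) b c]mxE.
  have dp : partial i (fun y => \sum_j invmx (T y) b j * T y j c) x = 0.
    rewrite (@eq_partial _ _ B _ (fun=> (b == c)%:R) i x oB Bx) ?partial_cst //.
    move=> y; rewrite inE => By.
    by have := congr1 (fun A : 'M[R]_n => A b c) (mulVmx (uT y By)); rewrite !mxE.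
  have sp j : smooth_on B (fun y => invmx (T y) b j * T y j c).
    exact: smoothM oB (sE b j) (sT j c).
  rewrite -[RHS]dp (partial_bigsum _ _ Bx sp) -big_split; apply: eq_bigr => j _ /=.
  rewrite (partialM (smooth_derivable (sE b j) Bx) (smooth_derivable (sT j c) Bx)) dT.
  rewrite addrC [D b j]mxE [(Ga *m _) j c]mxE; congr (_ + _); last exact: mulrC.
  by congr (_ * _); apply: eq_bigr => k' _; rewrite mxE.
have : D = - (invmx (T x) *m Ga).
  apply/eqP; rewrite -addr_eq0; apply/eqP.
  by rewrite -[LHS](mulmxK (uT x Bx)) mulmxDl -!mulmxA H mul0mx.
move=> /(congr1 (fun A : 'M[R]_n => A al k)); rewrite mxE => ->.
rewrite !mxE; congr (- _); by apply: eq_bigr => j _; rewrite mxE.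
Qed.

Lemma jacm_mulr m (V : set 'rV[R]_m) (Q : 'rV[R]_m -> 'rV[R]_m) (K : 'M[R]_m) w :
  smooth_map V Q -> V w -> jacm (fun y => Q y *m K) w = jacm Q w *m K.
Proof.
move=> sQ Vw; apply/matrixP => b c; rewrite mxE.
rewrite (_ : (fun y => _) = fun y => \sum_d K d c * Q y 0 d); last first.
  by apply/funext => y; rewrite mxE; apply: eq_bigr => d _; rewrite mulrC.
have dQ d := smooth_derivable (i := b) (sQ d) Vw.
have [_ ->] := @partial_sum R m 'I_m (index_enum 'I_m) (fun d y => K d c * Q y 0 d) b w
  (fun d => derivable_mulc (dQ d)).
by rewrite [RHS]mxE; apply: eq_bigr => d _; rewrite (partialZ _ (dQ d)) mxE mulrC.
Qed.

Lemma smooth_mulr m (V : set 'rV[R]_m) (Q : 'rV[R]_m -> 'rV[R]_m) (K : 'M[R]_m) :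
  open V -> smooth_map V Q -> smooth_map V (fun y => Q y *m K).
Proof.
move=> oV sQ c; rewrite (_ : (fun y => _) = fun y => \sum_d Q y 0 d * K d c); last first.
  by apply/funext => y; rewrite mxE.
have S d : smooth_on V (fun y => Q y 0 d * K d c).
  exact (@smoothM R m V _ (fun=> K d c) oV (sQ d) (smooth_cst (U := V) _)).
exact (smooth_sum (index_enum 'I_m) oV S).
Qed.

Lemma flat_integrable_at (x0 xi0 : 'rV[R]_n) : U x0 ->
  exists V F H, [/\ V (row_mx x0 xi0), V `<=` W, local_coordinates V F H &
  forall w (i : 'I_n), V w ->
     para_J a w (partial_map (lft i) H (F w)) = partial_map (rgt i) H (F w) /\
     para_J a w (partial_map (rgt i) H (F w)) = partial_map (lft i) H (F w)].
Proof.
move=> Ux0; have symG x i j k : U x -> G x i j k = G x j i k by exact: gamma_sym.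
have [B [y [T [oB Bx0 BU [uT [sy sT] [y0 T0] dy dT]]]]] :=
  affine_coordinates oU (@gamma_smooth _ _ _ a) symG flatG Ux0.
pose E x := invmx (T x).
have sE al k : smooth_on B (fun x => E x al k) by exact: smooth_invmx.
have dE x i al k : B x -> partial i (fun x => E x al k) x = - \sum_j E x al j * G x i j k.
  move=> Bx; exact: partial_frame oB Bx uT sT (fun j be => dT x i j be Bx).
pose W0 := [set w : 'rV[R]_(n + n) | B (lsubmx w)].
have oW0 : open W0 := open_lsub oB.
pose yl al (w : 'rV[R]_(n + n)) := y al (lsubmx w).
(* [yt] and [yp] solve x'_k = sum_a y'_a dy_a/dx_k for y', by means of the dual frame [E]. *)
pose yt al k (w : 'rV[R]_(n + n)) := w 0 (rgt k) * E (lsubmx w) al k.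
pose yp al w := \sum_k yt al k w.
have syl al : smooth_on W0 (yl al) by exact (smooth_lsub oB (sy al)).
have sEl al k : smooth_on W0 (fun w => E (lsubmx w) al k) by exact (smooth_lsub oB (sE al k)).
have syt al k : smooth_on W0 (yt al k) by exact: smoothM oW0 (smooth_coord _) (sEl al k).
have syp al : smooth_on W0 (yp al) by exact: smooth_sum oW0 (syt al).
have syy al : smooth_on W0 (fun w => yl al w * yp al w) by exact: smoothM oW0 (syl al) (syp al).
pose S w := \sum_al yl al w * yp al w.
have sS : smooth_on W0 S by exact: smooth_sum oW0 syy.
pose den w := 1 + (- 2^-1) * S w.
have sden : smooth_on W0 den.
  apply: (smoothD oW0 (smooth_cst (U := W0) 1)).
  exact (@smoothM R _ W0 (fun=> - 2^-1) _ oW0 (smooth_cst (U := W0) _) sS).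
pose N := [set w | W0 w /\ den w != 0].
have oN : open N by exact: open_nonzero.
have NW0 : N `<=` W0 by move=> w [].
have sdN : smooth_on N den := smooth_sub NW0 sden.
have sdV : smooth_on N (fun w => (den w)^-1) by apply: smoothV => // w [].
pose q al w := yp al w * (den w)^-1.
have sq al : smooth_on N (q al) by exact: smoothM oN (smooth_sub NW0 (syp al)) sdV.
(* With L_i = lift_deriv i, one has L_i y'_al = - x'_i y'_al / 2 and, for
   den = 1 - (sum_al y_al y'_al) / 2, also L_i den = - x'_i den / 2; hence
   q_al = y'_al / den satisfies L_i q_al = 0, i.e. dq_al o J = - dq_al. *)
have Lyl w i al : W0 w -> lift_deriv i (yl al) w = T (lsubmx w) i al.
  move=> Ww; rewrite /lift_deriv (partial_lsub_l oB _ (sy al) Ww) dy //.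
  rewrite big1 ?mulr0 ?subr0 // => j _.
  by rewrite (partial_lsub_r oB _ (sy al) Ww) mulr0.
have dyr w i al : W0 w -> partial (rgt i) (yp al) w = E (lsubmx w) al i.
  move=> Ww; rewrite (partial_bigsum _ _ Ww (syt al)).
  rewrite -[RHS](sum_delta (fun k => E (lsubmx w) al k) i); apply: eq_bigr => k _.
  rewrite (partialM (smooth_derivable (smooth_coord (rgt k)) Ww)
    (smooth_derivable (sEl al k) Ww)) partial_coord (inj_eq (@rshift_inj n n)).
  by rewrite (partial_lsub_r oB _ (sE al k) Ww) mulr0 add0r mulrC.
have dyll w i al : W0 w -> partial (lft i) (yp al) w =
    - \sum_j E (lsubmx w) al j * \sum_k w 0 (rgt k) * G (lsubmx w) i j k.
  move=> Ww; rewrite (partial_bigsum _ _ Ww (syt al)).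
  have -> : \sum_j E (lsubmx w) al j * (\sum_k w 0 (rgt k) * G (lsubmx w) i j k) =
      \sum_k w 0 (rgt k) * \sum_j E (lsubmx w) al j * G (lsubmx w) i j k.
    under eq_bigr => j _ do rewrite mulr_sumr.
    rewrite exchange_big; apply: eq_bigr => k _; rewrite mulr_sumr.
    by apply: eq_bigr => j _; rewrite mulrCA.
  rewrite -sumrN; apply: eq_bigr => k _.
  rewrite (partialM (smooth_derivable (smooth_coord (rgt k)) Ww)
    (smooth_derivable (sEl al k) Ww)) partial_coord eq_rlshift mulr0 addr0.
  by rewrite (partial_lsub_l oB _ (sE al k) Ww) dE // mulrN.
have Lyp w i al : W0 w -> lift_deriv i (yp al) w = - 2^-1 * w 0 (rgt i) * yp al w.
  move=> Ww; rewrite /lift_deriv dyll //.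
  have -> : \sum_j Phi w i j * partial (rgt j) (yp al) w = w 0 (rgt i) * yp al w -
      2 * \sum_j E (lsubmx w) al j * \sum_k w 0 (rgt k) * G (lsubmx w) i j k.
    rewrite /yp !mulr_sumr -sumrB; apply: eq_bigr => j _; rewrite dyr // ext_blockE /yt.
    move: (\sum_k _) (E _ _ _) => s t; ring.
  by move: (\sum_j _) (yp _ _) => s t; field.
have TE w i k : W0 w -> \sum_al T (lsubmx w) i al * E (lsubmx w) al k = (i == k)%:R.
  move=> Ww; have := congr1 (fun A : 'M[R]_n => A i k) (mulmxV (uT _ Ww)).
  by rewrite !mxE.
have Typ w i : W0 w -> \sum_al T (lsubmx w) i al * yp al w = w 0 (rgt i).
  move=> Ww; rewrite -[RHS](sum_deltar (fun k => w 0 (rgt k)) i).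
  under eq_bigr => al _ do rewrite /yp mulr_sumr.
  rewrite exchange_big; apply: eq_bigr => k _; rewrite -(TE w i k Ww) mulr_suml.
  by apply: eq_bigr => al _; rewrite /yt mulrCA mulrC -mulrA mulrCA mulrA.
have LS w i : W0 w -> lift_deriv i S w = w 0 (rgt i) - 2^-1 * w 0 (rgt i) * S w.
  move=> Ww; rewrite (lift_deriv_sum Ww _ _ syy) -[X in _ = X - _](Typ w i Ww).
  rewrite /S mulr_sumr -sumrB; apply: eq_bigr => al _.
  rewrite (lift_derivM Ww _ (syl al) (syp al)) Lyl // Lyp //; ring.
have Lden w i : W0 w -> lift_deriv i den w = - 2^-1 * w 0 (rgt i) * den w.
  move=> Ww; rewrite (lift_deriv_affine Ww i 1 (- 2^-1) sS) LS // /den; ring.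
have Lq w i al : N w -> lift_deriv i (q al) w = 0.
  move=> Nw; have Ww := NW0 _ Nw; have dw : den w != 0 by case: Nw.
  rewrite (lift_derivM Nw _ (smooth_sub NW0 (syp al)) sdV) (lift_derivV Nw _ sdN dw).
  rewrite Lden // Lyp //; move: (den w) dw (yp al w) => d d0 t; by field.
have pr w i al : W0 w -> partial (rgt i) (yl al) w = 0.
  by move=> Ww; exact: (partial_lsub_r oB _ (sy al) Ww).
pose Q w : 'rV[R]_(n + n) := row_mx (\row_al yl al w) (\row_al q al w).
have Ql al : (fun w => Q w 0 (lft al)) = yl al.
  by apply/funext => w; rewrite row_mxEl mxE.
have Qr al : (fun w => Q w 0 (rgt al)) = q al.
  by apply/funext => w; rewrite row_mxEr mxE.
have sQ : smooth_map N Q.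
  move=> c; case: (split_ordP c) => al ->; first by rewrite Ql; exact: smooth_sub NW0 (syl al).
  by rewrite Qr.
(* [K] passes from (p, q) to u = (p + q) / 2 and v = (p - q) / 2, turning the diagonal action [D] of
   J into the exchange [Sw]. *)
pose K : 'M[R]_(n + n) := 2^-1 *: block_mx 1%:M 1%:M 1%:M (- 1%:M).
pose Sw : 'M[R]_(n + n) := block_mx 0 1%:M 1%:M 0.
pose D : 'M[R]_(n + n) := block_mx 1%:M 0 0 (- 1%:M).
have KS : K *m Sw = D *m K.
  rewrite /K -scalemxAl -scalemxAr; congr (_ *: _); rewrite !mulmx_block.
  by rewrite !(mulmx0, mul0mx, mulmx1, mul1mx, addr0, add0r, mulmxN, mulNmx, opprK).
have uK : K \in unitmx.
  have KK : K *m block_mx 1%:M 1%:M 1%:M (- 1%:M) = 1%:M.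
    rewrite /K -scalemxAl mulmx_block !mulmxN !mulNmx !mulmx1 !opprK subrr.
    rewrite scale_block_mx !scaler0 (_ : 2^-1 *: (1%:M + 1%:M) = 1%:M) -?scalar_mx_block //.
    by apply/matrixP => b c; rewrite !mxE; move: ((b == c)%:R : R) => t; field.
  by case: (mulmx1_unit KK).
have JQ w : N w -> block_mx 1%:M (- Phi w) 0 (- 1%:M) *m jacm Q w = jacm Q w *m D.
  move=> Nw; have Ww := NW0 _ Nw; apply/matrixP => b c.
  have mulD (A : 'M[R]_(n + n)) : A *m D = row_mx (lsubmx A) (- rsubmx A).
    by rewrite -{1}[A]hsubmxK mul_row_block !mulmx0 mulmxN !mulmx1 add0r addr0.
  have Dl (A : 'M[R]_(n + n)) al : (A *m D) b (lft al) = A b (lft al).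
    by rewrite mulD row_mxEl mxE.
  have Dr (A : 'M[R]_(n + n)) al : (A *m D) b (rgt al) = - A b (rgt al).
    by rewrite mulD row_mxEr !mxE.
  have jl d al : jacm Q w d (lft al) = partial d (yl al) w by rewrite mxE Ql.
  have jr d al : jacm Q w d (rgt al) = partial d (q al) w by rewrite mxE Qr.
  case: (split_ordP c) => al ->; rewrite ?Dl ?Dr; case: (split_ordP b) => i ->;
    rewrite ?mul_para_l ?mul_para_r.
  - rewrite big1 ?subr0 // => j _; by rewrite jl pr // mulr0.
  - by rewrite !jl pr // oppr0.
  - have -> : \sum_j Phi w i j * jacm Q w (rgt j) (rgt al) =
        \sum_j Phi w i j * partial (rgt j) (q al) w.
      by apply: eq_bigr => j _; rewrite jr.
    rewrite jr; have := Lq w i al Nw; rewrite /lift_deriv.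
    move: (partial _ _ _) (\sum_j _) => s t H; lra.
  - by [].
pose F w := Q w *m K.
have sF : smooth_map N F by exact: smooth_mulr.
have JF w : N w -> jacm F w = jacm Q w *m K by move=> Nw; exact: jacm_mulr sQ Nw.
pose w0 : 'rV[R]_(n + n) := row_mx x0 xi0.
have lw0 : lsubmx w0 = x0 by rewrite row_mxKl.
have Ww0 : W0 w0 by rewrite /W0 /= lw0.
(* The affine coordinates vanish at [x0], so [den] is 1 on the whole fibre over [x0] and every
   covector [xi0] is covered. *)
have S0 : S w0 = 0 by rewrite /S big1 // => al _; rewrite /yl lw0 y0 mul0r.
have d0 : den w0 = 1 by rewrite /den S0 mulr0 addr0.
have Nw0 : N w0 by split=> //; rewrite d0 oner_neq0.
have uF : jacm F w0 \in unitmx.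
  rewrite JF // unitmx_mul uK andbT.
  (* The frame is the identity at [x0], and the derivative of [den] in the fibre drops out because
     the coordinates y vanish there. *)
  have -> : jacm Q w0 = block_mx 1%:M (\matrix_(i, al) partial (lft i) (q al) w0) 0 1%:M.
    apply/matrixP => b c; rewrite [LHS]mxE.
    case: (split_ordP c) => al ->; rewrite ?Ql ?Qr; case: (split_ordP b) => i ->.
    - by rewrite block_mxEul (partial_lsub_l oB _ (sy al) Ww0) dy // lw0 T0.
    - by rewrite block_mxEdl pr // mxE.
    - by rewrite block_mxEur mxE.
    - rewrite block_mxEdr.
      rewrite (partialM (smooth_derivable (smooth_sub NW0 (syp al)) Nw0)
        (smooth_derivable sdV Nw0)).
      have dd : partial (rgt i) den w0 = - 2^-1 * \sum_be yl be w0 * partial (rgt i) (yp be) w0.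
        have dS := smooth_derivable (i := rgt i) sS Ww0.
        have dc := smooth_derivable (i := rgt i) (smooth_cst (U := W0) 1) Ww0.
        rewrite (partialD dc (derivable_mulc dS)) partial_cst add0r (partialZ _ dS).
        congr (_ * _); rewrite (partial_bigsum _ _ Ww0 syy); apply: eq_bigr => be _.
        rewrite (partialM (smooth_derivable (syl be) Ww0) (smooth_derivable (syp be) Ww0)).
        by rewrite pr // mulr0 addr0.
      rewrite (partialV _ (smooth_derivable sdN Nw0)) ?d0 ?oner_neq0 // dd.
      rewrite big1 => [|be _]; last by rewrite /yl lw0 y0 mul0r.
      rewrite !mulr0 add0r invr1 mul1r dyr // lw0 /E T0 invmx1 !mxE.
      by rewrite eq_sym.
  by rewrite unitmxE det_ublock !det1 mulr1 unitr1.
have [V [H [Vw0 VN coo FH]]] := inverse_function oN Nw0 sF uF.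
exists V, F, H; split=> //.
  by move=> w /VN/NW0/BU.
move=> w i Vw; have Nw := VN w Vw.
have JA : block_mx 1%:M (- Phi w) 0 (- 1%:M) *m jacm F w = jacm F w *m Sw.
  by rewrite JF // mulmxA JQ // -!mulmxA KS.
have BJ := mulmx_conj (mulmx1C (FH w Vw)) (esym JA).
have rE c : partial_map c H (F w) = row c (jacm H (F w)).
  by apply/rowP => d; rewrite !mxE.
by rewrite !rE /para_J -!row_mul -BJ row_swap_mul_l row_swap_mul_r.
Qed.

End flat_para_coordinates.

Theorem theorem1p6 (R : realType) (n : nat) (M : affine_manifold R n) :
  [<-> flat M; integrable_para M; third_gray M; para_jacobi_commutes M].
Proof.
have f2i : flat M -> integrable_para M.
  move=> /flatP flM z a az.
  have Ux : (chart_map a @` chart_dom a) (chart_map a (foot z)) by exists (foot z).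
  exact (@flat_integrable_at R n M a (fun x i j k l => flM a x i j k l) _ _ Ux).
have i2f : integrable_para M -> flat M.
  move=> iM; apply/flatP => a _ i j k l [p ap <-].
  have [V [F [H [Vw VW coo JH]]]] := iM (zero_covector p) a ap.
  exact: integrable_flat_at Vw VW coo JH.
have f2g : flat M -> third_gray M.
  move=> /flatP flM z a az /= X Y Z V; apply: flat_gray; first exact: cot_imageP.
  move=> i j k l; apply: flM; exact: cot_imageP.
have g2c : third_gray M -> para_jacobi_commutes M.
  move=> gM z a az /= P _ xi _ _; apply: gray_commutes; first exact: cot_imageP.
  exact: gM z a az.
have c2f : para_jacobi_commutes M -> flat M.
  move=> cM; apply/flatP => a _ i j k l [p ap <-].
  have Ww := @cot_imageP R n M a (zero_covector p) ap.
  have := @commutes_flat R n M a _ Ww (cM (zero_covector p) a ap) i j k l.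
  by rewrite row_mxKl.
(* The third Gray identity is reached from integrability through flatness. *)
tfae; [exact: f2i|by move/i2f/f2g|exact: g2c|exact: c2f].
Qed.
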